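(* Let $(M,g)$ and $(N,h)$ be $n$-dimensional Riemannian manifolds, $n\geq 3$, possibly with boundaries. Assume that the Riemannian metrics $g$ and $h$ are both of class $C^{k+\alpha}$ (respectively both $C^\infty$, respectively both real analytic $C^\omega$), where $k\in\mathbb{N}$, $k\geq 2$ and $\alpha\in(0,1)$. Let $F:M\to N$ be a $C^3$ smooth locally diffeomorphic conformal mapping, i.e. $F^*h=c\,g$ in $M$, where $c$ is a function on $M$. If $\partial M\neq\emptyset$, assume also that $\partial N\neq\emptyset$, that $g$ and $h$ are $C^{k+\alpha}$ (respectively $C^\infty$, $C^\omega$) up to the boundary, that $F$ is $C^3$ up to the boundary, and that $F(\partial M)\subset\partial N$. Then $F$ and its local inverses are of class $C^{k+1+\alpha}$ (respectively $C^\infty$, $C^\omega$), up to the boundary if $\partial M\neq\emptyset$.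
   Context: $C^{k+\alpha}$ denotes the Hölder class $C^{k,\alpha}$. If a metric is $C^{r}$, the atlas of the manifold is assumed to have $C^{r+1}$ transition functions (in particular the boundary is $C^{r+1}$), and the metric is $C^r$ up to $\{x^n=0\}$ in boundary charts of the atlas; if the metric is $C^\infty$ or $C^\omega$, the transition functions are assumed to be $C^\infty$ or $C^\omega$ respectively. Regularity of $F$ is understood with respect to these atlases. *)

(* Defs.v *)
From mathcomp Require Export all_boot all_order all_algebra.
From mathcomp Require Export all_classical all_reals all_analysis.
Export Order.TTheory GRing.Theory Num.Theory numFieldNormedType.Exports.

Global Set Implicit Arguments.
Global Unset Strict Implicit.
Global Unset Printing Implicit Defensive.

Global Open Scope classical_set_scope.
Global Open Scope ring_scope.

(* Hol k a is C^{k+a} = C^{k,a}, with the Hölder condition understood locally,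
   i.e. near every point of the domain, boundary points included. *)
Inductive regularity (R : realType) :=
| Ck of nat
| Hol of nat & R
| Cinfty
| Comega.
Arguments Ck {R}.
Arguments Cinfty {R}.
Arguments Comega {R}.

Definition rsucc (R : realType) (r : regularity R) : regularity R :=
  match r with
  | Ck k => Ck k.+1
  | Hol k a => Hol k.+1 a
  | Cinfty => Cinfty
  | Comega => Comega
  end.

Definition metric_regularity (R : realType) (r : regularity R) : Prop :=
  match r with
  | Ck _ => False
  | Hol k a => (2 <= k)%N /\ 0 < a < 1
  | Cinfty => True
  | Comega => True
  end.

Section Regularity_in_coordinates.
Variables (R : realType) (n : nat).

(* U is meant to be open in R^n or relatively open in a closed half-space; then
   U is contained in the closure of its interior, so g below is unique on U. *)
Fixpoint Ck_with (P : set 'rV[R]_n -> ('rV[R]_n -> R) -> Prop) (k : nat)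
    (U : set 'rV[R]_n) (f : 'rV[R]_n -> R) : Prop :=
  if k is k'.+1 then
    {within U, continuous f} /\
    forall i : 'I_n, exists2 g : 'rV[R]_n -> R,
      Ck_with P k' U g &
      forall x, U^° x -> is_derive x (delta_mx 0 i : 'rV[R]_n) f (g x)
  else P U f.

Definition locally_holder (a : R) (U : set 'rV[R]_n) (f : 'rV[R]_n -> R) :=
  forall x, U x -> exists2 V, nbhs x V & exists C : R,
    forall y z, (U `&` V) y -> (U `&` V) z ->
      `|f y - f z| <= C * `|y - z| `^ a.

(* Around every point x of U, f is the sum of an absolutely convergent power
   series; b runs over the multi-indices of length m. At points x on the
   boundary of U the equality with f is required on U only. *)
Definition analytic_on (U : set 'rV[R]_n) (f : 'rV[R]_n -> R) :=
  forall x, U x -> exists (a : ('I_n -> nat) -> R) (rho : R),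
    [/\ 0 < rho,
        cvgn [series (\sum_(b : {ffun 'I_n -> 'I_m.+1} | (\sum_i b i == m)%N)
                        `|a (fun i => b i)|) * rho ^+ m]_m &
        forall y, U y -> `|y - x| < rho ->
          [series \sum_(b : {ffun 'I_n -> 'I_m.+1} | (\sum_i b i == m)%N)
             a (fun i => b i) * \prod_i (y 0 i - x 0 i) ^+ b i]_m @ \oo --> f y].

Definition of_class (r : regularity R) (U : set 'rV[R]_n) (f : 'rV[R]_n -> R) :=
  match r with
  | Ck k => Ck_with (fun U f => {within U, continuous f}) k U f
  | Hol k a => Ck_with (locally_holder a) k U f
  | Cinfty =>
      forall k, Ck_with (fun U f => {within U, continuous f}) k U f
  | Comega => analytic_on U f
  end.

(* Row-vector convention: f y = f x + (y - x) *m J + o(y - x) as y -> x in U,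
   one-sidedly if x lies on the boundary of U. *)
Definition is_jacobian_within (U : set 'rV[R]_n) (f : 'rV[R]_n -> 'rV[R]_n)
    (x : 'rV[R]_n) (J : 'M[R]_n) :=
  forall eps : R, 0 < eps -> \forall y \near within U (nbhs x),
    `|f y - f x - (y - x) *m J| <= eps * `|y - x|.

Definition jacobian_within (U : set 'rV[R]_n) (f : 'rV[R]_n -> 'rV[R]_n)
    (x : 'rV[R]_n) : 'M[R]_n :=
  xget 0 [set J | is_jacobian_within U f x J].

Definition pullback (U : set 'rV[R]_n) (f : 'rV[R]_n -> 'rV[R]_n)
    (G : 'rV[R]_n -> 'M[R]_n) (x : 'rV[R]_n) : 'M[R]_n :=
  jacobian_within U f x *m G (f x) *m (jacobian_within U f x)^T.

(* The hypothesis i.+1 = n selects the last coordinate x^n. *)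
Definition half_space : set 'rV[R]_n :=
  [set x | forall i : 'I_n, i.+1 = n -> 0 <= x 0 i].

Definition half_space_face : set 'rV[R]_n :=
  [set x | forall i : 'I_n, i.+1 = n -> x 0 i = 0].

Definition open_in_half_space (U : set 'rV[R]_n) :=
  exists2 W : set 'rV[R]_n, open W & U = W `&` half_space.

End Regularity_in_coordinates.
Arguments half_space {R n}.
Arguments half_space_face {R n}.

(* cinv is only meaningful on the image of the chart. *)
Record chart (R : realType) (n : nat) (M : topologicalType) := Chart {
  cdom : set M;
  cfun :> M -> 'rV[R]_n;
  cinv : 'rV[R]_n -> M;
  cdom_open : open cdom;
  cimage_open : open (cfun @` cdom) \/ open_in_half_space (cfun @` cdom);
  cfunK : forall p, cdom p -> cinv (cfun p) = p;
  cfun_continuous : {within cdom, continuous cfun};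
  cinv_continuous : {within cfun @` cdom, continuous cinv}
}.

Definition cimage (R : realType) (n : nat) (M : topologicalType)
  (e : chart R n M) : set 'rV[R]_n := e @` cdom e.

Section Coordinate_representation.
Variables (R : realType) (n : nat) (M N : topologicalType).
Implicit Types (F : M -> N) (d : chart R n M) (e : chart R n N).

Definition rep F d e : 'rV[R]_n -> 'rV[R]_n := e \o F \o cinv d.

Definition rep_dom (A : set M) F d e : set 'rV[R]_n :=
  cimage d `&` cinv d @^-1` (A `&` F @^-1` cdom e).

End Coordinate_representation.

(* n-manifold, possibly with boundary, whose transition functions (the
   coordinate representations of the identity) are of class s. *)
Record manifold (R : realType) (n : nat) (s : regularity R) := Manifold {
  carrier :> topologicalType;
  manifold_hausdorff : hausdorff_space carrier;
  manifold_second_countable : @second_countable carrier;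
  atlas : set (chart R n carrier);
  atlas_cover : forall p, exists2 e, atlas e & cdom e p;
  atlas_class : forall d e, atlas d -> atlas e -> forall j : 'I_n,
    of_class s (rep_dom setT id d e) (fun x => rep id d e x 0 j)
}.

Definition boundary (R : realType) (n : nat) (s : regularity R)
    (M : manifold n s) : set M :=
  [set p | exists e : chart R n M,
    [/\ atlas e, cdom e p, open_in_half_space (cimage e)
      & half_space_face (e p)]].

Arguments boundary {R n s} M _.

(* A Riemannian metric of class r, given by its coordinate matrices in the
   charts of the atlas. *)
Record metric (R : realType) (n : nat) (s : regularity R) (r : regularity R)
    (M : manifold n s) := Metric {
  gmx :> chart R n M -> 'rV[R]_n -> 'M[R]_n;
  metric_class : forall e, atlas e -> forall i j : 'I_n,
    of_class r (cimage e) (fun x => gmx e x i j);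
  metric_sym : forall e, atlas e -> forall x, cimage e x ->
    (gmx e x)^T = gmx e x;
  metric_pos : forall e, atlas e -> forall x, cimage e x ->
    forall v : 'rV[R]_n, v != 0 -> 0 < (v *m gmx e x *m v^T) 0 0;
  metric_compat : forall d e, atlas d -> atlas e ->
    forall x, rep_dom setT id d e x ->
    gmx d x = pullback (rep_dom setT id d e) (rep id d e) (gmx e) x
}.

Section Maps_between_manifolds.
Variables (R : realType) (n : nat) (s t : regularity R).

(* A is meant to be open in M. *)
Definition map_of_class (M : manifold n s) (N : manifold n t)
    (r : regularity R) (A : set M) (F : M -> N) :=
  {within A, continuous F} /\
  forall (d : chart R n M) (e : chart R n N), atlas d -> atlas e ->
    forall j : 'I_n,
      of_class r (rep_dom A F d e) (fun x => rep F d e x 0 j).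

Definition local_inverse (M : manifold n s) (N : manifold n t)
    (U : set M) (F : M -> N) (G : N -> M) :=
  [/\ open U, open (F @` U) & forall p, U p -> G (F p) = p].

End Maps_between_manifolds.

Definition local_diffeo (R : realType) (n : nat) (s t : regularity R)
    (M : manifold n s) (N : manifold n t) (r : regularity R) (F : M -> N) :=
  map_of_class r setT F /\
  forall p : M, exists (U : set M) (G : N -> M),
    [/\ U p, local_inverse U F G & map_of_class r (F @` U) G].

(* F^* h = c g, read in the charts of the atlases. *)
Definition conformal (R : realType) (n : nat) (s t r q : regularity R)
    (M : manifold n s) (N : manifold n t) (g : metric r M) (h : metric q N)
    (F : M -> N) :=
  exists c : M -> R, forall p (d : chart R n M) (e : chart R n N),
    atlas d -> atlas e -> cdom d p -> cdom e (F p) ->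
    pullback (rep_dom setT F d e) (rep F d e) (h e) (d p) = c p *: g d (d p).

(* Main.v *)
Require Import Defs.
From mathcomp Require Import ring lra zify.

(** No elliptic theory is used: in charts, a conformal map [Q] with Jacobian [A]
    and factor [c], [A h(Q) A^T = c g], solves a total differential system.
    Differentiating this identity expresses the derivatives of [A] through
    [A], [c], [dc] and the first jets of [g] and [h o Q] (Koszul's formula).
    Differentiating once more and using the symmetry of third derivatives of [Q]
    gives a linear equation for the Hessian of [c], which can be solved by
    contraction since [n >= 3].  So all first derivatives of [(A, c, 1/c, dc, g^-1)]
    are polynomials in these functions and in the second jets of [g] and [h o Q].
    A bootstrap along this system gives the Hölder and the smooth cases; in the
    analytic case it propagates bounds [K M^l l! / (l+1)^2] on the derivatives of
    order [l], and Taylor's formula concludes.  Nothing happens at the boundary,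
    because every estimate passes to the limit from interior points.  The inverse
    map is treated in the same way, its Jacobian being [A^-1] along the map. *)

(** * Domains in a half-space *)

(** The functions [1/c] and [g^-1] are carried along as unknowns so that the right-hand sides
    contain no division: they are polynomials, and the Leibniz rule alone controls all their
    derivatives. Since [F] is $C^3$, its Jacobian is $C^2$ and the conformality identity can be
    differentiated twice; the factor [c], on which no regularity is assumed, becomes $C^2$ as a
    trace of [g^-1 A h A^T] divided by [n]. The closed system by itself loses one derivative: it
    contains second jets of the metrics, so metrics of class $k+2$ only give [A] of class $k+1$. The
    missing order comes from Koszul's formula, in which [dA] depends on first jets only, once [dc]
    is known to be of class $k+1$. A local inverse is given only as a set-theoretic one; near each
    point it has to be identified with a $C^3$ inverse supplied by the local diffeomorphism before
    its Jacobian can be used. *)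

Section Relative_domains.
Variables (R : realType) (n : nat).
Notation E := 'rV[R]_n.
Implicit Types (U V W : set E) (x y z v : E) (f : E -> R).

Definition basis_vec (i : 'I_n) : E := delta_mx 0 i.

Lemma coord_le x i : `|x 0 i| <= `|x|.
Proof.
rewrite [leRHS]/Num.norm /= mx_normrE.
exact: (le_bigmax _ (fun ij : 'I_1 * 'I_n => `|x ij.1 ij.2|) (0, i)).
Qed.

Lemma rV_norm_le x (c : R) : 0 <= c -> (forall i, `|x 0 i| <= c) -> `|x| <= c.
Proof.
move=> c0 h; rewrite [leLHS]/Num.norm /= mx_normrE; apply: bigmax_le => //.
by move=> [a i] _ /=; rewrite ord1.
Qed.

Lemma norm_basis_vec_le i : `|basis_vec i| <= 1.
Proof.
apply: rV_norm_le => // j; rewrite /basis_vec mxE eqxx /=.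
by case: eqP; rewrite ?normr1 ?normr0.
Qed.

Definition hs (b : bool) : set E := [set x | b -> half_space x].
Definition hsi (b : bool) : set E :=
  [set x | b -> forall i : 'I_n, i.+1 = n -> 0 < x 0 i].

(* b = true: relatively open in the half-space; b = false: open. *)
Definition rdom U := exists b W, open W /\ U = W `&` hs b.

Lemma rdomP U : open U \/ open_in_half_space U -> rdom U.
Proof.
case=> [oU|[W oW ->]]; last by exists true, W; split=> //; apply/seteqP; split=> x [? h]; split=> //; exact: h.
by exists false, U; split=> //; apply/seteqP; split=> [x|x []].
Qed.

Lemma rdomI U W : rdom U -> open W -> rdom (U `&` W).
Proof.
move=> [b [W' [oW' ->]]] oW; exists b, (W' `&` W); split; first exact: openI.
by rewrite -!setIA (setIC W).
Qed.

Lemma nbhs_normE x (P : set E) :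
  nbhs x P <-> exists2 d : R, 0 < d & forall y, `|y - x| < d -> P y.
Proof.
split.
  move/nbhs_ballP=> [d /= d0 h]; exists d => // y yx; apply: h.
  by rewrite -ball_normE /= distrC.
move=> [d d0 h]; apply/nbhs_ballP; exists d => //= y; rewrite -ball_normE /= distrC.
exact: h.
Qed.

Lemma nbhsI_le x (d d' : R) y : `|y - x| < Num.min d d' -> `|y - x| < d /\ `|y - x| < d'.
Proof. by rewrite lt_min => /andP. Qed.

Definition nball x (d : R) : set E := [set y | `|y - x| < d].

Lemma open_nball x (d : R) : open (nball x d).
Proof.
rewrite openE => y /= yx; apply/nbhs_normE; exists (d - `|y - x|).
  by rewrite subr_gt0.
move=> z zy; rewrite /nball /=; have := ler_distD y z x; lra.
Qed.

(** Local arguments take place in a sup-norm ball cut by a half-space: this set is convex, and its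
    points off the face are interior to [U]. *)
Lemma rdom_box U x : rdom U -> U x -> exists b (d : R),
  [/\ 0 < d, U `<=` hs b, (forall y, `|y - x| < d -> hs b y -> U y) &
     forall y, `|y - x| < d -> hsi b y -> U° y].
Proof.
move=> [b [W [oW ->]]] [Wx hx].
have /nbhs_normE[d d0 h] : nbhs x W by apply: open_nbhs_nbhs.
exists b, d; split=> //; first by move=> y /h.
move=> y yx hy; rewrite interiorI; split; first by have /interior_id -> := oW; apply: h.
case: b hx hy => [_ hy|_ _]; last by apply/nbhs_normE; exists 1.
(* In dimension 0 no index is the last one, so the half-space is everything. *)
have [/eqP n0|n0] := boolP (n == 0%N).
  by apply/nbhs_normE; exists 1 => // z _ _ i; have := ltn_ord i; rewrite {2}n0.
have nP : (n.-1 < n)%N by rewrite prednK // lt0n.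
pose l := Ordinal nP.
have l0 : 0 < y 0 l by apply: hy => //=; rewrite prednK // lt0n.
apply/nbhs_normE; exists (y 0 l) => // z zy _ i iE.
have -> : i = l by apply: val_inj; apply: succn_inj; rewrite iE /= prednK // lt0n.
have := le_lt_trans (coord_le (z - y) l) zy; rewrite !mxE ltr_norml => /andP[? _]; lra.
Qed.

Lemma hsi_hs b : hsi b `<=` hs b.
Proof. by move=> x hx bT i iE; apply/ltW/hx. Qed.

Lemma hsi_convex b x y (t : R) : 0 <= t <= 1 -> hsi b x -> hsi b y ->
  hsi b (x + t *: (y - x)).
Proof.
move=> /andP[t0 t1] hx hy bT i iE; rewrite !mxE.
have := hx bT i iE; have := hy bT i iE => ? ?; nra.
Qed.

Lemma ball_convex x y z (t d : R) : 0 <= t <= 1 -> `|y - x| < d -> `|z - x| < d ->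
  `|y + t *: (z - y) - x| < d.
Proof.
move=> /andP[t0 t1] yx zx.
have -> : y + t *: (z - y) - x = (1 - t) *: (y - x) + t *: (z - x).
  by apply/rowP=> i; rewrite !mxE; ring.
apply: le_lt_trans (ler_normD _ _) _; rewrite !normrZ !ger0_norm ?subr_ge0 //.
set a := `|y - x| in yx *; set b := `|z - x| in zx *.
have [->|tn0] := eqVneq t 0; first by rewrite subr0 mul1r mul0r addr0.
have tp : 0 < t by rewrite lt_def tn0.
have : (1 - t) * a <= (1 - t) * d by rewrite ler_wpM2l ?subr_ge0 // ltW.
have : t * b < t * d by rewrite ltr_pM2l.
lra.
Qed.

(** All coordinates are shifted, so that no last index has to be named; only the last one matters
    for leaving the face. *)
Definition inward (e : R) : E := const_mx e.

Lemma norm_inward (e : R) : `|inward e| <= `|e|.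
Proof. by apply: rV_norm_le => // i; rewrite mxE. Qed.

Lemma hsi_inward b x (e : R) : 0 < e -> hs b x -> hsi b (x + inward e).
Proof. by move=> e0 hx bT i iE; rewrite !mxE; have := hx bT i iE; lra. Qed.

Definition econt U f := forall x, U x -> forall e : R, 0 < e ->
  exists2 d : R, 0 < d & forall y, U y -> `|y - x| < d -> `|f y - f x| < e.

Lemma within_econt U f : {within U, continuous f} <-> econt U f.
Proof.
split.
  move=> /subspace_continuousP cf x Ux e e0.
  have := cf x Ux; move=> /cvgrPdist_lt /(_ e e0); rewrite near_withinE.
  move=> /nbhs_normE[d d0 h]; exists d => // y Uy yx.
  by rewrite distrC; apply: h.
move=> cf; apply/subspace_continuousP => x Ux.
apply/cvgrPdist_lt => e e0; rewrite near_withinE.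
have [d d0 h] := cf x Ux e e0; apply/nbhs_normE; exists d => // y yx Uy.
by rewrite distrC; apply: h.
Qed.

Lemma econtS U V f : V `<=` U -> econt U f -> econt V f.
Proof.
move=> VU cf x Vx e e0; have [d d0 h] := cf x (VU _ Vx) e e0.
by exists d => // y /VU; apply: h.
Qed.

Lemma eq_econt U f g : (forall x, U x -> f x = g x) -> econt U f -> econt U g.
Proof.
move=> fg cf x Ux e e0; have [d d0 h] := cf x Ux e e0.
by exists d => // y Uy yx; rewrite -!fg //; exact: h.
Qed.

(** A common radius exists because each condition is required to survive shrinking: finitely many of
    them then hold together near 0 on the right. *)
Lemma fin_delta (I : finType) (P : I -> R -> Prop) :
  (forall i, exists2 d : R, 0 < d & forall d', 0 < d' <= d -> P i d') ->
  exists2 d : R, 0 < d & forall i, P i d.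
Proof.
move=> h; have : \forall d \near (0:R)^'+, forall i, P i d.
  apply: filter_forall => i; have [d d0 hd] := h i.
  near=> d'; apply: hd; apply/andP; split; near: d'.
    exact: nbhs_right_gt.
  exact: nbhs_right_le.
move=> hn; have : \forall d \near (0:R)^'+, 0 < d /\ forall i, P i d.
  near=> d; split; [near: d; exact: nbhs_right_gt|near: d; exact: hn].
by move=> /filter_ex[d [d0 hd]]; exists d.
Unshelve. all: by end_near. Qed.

Lemma line_is_derive f x v (t : R) (df : R) :
  is_derive (x + t *: v) v f df -> is_derive t (1 : R) (fun s : R => f (x + s *: v)) df.
Proof.
move=> [dd dv].
have eqf : (fun h : R => h^-1 *: (((fun s : R => f (x + s *: v)) \o shift t) (h *: (1:R)) - f (x + t *: v)))
   = (fun h : R => h^-1 *: ((f \o shift (x + t *: v)) (h *: v) - f (x + t *: v))).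
  apply/funext => h /=; congr (_ *: (f _ - _)).
  by rewrite [h *: (1:R)]mulr1 scalerDl addrCA.
by constructor; [rewrite /derivable eqf|rewrite /derive eqf].
Qed.

(** Comparing [dphi] with a constant [G] turns the mean value theorem into a first-order estimate.
    The order of [a] and [b] is free, so increments of either sign are covered. *)
Lemma mvt_bound (phi dphi : R -> R) (a b G e : R) :
  (forall s : R, (a <= s <= b) || (b <= s <= a) ->
     is_derive s (1:R) phi (dphi s) /\ `|dphi s - G| <= e) ->
  `|phi b - phi a - (b - a) * G| <= e * `|b - a|.
Proof.
wlog ab : a b / a <= b => [hw|] h.
  have [ab|/ltW ba] := leP a b; first exact: hw.
  rewrite [`|b - a|]distrC; have -> : phi b - phi a - (b - a) * G = - (phi a - phi b - (a - b) * G) by ring.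
  by rewrite normrN; apply: hw => // s; rewrite orbC; apply: h.
have hd s : s \in `]a, b[%R -> is_derive s (1:R) phi (dphi s).
  by rewrite in_itv /= => /andP[as_ sb]; have [] := h s; rewrite ?(ltW as_) ?(ltW sb).
have hc : {within `[a, b], continuous phi}.
  apply: derivable_within_continuous => s; rewrite in_itv /= => sab.
  by have [|[]] := h s; rewrite ?sab.
have [c cab ->] := MVT_segment ab hd hc.
move: cab; rewrite in_itv /= => cab.
have -> : dphi c * (b - a) - (b - a) * G = (dphi c - G) * (b - a) by ring.
by rewrite normrM ler_wpM2r //; apply: (h c _).2; rewrite cab.
Qed.

(** $C^1$ up to the boundary: [g] is the derivative at interior points only and is pinned down
    elsewhere by its continuity. *)
Definition C1on U f (g : 'I_n -> E -> R) :=
  [/\ econt U f, (forall i, econt U (g i)) &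
     forall i x, U° x -> is_derive x (basis_vec i) f (g i x)].

End Relative_domains.

(** * Strict differentiability up to the boundary *)

Section Strict.
Variables (R : realType) (n : nat).
Notation E := 'rV[R]_n.
Notation e_ := (@basis_vec R n).
Implicit Types (U V W : set E) (x y z v : E) (f : E -> R).

Lemma rV_norm_lt x (c : R) : 0 < c -> (forall i, `|x 0 i| < c) -> `|x| < c.
Proof.
move=> c0 h; rewrite [ltLHS]/Num.norm /= mx_normrE; apply/bigmax_ltP; split=> //.
by move=> [a i] _ /=; rewrite ord1.
Qed.

(** Travel from [z] to [y] along a broken line that changes one coordinate at a time; each of the
    [n] legs is a one-variable mean value estimate. *)
Lemma path_bound b x (d eta : R) f (g : 'I_n -> E -> R) y z : 0 <= eta ->
  (forall p, `|p - x| < d -> hsi b p -> forall i,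
     is_derive p (e_ i) f (g i p) /\ `|g i p - g i x| <= eta) ->
  `|y - x| < d -> `|z - x| < d -> hsi b y -> hsi b z ->
  `|f y - f z - \sum_i (y - z) 0 i * g i x| <= eta * n%:R * `|y - z|.
Proof.
move=> eta0 h yx zx hy hz.
have d0 : 0 < d by apply: le_lt_trans yx.
pose p k : E := \row_i (if (i < k)%N then y 0 i else z 0 i).
have -> : f y = f (p n) by congr f; apply/rowP => i; rewrite mxE ltn_ord.
have pE k (kn : (k < n)%N) : p k.+1 = p k + (y - z) 0 (Ordinal kn) *: e_ (Ordinal kn).
  apply/rowP => i; rewrite !mxE eqxx /= ltnS leq_eqVlt.
  have -> : (i == Ordinal kn) = (nat_of_ord i == k) by [].
  case: (eqVneq (nat_of_ord i) k) => [ik|_] /=; last by rewrite mulr0 addr0.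
  have -> : Ordinal kn = i by apply: val_inj.
  by rewrite ik ltnn; ring.
suff: forall k, (k <= n)%N ->
   `|f (p k) - f z - \sum_(i < n | (i < k)%N) (y - z) 0 i * g i x| <= eta * k%:R * `|y - z|.
  by move=> /(_ n (leqnn n)); rewrite (eq_bigl (fun=> true)) // => i; rewrite ltn_ord.
elim=> [|k IH] kn.
  have -> : p 0%N = z by apply/rowP => i; rewrite mxE.
  by rewrite big_pred0 // subrr subr0 normr0 mulr0 mul0r.
have := IH (ltnW kn); set Sk := \sum_(i < n | (i < k)%N) _ => {}IH.
pose o := Ordinal kn.
have -> : \sum_(i < n | (i < k.+1)%N) (y - z) 0 i * g i x = Sk + (y - z) 0 o * g o x.
  rewrite (bigD1 o) //= addrC; congr (_ + _); apply: eq_bigl => i.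
  rewrite ltnS leq_eqVlt.
  have -> : (i == o) = (nat_of_ord i == k) by [].
  by case: (eqVneq (nat_of_ord i) k) => [->|_] /=; rewrite ?ltnn ?andbF ?andbT.
set D := (y - z) 0 o.
have mv : `|f (p k + D *: e_ o) - f (p k + 0 *: e_ o) - (D - 0) * g o x| <= eta * `|D - 0|.
  apply: (@mvt_bound R (fun s => f (p k + s *: e_ o)) (fun s => g o (p k + s *: e_ o))) => s sD.
  (* Each coordinate on the path lies between those of [z] and [y], with a parameter depending on
     the coordinate. Sup-norm balls and half-spaces are coordinatewise conditions, so the path stays
     inside. *)
  have coordE i : exists2 t : R, 0 <= t <= 1 & (p k + s *: e_ o) 0 i = z 0 i + t * (y 0 i - z 0 i).
    rewrite !mxE eqxx /=; case: (eqVneq i o) => [->|io] /=.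
      rewrite ltnn mulr1.
      have [D0|D0] := eqVneq D 0.
        exists 0; [by rewrite lexx ler01|rewrite mul0r]; congr (_ + _); move: sD; rewrite D0.
        by rewrite orbb => /andP[? ?]; lra.
      exists (s / D); last by rewrite /D !mxE divfK // -[_ - _]/(_ - _); move: D0; rewrite /D !mxE.
      case/orP: sD => /andP[s0 s1].
        have Dp : 0 < D by rewrite lt_def D0 (le_trans s0).
        by rewrite divr_ge0 ?(ltW Dp) //= ler_pdivrMr // mul1r.
      have Dp : D < 0 by rewrite lt_def eq_sym D0 (le_trans s0).
      by rewrite -mulrNN -invrN divr_ge0 ?oppr_ge0 ?(ltW Dp) //= ler_pdivrMr ?oppr_gt0 // mul1r lerN2.
    rewrite mulr0 addr0; case: ifP => _; [exists 1|exists 0]; rewrite ?lexx ?ler01 //; ring.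
  have hp : hsi b (p k + s *: e_ o).
    move=> bT i iE; have [t /andP[t0 t1] ->] := coordE i.
    have := hy bT i iE; have := hz bT i iE => ? ?; nra.
  have np : `|p k + s *: e_ o - x| < d.
    apply: rV_norm_lt => // i; have [t t01 E] := coordE i.
    have -> : (p k + s *: e_ o - x) 0 i = (z + t *: (y - z) - x) 0 i.
      by rewrite mxE E !mxE.
    by apply: le_lt_trans (coord_le _ _) _; apply: ball_convex.
  by have [di ei] := h _ np hp o; split => //; apply: line_is_derive.
rewrite pE -/o -/D.
rewrite scale0r addr0 subr0 in mv.
have -> : f (p k + D *: e_ o) - f z - (Sk + D * g o x) =
  (f (p k + D *: e_ o) - f (p k) - D * g o x) + (f (p k) - f z - Sk) by ring.
apply: le_trans (ler_normD _ _) _.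
have DD : `|D| <= `|y - z| by apply: coord_le.
have : eta * `|D| <= eta * `|y - z| by rewrite ler_wpM2l.
by rewrite -natr1; move: mv IH; lra.
Qed.

(** Both points are free near [x]. In this form the estimate passes from pairs of interior points to
    boundary points, and it yields Lipschitz bounds, directional derivatives and the chain rule. *)
Lemma strict_diff U f g x : rdom U -> C1on U f g -> U x ->
  forall e : R, 0 < e -> exists2 d : R, 0 < d &
  forall y z, U y -> U z -> `|y - x| < d -> `|z - x| < d ->
   `|f y - f z - \sum_i (y - z) 0 i * g i x| <= e * `|y - z|.
Proof.
move=> rU [cf cg dfg] Ux e e0.
have [b [d1 [d10 Ub bU biU]]] := rdom_box rU Ux.
(* [path_bound] costs a factor [n]; dividing by [n.+1] also covers [n = 0]. *)
pose eta := e / n.+1%:R.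
have eta0 : 0 < eta by rewrite divr_gt0.
have : exists2 d2 : R, 0 < d2 & forall i y, U y -> `|y - x| < d2 -> `|g i y - g i x| < eta.
  apply: fin_delta => i; have [d d0 h] := cg i x Ux eta eta0.
  exists d => // d' /andP[_ d'd] y Uy yx; apply: h => //; exact: lt_le_trans yx d'd.
move=> [d2 d20 hg].
exists (Num.min d1 d2); first by rewrite lt_min d10.
have key y z : `|y - x| < Num.min d1 d2 -> `|z - x| < Num.min d1 d2 ->
   hsi b y -> hsi b z -> `|f y - f z - \sum_i (y - z) 0 i * g i x| <= e * `|y - z|.
  move=> yx zx hy hz; apply: le_trans (path_bound (ltW eta0) _ yx zx hy hz) _.
    move=> p /nbhsI_le[p1 p2] hp i; split; first exact/dfg/biU.
    by apply/ltW/hg => //; apply/bU => //; apply: hsi_hs.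
  by rewrite ler_wpM2r // /eta mulrAC ler_pdivrMr // ler_wpM2l ?(ltW e0) // ler_nat.
move=> y z Uy Uz yx zx; apply/ler_addgt0Pr => e' e'0.
have e'2 : 0 < e' / 2 by rewrite divr_gt0.
have [dy dy0 hfy] := cf y Uy _ e'2.
have [dz dz0 hfz] := cf z Uz _ e'2.
set m := Num.min d1 d2 in yx zx key.
(* Small enough that an inward shift by [t] moves [f] by less than [e' / 2] at both points and keeps
   them in the ball; halving makes the inequalities strict. *)
pose t := Num.min (Num.min dy dz) (Num.min (m - `|y - x|) (m - `|z - x|)) / 2.
have : 0 < Num.min (Num.min dy dz) (Num.min (m - `|y - x|) (m - `|z - x|)).
  by rewrite !lt_min dy0 dz0 !subr_gt0 yx zx.
set T := Num.min (Num.min dy dz) (Num.min (m - `|y - x|) (m - `|z - x|)) in t * => T0.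
have t0 : 0 < t by rewrite divr_gt0.
have : t < T by rewrite /t; lra.
rewrite !lt_min => /andP[/andP[tdy tdz] /andP[tmy tmz]].
have ni : `|inward n t| <= t by apply: le_trans (norm_inward _ _) _; rewrite gtr0_norm.
have aux w : `|w - x| + t < m -> `|w + inward n t - x| < m.
  move=> h; rewrite -addrA [_ - x]addrC addrA; apply: le_lt_trans (ler_normD _ _) _.
  by apply: le_lt_trans h; rewrite lerD2l.
have yx' : `|y + inward n t - x| < m by apply: aux; lra.
have zx' : `|z + inward n t - x| < m by apply: aux; lra.
have hy' : hsi b (y + inward n t) by apply: hsi_inward => //; apply: Ub.
have hz' : hsi b (z + inward n t) by apply: hsi_inward => //; apply: Ub.
have := key _ _ yx' zx' hy' hz'.
have Uy' : U (y + inward n t) by apply: bU; [move: yx' => /nbhsI_le[]|apply: hsi_hs].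
have Uz' : U (z + inward n t) by apply: bU; [move: zx' => /nbhsI_le[]|apply: hsi_hs].
have := hfy _ Uy'; rewrite addrAC subrr add0r => /(_ (le_lt_trans ni tdy)).
have := hfz _ Uz'; rewrite addrAC subrr add0r => /(_ (le_lt_trans ni tdz)).
(* The same shift at both ends leaves the difference [y - z] unchanged. *)
have -> : y + inward n t - (z + inward n t) = y - z by rewrite opprD addrACA subrr addr0.
set S := \sum_i _; move: (f (y + _)) (f (z + _)) => a c.
rewrite !ltr_norml => /andP[? ?] /andP[? ?]; rewrite !ler_norml => /andP[? ?].
apply/andP; split; lra.
Qed.

End Strict.

(** * Calculus up to the boundary *)

Section Calculus.
Variables (R : realType) (n : nat).
Notation E := 'rV[R]_n.
Notation e_ := (@basis_vec R n).
Implicit Types (U V W : set E) (x y z v : E) (f : E -> R).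

Lemma is_deriveP (f : E -> R) x v (l : R) : is_derive x v f l <->
  forall e : R, 0 < e -> exists2 d : R, 0 < d & forall h : R, `|h| < d ->
    `|f (x + h *: v) - f x - h * l| <= e * `|h|.
Proof.
split=> [[dd <-] e e0|H].
  have /cvgrPdist_lt /(_ e e0) : h^-1 *: ((f \o shift x) (h *: v) - f x) @[h --> 0^'] --> 'D_v f x by exact: dd.
  rewrite near_withinE => /nbhs_ballP[d /= d0 hd].
  exists d => // h hn; have [->|h0] := eqVneq h 0.
    by rewrite scale0r addr0 subrr mul0r subrr normr0 mulr0.
  have := hd h; rewrite /ball /= sub0r normrN => /(_ hn h0) /=.
  set D := 'D_v f x; rewrite [h *: v + x]addrC => /ltW hD.
  have -> : f (x + h *: v) - f x - h * D = - h * (D - h^-1 * (f (x + h *: v) - f x)).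
    by field.
  by rewrite normrM normrN mulrC ler_wpM2r.
have H' : h^-1 *: ((f \o shift x) (h *: v) - f x) @[h --> 0^'] --> l.
  apply/cvgrPdist_le => e e0; rewrite near_withinE; apply/nbhs_ballP.
  have [d d0 hd] := H e e0; exists d => //= h; rewrite /ball /= sub0r normrN => hn h0.
  have := hd h hn; rewrite [h *: v + x]addrC.
  have -> : f (x + h *: v) - f x - h * l = - h * (l - h^-1 * (f (x + h *: v) - f x)) by field.
  by rewrite normrM normrN mulrC ler_pM2r // normr_gt0.
by constructor; [apply: cvgP H'|apply: cvg_lim => //; exact: H'].
Qed.

Lemma is_derive_uniq f x v (l l' : R) : is_derive x v f l -> is_derive x v f l' -> l = l'.
Proof. by move=> [_ <-] [_ <-]. Qed.

Lemma eq_is_derive U f g x v (l : R) : U° x -> (forall y, U y -> f y = g y) ->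
  is_derive x v f l -> is_derive x v g l.
Proof.
move=> Ux fg; apply: near_eq_is_derive; near=> y; apply: fg; near: y; exact: Ux.
Unshelve. all: by end_near. Qed.

Lemma C1on_dir U f g x v : rdom U -> C1on U f g -> U° x ->
  is_derive x v f (\sum_i v 0 i * g i x).
Proof.
move=> rU C1 Ux; apply/is_deriveP => e e0.
have e'0 : 0 < e / (1 + `|v|) by rewrite divr_gt0 // ltr_pwDl.
have [d d0 hd] := strict_diff rU C1 (interior_subset Ux) e'0.
have /nbhs_normE[d' d'0 hd'] : nbhs x U by [].
exists (Num.min d d' / (1 + `|v|)).
  by rewrite divr_gt0 ?lt_min ?d0 // ltr_pwDl.
move=> h; rewrite ltr_pdivlMr ?ltr_pwDl // lt_min => /andP[hd1 hd2].
have nv : `|h *: v| <= `|h| * (1 + `|v|).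
  by rewrite normrZ ler_wpM2l // lerDr.
have xx : x + h *: v - x = h *: v by rewrite addrAC subrr add0r.
have := hd (x + h *: v) x; rewrite xx subrr normr0 => /(_ _ _ _ d0) H.
have : `|f (x + h *: v) - f x - \sum_i (h *: v) 0 i * g i x| <= e / (1 + `|v|) * `|h *: v|.
  apply: H; rewrite ?(le_lt_trans nv) //; last exact: interior_subset.
  by apply: hd'; rewrite xx (le_lt_trans nv).
rewrite (_ : \sum_i (h *: v) 0 i * g i x = h * \sum_i v 0 i * g i x); last first.
  by rewrite big_distrr /=; apply: eq_bigr => i _; rewrite mxE mulrA.
move/le_trans; apply; rewrite mulrAC ler_pdivrMr ?ltr_pwDl //.
by rewrite -mulrA ler_wpM2l // ltW.
Qed.

Lemma C1on_lip U f g x : rdom U -> C1on U f g -> U x ->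
  exists2 d : R, 0 < d & exists2 L : R, 0 <= L &
  forall y z, U y -> U z -> `|y - x| < d -> `|z - x| < d -> `|f y - f z| <= L * `|y - z|.
Proof.
move=> rU C1 Ux; have [d d0 hd] := strict_diff rU C1 Ux ltr01.
exists d => //; exists (1 + \sum_i `|g i x|); first by rewrite addr_ge0 // sumr_ge0.
move=> y z Uy Uz yx zx; have := hd y z Uy Uz yx zx; set S := \sum_i _ => h.
have hS : `|S| <= (\sum_i `|g i x|) * `|y - z|.
  rewrite /S; apply: le_trans (ler_norm_sum _ _ _) _; rewrite big_distrl /=.
  by apply: ler_sum => i _; rewrite normrM mulrC ler_wpM2l // coord_le.
have -> : f y - f z = (f y - f z - S) + S by rewrite subrK.
by apply: le_trans (ler_normD _ _) _; rewrite mulrDl; apply: lerD.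
Qed.

Lemma rdom_inward U x : rdom U -> U x -> forall d : R, 0 < d ->
  exists2 e : R, 0 < e < d & U° (x + inward n e).
Proof.
move=> rU Ux d d0; have [b [d1 [d10 Ub bU biU]]] := rdom_box rU Ux.
pose e := Num.min d d1 / 2; have m0 : 0 < Num.min d d1 by rewrite lt_min d0.
have : e < Num.min d d1 by rewrite /e; lra.
rewrite lt_min => /andP[ed ed1].
have e0 : 0 < e by rewrite divr_gt0.
exists e; first by rewrite e0.
apply: biU; last by apply: hsi_inward => //; exact: Ub.
by rewrite addrAC subrr add0r (le_lt_trans (norm_inward _ _)) // gtr0_norm.
Qed.

(** Inward shifts make the interior dense in [U]. In particular derivatives up to the boundary are
    unique. *)
Lemma econt_ext U f g : rdom U -> econt U f -> econt U g ->
  (forall x, U° x -> f x = g x) -> forall x, U x -> f x = g x.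
Proof.
move=> rU cf cg fg x Ux; apply/eqP; rewrite -subr_eq0 -normr_le0.
apply/ler_addgt0Pr => e e0; rewrite add0r.
have e2 : 0 < e / 2 by rewrite divr_gt0.
have [d1 d10 h1] := cf x Ux _ e2; have [d2 d20 h2] := cg x Ux _ e2.
have [|t /andP[t0 td] Ut] := @rdom_inward U x rU Ux (Num.min d1 d2); first by rewrite lt_min d10.
move: td; rewrite lt_min => /andP[td1 td2].
have nt : `|x + inward n t - x| <= t.
  by rewrite addrAC subrr add0r (le_trans (norm_inward _ _)) // gtr0_norm.
have := h1 _ (interior_subset Ut) (le_lt_trans nt td1).
have := h2 _ (interior_subset Ut) (le_lt_trans nt td2).
rewrite (fg _ Ut) !ltr_norml => /andP[? ?] /andP[? ?].
by rewrite ler_norml; apply/andP; split; lra.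
Qed.

(** [P] is only asked to be differentiable along one direction at one point; the strict
    differentiability of [f] makes up for it. *)
Lemma chain_dir m (V : set 'rV[R]_m) (f : 'rV[R]_m -> R) (g : 'I_m -> 'rV[R]_m -> R)
    (P : E -> 'rV[R]_m) x v (w : 'I_m -> R) :
  rdom V -> C1on V f g -> V° (P x) ->
  (forall a, is_derive x v (fun y => P y 0 a) (w a)) ->
  is_derive x v (f \o P) (\sum_a w a * g a (P x)).
Proof.
move=> rV C1 VPx dP; apply/is_deriveP => e e0.
pose G := \sum_a `|g a (P x)|.
pose K := 1 + \sum_a `|w a|.
have G0 : 0 <= G by apply: sumr_ge0.
have K1 : 1 <= K by rewrite lerDl sumr_ge0.
have Kw a : `|w a| + 1 <= K.
  by rewrite /K addrC lerD2l (bigD1 a) //= lerDl sumr_ge0.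
(* [e2 <= 1] keeps the increment of [P] below [K] times that of the parameter; [e1] then absorbs
   [K], and [e2] absorbs the sum [G] of the partial derivatives. *)
pose e1 := e / (2 * K); pose e2 := Num.min 1 (e / (2 * (1 + G))).
have e10 : 0 < e1 by rewrite divr_gt0 // mulr_gt0 // (lt_le_trans ltr01).
have e20 : 0 < e2 by rewrite lt_min ltr01 divr_gt0 // mulr_gt0 // ltr_pwDl.
have [d d0 hd] := strict_diff rV C1 (interior_subset VPx) e10.
have /nbhs_normE[d' d'0 hd'] : nbhs (P x) V by [].
have [d2 d20 hP] : exists2 d2 : R, 0 < d2 & forall a h, `|h| < d2 ->
    `|P (x + h *: v) 0 a - P x 0 a - h * w a| <= e2 * `|h|.
  apply: fin_delta => a; have /is_deriveP/(_ e2 e20)[d2 d20 h] := dP a.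
  by exists d2 => // d3 /andP[_ dd] k kd; apply: h; apply: lt_le_trans dd.
pose m0 := Num.min d d' / K.
have m00 : 0 < m0 by rewrite divr_gt0 ?lt_min ?d0 // (lt_le_trans ltr01).
exists (Num.min d2 m0); first by rewrite lt_min d20.
move=> h; rewrite lt_min => /andP[hd2].
rewrite /m0 ltr_pdivlMr ?(lt_le_trans ltr01) // lt_min => /andP[h1 h2].
have nP : `|P (x + h *: v) - P x| <= `|h| * K.
  apply: rV_norm_le => [|a]; first by rewrite mulr_ge0 // (le_trans ler01).
  rewrite !mxE; have := hP a h hd2; set q := P _ 0 a - _ => hq.
  have -> : q = (q - h * w a) + h * w a by rewrite subrK.
  apply: le_trans (ler_normD _ _) _; rewrite normrM.
  have : e2 * `|h| <= 1 * `|h| by rewrite ler_wpM2r // ge_min lexx.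
  have : `|h| * (`|w a| + 1) <= `|h| * K by rewrite ler_wpM2l.
  lra.
have Vh : V (P (x + h *: v)) by apply: hd'; apply: le_lt_trans nP _.
have := hd _ _ Vh (interior_subset VPx) (le_lt_trans nP h1).
rewrite subrr normr0 => /(_ d0) /=.
set S := \sum_i _ => hS.
set T := \sum_a _.
have hST : `|S - h * T| <= e2 * `|h| * G.
  rewrite /S /T [h * _]big_distrr /= -sumrB; apply: le_trans (ler_norm_sum _ _ _) _.
  rewrite /G [leRHS]big_distrr /=; apply: ler_sum => a _.
  rewrite mulrA -mulrBl normrM ler_wpM2r // !mxE; exact: hP.
have -> : f (P (x + h *: v)) - f (P x) - h * T =
  (f (P (x + h *: v)) - f (P x) - S) + (S - h * T) by rewrite addrA subrK.
apply: le_trans (ler_normD _ _) _.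
have b1 : e1 * `|P (x + h *: v) - P x| <= e / 2 * `|h|.
  have : e1 * `|P (x + h *: v) - P x| <= e1 * (`|h| * K) by rewrite ler_wpM2l // ltW.
  move/le_trans; apply; rewrite /e1 invfM; have K0 : K != 0 by lra.
  by rewrite le_eqVlt; apply/orP; left; apply/eqP; field.
have b2 : e2 * `|h| * G <= e / 2 * `|h|.
  rewrite mulrAC ler_wpM2r //.
  have : e2 * G <= e / (2 * (1 + G)) * G by rewrite ler_wpM2r // ge_min lexx orbT.
  move/le_trans; apply; rewrite invfM mulrA -[leLHS]mulrA ler_piMr //.
    by rewrite ltW // divr_gt0.
  by rewrite mulrC ler_pdivrMr ?mul1r ?lerDr // ltr_pwDl.
lra.
Qed.

Lemma min_derive0 f x v (l : R) U : U° x -> is_derive x v f l ->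
  (forall y, U y -> f x <= f y) -> l = 0.
Proof.
move=> Ux /is_deriveP dl mn; apply/eqP; rewrite -normr_le0.
apply/ler_addgt0Pr => e e0; rewrite add0r; have [d d0 hd] := dl e e0.
have /nbhs_normE[d' d'0 hd'] : nbhs x U by [].
pose m := Num.min d (d' / (1 + `|v|)).
have m0 : 0 < m by rewrite lt_min d0 divr_gt0 // ltr_pwDl.
pose h := m / 2; have h0 : 0 < h by rewrite divr_gt0.
have : h < m by rewrite /h; lra.
rewrite /m lt_min ltr_pdivlMr ?ltr_pwDl // => /andP[h1 h2].
have Uh s : `|s| = h -> U (x + s *: v).
  move=> sh; apply: hd'; rewrite addrAC subrr add0r normrZ sh.
  by apply: le_lt_trans h2; rewrite ler_wpM2l ?(ltW h0) // lerDr.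
have H s : `|s| = h -> s * l + e * h >= 0.
  move=> sh; have := mn _ (Uh s sh); have := hd s; rewrite sh => /(_ h1).
  by rewrite ler_norml => /andP[? ?] ?; lra.
have := H h (gtr0_norm h0); have := H (- h); rewrite normrN => /(_ (gtr0_norm h0)).
move=> p1 p2; rewrite ler_norml.
have q1 : 0 <= h * (e - l) by lra.
have q2 : 0 <= h * (e + l) by lra.
by move: q1 q2; rewrite !pmulr_rge0 // => ? ?; apply/andP; split; lra.
Qed.

(* Both mixed partials are the limit of the second difference quotient. *)
Lemma schwarz_aux U f g i j (q : 'I_n -> E -> R) x : rdom U -> U° x ->
  (forall y, U° y -> is_derive y (e_ i) f (g y)) -> C1on U g q ->
  forall e : R, 0 < e -> exists2 d : R, 0 < d & forall t, 0 < t < d ->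
  `|f (x + t *: e_ i + t *: e_ j) - f (x + t *: e_ i) - f (x + t *: e_ j) + f x - t * t * q j x| <= e * (t * t).
Proof.
move=> rU Ux df C1 e e0.
have [d d0 hd] := strict_diff rU C1 (interior_subset Ux) e0.
have /nbhs_normE[d' d'0 hd'] : nbhs x (U°) by apply: nbhs_interior.
pose m := Num.min d d' / 2.
have m0' : 0 < Num.min d d' by rewrite lt_min d0.
exists m; first by rewrite divr_gt0.
move=> t /andP[t0 tm].
have nb s r : 0 <= s <= t -> 0 <= r <= t -> `|x + s *: e_ i + r *: e_ j - x| < Num.min d d'.
  move=> /andP[s0 st] /andP[r0 rt]; rewrite addrAC [x + _]addrC addrK.
  apply: le_lt_trans (ler_normD _ _) _; rewrite !normrZ !ger0_norm //.
  have : s * `|e_ i| <= s by rewrite ler_piMr // norm_basis_vec_le.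
  have : r * `|e_ j| <= r by rewrite ler_piMr // norm_basis_vec_le.
  by move: tm; rewrite /m; lra.
have Unb s r : 0 <= s <= t -> 0 <= r <= t -> U° (x + s *: e_ i + r *: e_ j).
  by move=> hs hr; apply: hd'; have /nbhsI_le[] := nb s r hs hr.
have dnb s r : 0 <= s <= t -> 0 <= r <= t -> `|x + s *: e_ i + r *: e_ j - x| < d.
  by move=> hs hr; have /nbhsI_le[] := nb s r hs hr.
have t00 : (0:R) <= 0 <= t by rewrite lexx ltW.
have tt : 0 <= t <= t by rewrite lexx ltW.
(* The second difference is [phi t - phi 0], and strict differentiability of [g] puts [dphi] within
   [e * t] of [t * q j x]. *)
pose phi (s : R) := f ((x + t *: e_ j) + s *: e_ i) - f (x + s *: e_ i).
pose dphi (s : R) := g ((x + t *: e_ j) + s *: e_ i) - g (x + s *: e_ i).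
have := @mvt_bound R phi dphi 0 t (t * q j x) (e * t).
rewrite subr0 (gtr0_norm t0) /phi !scale0r !addr0.
have -> : x + t *: e_ j + t *: e_ i = x + t *: e_ i + t *: e_ j by rewrite addrAC.
move=> H; have : `|f (x + t *: e_ i + t *: e_ j) - f (x + t *: e_ i) - (f (x + t *: e_ j) - f x) - t * (t * q j x)| <= e * t * t.
  apply: H => s /orP[] /andP[s0 st]; last by have : t <= 0 := le_trans s0 st; rewrite leNgt t0.
  have st' : 0 <= s <= t by rewrite s0.
  have A1 := Unb s t st' tt; have A2 := Unb s 0 st' t00.
  have B1 := dnb s t st' tt; have B2 := dnb s 0 st' t00.
  move: A1 A2 B1 B2; rewrite scale0r addr0 [x + _ + _]addrAC => A1 A2 B1 B2.
  split.
    apply: is_deriveB; apply: line_is_derive; exact: df.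
  have := hd _ _ (interior_subset A1) (interior_subset A2) B1 B2.
  have -> : x + t *: e_ j + s *: e_ i - (x + s *: e_ i) = t *: e_ j.
    by rewrite [x + _ + _]addrAC [_ + t *: _]addrC addrK.
  rewrite (bigD1 j) //= big1 ?addr0; last first.
    move=> k kj; rewrite !mxE eqxx (negPf kj) /= mulr0 mul0r //.
  rewrite !mxE !eqxx mulr1; move/le_trans; apply; rewrite normrZ gtr0_norm //.
  rewrite ler_wpM2l ?(ltW e0) // ler_piMr ?(ltW t0) //; exact: norm_basis_vec_le.
by rewrite opprB addrA addrAC !mulrA; congr (_ <= _); congr (`|_|); ring.
Qed.

Lemma schwarz U f (g : 'I_n -> E -> R) (q : 'I_n -> 'I_n -> E -> R) x i j : rdom U -> U° x ->
  (forall i y, U° y -> is_derive y (e_ i) f (g i y)) ->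
  (forall i, C1on U (g i) (q i)) -> q i j x = q j i x.
Proof.
move=> rU Ux df C1; apply/eqP; rewrite -subr_eq0 -normr_le0.
apply/ler_addgt0Pr => e e0; rewrite add0r; have e2 : 0 < e / 2 by rewrite divr_gt0.
have [d1 d10 h1] := schwarz_aux j rU Ux (df i) (C1 i) e2.
have [d2 d20 h2] := schwarz_aux i rU Ux (df j) (C1 j) e2.
pose t := Num.min d1 d2 / 2; have m0 : 0 < Num.min d1 d2 by rewrite lt_min d10.
have t0 : 0 < t by rewrite divr_gt0.
have : t < Num.min d1 d2 by rewrite /t; lra.
rewrite lt_min => /andP[t1 t2].
have := h1 t; rewrite t0 t1 => /(_ isT); have := h2 t; rewrite t0 t2 => /(_ isT).
have -> : x + t *: e_ j + t *: e_ i = x + t *: e_ i + t *: e_ j by rewrite addrAC.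
set a := f _; set b := f _; set c := f (_ + _); set k := f x.
have tt : 0 < t * t by rewrite mulr_gt0.
rewrite !ler_norml => /andP[? ?] /andP[? ?].
have q1 : 0 <= (t * t) * (e - (q i j x - q j i x)) by lra.
have q2 : 0 <= (t * t) * (e + (q i j x - q j i x)) by lra.
by move: q1 q2; rewrite !pmulr_rge0 // => ? ?; apply/andP; split; lra.
Qed.

End Calculus.

(** * Function classes and $C^k$ calculus over them *)

Section Classes.
Variables (R : realType) (n : nat).
Notation E := 'rV[R]_n.
Notation fn := (E -> R).
Notation e_ := (@basis_vec R n).
Implicit Types (U V W : set E) (x y z v : E) (f g : fn) (P : set E -> fn -> Prop).

Lemma econt_cvg U f : econt U f <->
  forall x, U x -> f y @[y --> within U (nbhs x)] --> f x.
Proof. by rewrite -within_econt; apply: subspace_continuousP. Qed.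

Lemma econt_cst U (c : R) : econt U (fun=> c).
Proof. by move=> x Ux e e0; exists 1 => // y _ _; rewrite subrr normr0. Qed.

Lemma econtD U f g : econt U f -> econt U g -> econt U (fun x => f x + g x).
Proof. by move=> /econt_cvg cf /econt_cvg cg; apply/econt_cvg => x Ux; apply: cvgD; [exact: cf|exact: cg]. Qed.

Lemma econtM U f g : econt U f -> econt U g -> econt U (fun x => f x * g x).
Proof. by move=> /econt_cvg cf /econt_cvg cg; apply/econt_cvg => x Ux; apply: cvgM; [exact: cf|exact: cg]. Qed.

Lemma econtV U f : (forall x, U x -> f x != 0) -> econt U f -> econt U (fun x => (f x)^-1).
Proof. by move=> f0 /econt_cvg cf; apply/econt_cvg => x Ux; apply: cvgV; [exact: f0|exact: cf]. Qed.

Lemma econt_map U (Q : E -> E) : (forall a, econt U (fun x => Q x 0 a)) ->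
  forall x, U x -> forall e : R, 0 < e -> exists2 d : R, 0 < d &
  forall y, U y -> `|y - x| < d -> `|Q y - Q x| < e.
Proof.
move=> cQ x Ux e e0.
have [d d0 h] : exists2 d : R, 0 < d & forall a y, U y -> `|y - x| < d -> `|Q y 0 a - Q x 0 a| < e.
  apply: fin_delta => a; have [d d0 h] := cQ a x Ux e e0.
  by exists d => // d' /andP[_ dd] y Uy yx; apply: h => //; apply: lt_le_trans dd.
exists d => // y Uy yx; apply: rV_norm_lt => // a; rewrite !mxE; exact: h.
Qed.

Lemma econt_comp U V f (Q : E -> E) : econt V f -> (forall x, U x -> V (Q x)) ->
  (forall a, econt U (fun x => Q x 0 a)) -> econt U (f \o Q).
Proof.
move=> cf UV cQ x Ux e e0; have [d d0 h] := cf _ (UV _ Ux) e e0.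
have [d' d'0 h'] := econt_map cQ Ux d0.
by exists d' => // y Uy yx; apply: h; [exact: UV|exact: h'].
Qed.

Lemma C1on_comp_lip U (Q : E -> E) (A : 'I_n -> 'I_n -> fn) x : rdom U ->
  (forall a, C1on U (fun x => Q x 0 a) (A ^~ a)) -> U x ->
  exists2 d : R, 0 < d & exists2 L : R, 0 < L &
  forall y z, U y -> U z -> `|y - x| < d -> `|z - x| < d -> `|Q y - Q z| <= L * `|y - z|.
Proof.
move=> rU C1 Ux.
(* The same number serves as radius and, inverted, as Lipschitz constant, so that [fin_delta] finds
   both at once. *)
have [d d0 h] : exists2 d : R, 0 < d & forall a, 
   forall y z, U y -> U z -> `|y - x| < d -> `|z - x| < d -> `|Q y 0 a - Q z 0 a| <= d^-1 * `|y - z|.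
  apply: fin_delta => a; have [d d0 [L L0 h]] := C1on_lip rU (C1 a) Ux.
  exists (Num.min d (L + 1)^-1); first by rewrite lt_min d0 invr_gt0 ltr_wpDl.
  move=> d'; rewrite le_min => /andP[d'0 /andP[dd dL]] y z Uy Uz yx zx.
  apply: le_trans (h y z Uy Uz (lt_le_trans yx dd) (lt_le_trans zx dd)) _.
  rewrite ler_wpM2r // (@le_trans _ _ (L + 1)) ?lerDl //.
  by rewrite -[L + 1]invrK lef_pV2 // posrE invr_gt0 ltr_wpDl.
exists d => //; exists d^-1; first by rewrite invr_gt0.
move=> y z Uy Uz yx zx; apply: rV_norm_le => [|a]; first by rewrite mulr_ge0 // invr_ge0 ltW.
by rewrite !mxE; apply: h.
Qed.

(* What a class of functions must satisfy for the bootstrap started from it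
   to close up: continuous functions and locally Hoelder functions qualify. *)
Record adm P : Prop := Adm {
  adm_eq : forall U f g, (forall x, U x -> f x = g x) -> P U f -> P U g;
  adm_sub : forall U V f, V `<=` U -> P U f -> P V f;
  adm_cont : forall U f, P U f -> econt U f;
  adm_cst : forall U (c : R), P U (fun=> c);
  adm_add : forall U f g, P U f -> P U g -> P U (fun x => f x + g x);
  adm_mul : forall U f g, P U f -> P U g -> P U (fun x => f x * g x);
  adm_C1 : forall U f q, rdom U -> C1on U f q -> P U f;
  adm_comp : forall U V f (Q : E -> E) (A : 'I_n -> 'I_n -> fn), rdom U ->
    (forall x, U x -> V (Q x)) ->
    (forall a, C1on U (fun x => Q x 0 a) (A ^~ a)) -> P V f -> P U (f \o Q) }.

Definition cont_class := (fun U f => {within U, continuous f}) : set E -> fn -> Prop.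

Lemma adm_cont_class : adm cont_class.
Proof.
have E U f : cont_class U f <-> econt U f by exact: within_econt.
split.
- by move=> U f g fg /E cf; apply/E; apply: eq_econt cf.
- by move=> U V f VU /E cf; apply/E; apply: econtS cf.
- by move=> U f /E.
- by move=> U c; apply/E; apply: econt_cst.
- by move=> U f g /E cf /E cg; apply/E; apply: econtD.
- by move=> U f g /E cf /E cg; apply/E; apply: econtM.
- by move=> U f q _ [cf _ _]; apply/E.
- move=> U V f Q A _ UV C1 /E cf; apply/E; apply: econt_comp cf UV _ => a.
  by case: (C1 a).
Qed.

Lemma holder_econt (a : R) U f : 0 < a -> locally_holder a U f -> econt U f.
Proof.
move=> a0 hf x Ux e e0; have [V /nbhs_normE[d d0 hd] [C hC]] := hf x Ux.
pose K := `|C| + 1; have K0 : 0 < K by rewrite ltr_wpDl.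
have eK : 0 < e / K by rewrite divr_gt0.
exists (Num.min d ((e / K) `^ a^-1)); first by rewrite lt_min d0 powR_gt0.
move=> y Uy; rewrite lt_min => /andP[yd ye].
have Vy : (U `&` V) y by split=> //; apply: hd.
have Vx : (U `&` V) x by split=> //; apply: hd; rewrite subrr normr0.
apply: le_lt_trans (hC y x Vy Vx) _.
have h1 : `|y - x| `^ a < e / K.
  have : `|y - x| `^ a < ((e / K) `^ a^-1) `^ a.
    by apply: gt0_ltr_powR => //; rewrite nnegrE ?powR_ge0.
  by rewrite -powRrM mulVf ?gt_eqF // powRr1 // ltW.
have : C * `|y - x| `^ a <= K * `|y - x| `^ a.
  by rewrite ler_wpM2r ?powR_ge0 // /K (le_trans (ler_norm _)) // lerDl.
move/le_lt_trans; apply; by rewrite mulrC -ltr_pdivlMr.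
Qed.

Lemma econt_bounded U f x : econt U f -> U x -> exists2 d : R, 0 < d &
  forall y, U y -> `|y - x| < d -> `|f y| <= `|f x| + 1.
Proof.
move=> cf Ux; have [d d0 h] := cf x Ux 1 ltr01; exists d => // y Uy yx.
have -> : f y = f x + (f y - f x) by rewrite addrC subrK.
by apply: le_trans (ler_normD _ _) _; rewrite lerD2l ltW // h.
Qed.

(** Products need local boundedness, which continuity gives; $C^1$ functions are locally Lipschitz;
    composition with a locally Lipschitz [Q] changes the constant but not the exponent. *)
Lemma adm_holder (a : R) : 0 < a < 1 -> adm (locally_holder a).
Proof.
move=> /andP[a0 a1]; split.
- move=> U f g fg hf x Ux; have [V Vx [C hC]] := hf x Ux; exists V => //; exists C.
  by move=> y z Vy Vz; rewrite -!fg ?hC //; [case: Vz|case: Vy].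
- move=> U V f VU hf x Vx; have [W Wx [C hC]] := hf x (VU _ Vx); exists W => //; exists C.
  by move=> y z [Vy Wy] [Vz Wz]; apply: hC; split=> //; exact: VU.
- by move=> U f; apply: holder_econt.
- move=> U c x Ux; exists setT; first exact: filterT.
  by exists 0 => y z _ _; rewrite subrr normr0 mul0r.
- move=> U f g hf hg x Ux; have [V Vx [C hC]] := hf x Ux; have [V' Vx' [C' hC']] := hg x Ux.
  exists (V `&` V'); first exact: filterI.
  exists (C + C') => y z [Uy [Vy Vy']] [Uz [Vz Vz']].
  rewrite opprD addrACA; apply: le_trans (ler_normD _ _) _; rewrite mulrDl; apply: lerD.
    exact: hC (conj Uy Vy) (conj Uz Vz).
  exact: hC' (conj Uy Vy') (conj Uz Vz').
- move=> U f g hf hg x Ux; have [V Vx [C hC]] := hf x Ux; have [V' Vx' [C' hC']] := hg x Ux.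
  have [d d0 bf] := econt_bounded (holder_econt a0 hf) Ux.
  have [d' d'0 bg] := econt_bounded (holder_econt a0 hg) Ux.
  set F := `|f x| + 1 in bf; set G := `|g x| + 1 in bg.
  exists ((V `&` V') `&` (nball x d `&` nball x d')).
    apply: filterI; first exact: filterI.
    by apply: filterI; apply/nbhs_normE; [exists d|exists d'].
  exists (F * `|C'| + G * `|C|) => y z [Uy [[Vy Vy'] [yd yd']]] [Uz [[Vz Vz'] [zd zd']]].
  have -> : f y * g y - f z * g z = f y * (g y - g z) + g z * (f y - f z) by ring.
  apply: le_trans (ler_normD _ _) _; rewrite !normrM mulrDl -!mulrA; apply: lerD.
    apply: ler_pM => //; first exact: bf.
    by apply: le_trans (hC' _ _ (conj Uy Vy') (conj Uz Vz')) _; rewrite ler_wpM2r ?powR_ge0 // ler_norm.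
  apply: ler_pM => //; first exact: bg.
  by apply: le_trans (hC _ _ (conj Uy Vy) (conj Uz Vz)) _; rewrite ler_wpM2r ?powR_ge0 // ler_norm.
- move=> U f q rU C1 x Ux; have [d d0 [L L0 h]] := C1on_lip rU C1 Ux.
  (* With radius at most 1/2 the distance of two points is below 1, where a number is at most its
     power with exponent [a < 1]. *)
  exists (nball x (Num.min d 2^-1)); first (apply/nbhs_normE; exists (Num.min d 2^-1); last by []; by rewrite lt_min d0 invr_gt0 ltr0n).
  exists L => y z [Uy /nbhsI_le[y1 y2]] [Uz /nbhsI_le[z1 z2]].
  apply: le_trans (h y z Uy Uz y1 z1) _; rewrite ler_wpM2l //.
  have [->|yz] := eqVneq `|y - z| 0; first exact: powR_ge0.
  apply: ger1_powR; last exact: ltW.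
  rewrite lt_def yz normr_ge0 /=.
  have := ler_distD x y z; rewrite (distrC x z); lra.
- move=> U V f Q A rU UV C1 hf x Ux.
  have [V' VQx [C hC]] := hf _ (UV _ Ux).
  have [d d0 [L L0 hL]] := C1on_comp_lip rU C1 Ux.
  have /nbhs_normE[e e0 he] := VQx.
  have cQ b : econt U (fun x => Q x 0 b) by case: (C1 b).
  have [d' d'0 hd'] := econt_map cQ Ux e0.
  exists (nball x (Num.min d d')).
    apply/nbhs_normE; exists (Num.min d d'); last by [].
    by rewrite lt_min d0 d'0.
  exists (`|C| * L `^ a) => y z [Uy /nbhsI_le[y1 y2]] [Uz /nbhsI_le[z1 z2]] /=.
  apply: le_trans (hC _ _ _ _) _.
  + by split; [exact: UV|apply: he; exact: hd'].
  + by split; [exact: UV|apply: he; exact: hd'].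
  rewrite -mulrA -powRM ?(ltW L0) //.
  apply: (@le_trans _ _ (`|C| * `|Q y - Q z| `^ a)); first by rewrite ler_wpM2r ?powR_ge0 // ler_norm.
  rewrite ler_wpM2l //; apply: ge0_ler_powR; rewrite ?(ltW a0) ?nnegrE //.
    by rewrite mulr_ge0 // ltW.
  exact: hL.
Qed.

Section Ck_calculus.
Variables (P : set E -> fn -> Prop) (aP : adm P).
Notation Ck := (Ck_with P).

Lemma Ck_cont k U f : Ck k U f -> econt U f.
Proof. by case: k => [/(adm_cont aP)|k [/within_econt]]. Qed.

(** The recursive definition picks the partial derivatives one at a time; inductions on the order
    are run on this form, with the whole family at once. *)
Lemma CkS k U f : Ck k.+1 U f <->
  exists2 q, C1on U f q & forall i, Ck k U (q i).
Proof.
split=> [[/within_econt cf h]|[q [/within_econt cf cq dq] Cq]].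
  have /boolp.choice[q hq] : forall i, exists q, Ck k U q /\ forall x, U° x -> is_derive x (e_ i) f (q x).
    by move=> i; have [q ? ?] := h i; exists q.
  exists q; last by move=> i; case: (hq i).
  by split=> // i; have [] := hq i => // /Ck_cont.
by split=> // i; exists (q i) => //; apply: dq.
Qed.

Lemma Ck_eq k U f g : (forall x, U x -> f x = g x) -> Ck k U f -> Ck k U g.
Proof.
case: k => [|k] fg; first exact: adm_eq.
case/CkS => q [cf cq dq] Cq; apply/CkS; exists q => //; split=> //.
  exact: eq_econt cf.
by move=> i x Ux; exact: (eq_is_derive Ux fg (dq i x Ux)).
Qed.

Lemma Ck_sub k U V f : V `<=` U -> Ck k U f -> Ck k V f.
Proof.
move=> VU; elim: k f => [|k IH] f; first exact: (adm_sub aP VU).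
case/CkS => q [cf cq dq] Cq; apply/CkS; exists q => [|i]; last exact: IH.
split; first exact: econtS cf; first by move=> i; exact: econtS (cq i).
by move=> i x /(interiorS VU); exact: dq.
Qed.

(** At the bottom of the induction a $C^1$ function has to lie in [P]: this is the reason for the
    field [adm_C1]. *)
Lemma Ck_lower k U f : rdom U -> Ck k.+1 U f -> Ck k U f.
Proof.
move=> rU; elim: k f => [|k IH] f /CkS[q C1 Cq]; first exact: adm_C1 C1.
by apply/CkS; exists q => // i; apply: IH.
Qed.

Lemma Ck_le j k U f : rdom U -> (j <= k)%N -> Ck k U f -> Ck j U f.
Proof.
move=> rU; elim: k => [|k IH]; first by rewrite leqn0 => /eqP ->.
by rewrite leq_eqVlt => /orP[/eqP -> //|jk] /(Ck_lower rU); apply: IH.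
Qed.

Lemma Ck_cst k U (c : R) : Ck k U (fun=> c).
Proof.
elim: k c => [|k IH] c; first exact: adm_cst.
apply/CkS; exists (fun _ _ => 0) => //; split; first exact: econt_cst.
  by move=> i; exact: econt_cst.
by move=> i x _; apply: is_derive_cst.
Qed.

Lemma Ck_add k U f g : Ck k U f -> Ck k U g -> Ck k U (fun x => f x + g x).
Proof.
elim: k f g => [|k IH] f g; first exact: adm_add.
move=> /CkS[q [cf cq dq] Cq] /CkS[r [cg cr dr] Cr]; apply/CkS.
exists (fun i x => q i x + r i x) => [|i]; last exact: IH.
split; first exact: econtD; first by move=> i; exact: econtD.
by move=> i x Ux; apply: is_deriveD; [exact: dq|exact: dr].
Qed.

Lemma C1onM U f g q r : C1on U f q -> C1on U g r ->
  C1on U (fun x => f x * g x) (fun i x => f x * r i x + g x * q i x).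
Proof.
move=> [cf cq dq] [cg cr dr]; split; first exact: econtM.
  by move=> i; apply: econtD; exact: econtM.
by move=> i x Ux; apply: is_deriveM; [exact: dq|exact: dr].
Qed.

Lemma Ck_mul k U f g : rdom U -> Ck k U f -> Ck k U g -> Ck k U (fun x => f x * g x).
Proof.
move=> rU; elim: k f g => [|k IH] f g; first exact: adm_mul.
move=> Cf Cg; have [q C1f Cq] := (CkS _ _ _).1 Cf; have [r C1g Cr] := (CkS _ _ _).1 Cg.
apply/CkS; exists (fun i x => f x * r i x + g x * q i x) => [|i]; first exact: C1onM.
by apply: Ck_add; apply: IH => //; apply: Ck_lower.
Qed.

Lemma Ck_sum (I : Type) (s : seq I) (F : I -> fn) k U : (forall i, Ck k U (F i)) ->
  Ck k U (fun x => \sum_(i <- s) F i x).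
Proof.
move=> CF; elim: s => [|i s IH].
  by apply: Ck_eq (Ck_cst k U 0) => x _; rewrite big_nil.
by apply: Ck_eq (Ck_add (CF i) IH) => x _; rewrite big_cons.
Qed.

Lemma econt_sum (I : Type) (s : seq I) (F : I -> fn) U : (forall i, econt U (F i)) ->
  econt U (fun x => \sum_(i <- s) F i x).
Proof.
move=> CF; elim: s => [|i s IH].
  by apply: eq_econt (@econt_cst U 0) => x _; rewrite big_nil.
by apply: eq_econt (econtD (CF i) IH) => x _; rewrite big_cons.
Qed.

Section Composition.
Variables (U V : set E) (Q : E -> E) (A : 'I_n -> 'I_n -> fn).
Hypotheses (rU : rdom U) (rV : rdom V) (UV : forall x, U x -> V (Q x))
  (UVi : forall x, U° x -> V° (Q x))
  (C1Q : forall a, C1on U (fun x => Q x 0 a) (A ^~ a)).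

Lemma C1on_comp f q : C1on V f q ->
  C1on U (f \o Q) (fun i x => \sum_a A i a x * (q a \o Q) x).
Proof.
move=> C1; have [cf cq dq] := C1.
have cQ a : econt U (fun x => Q x 0 a) by case: (C1Q a).
split; first exact: econt_comp cf UV cQ.
  move=> i; apply: econt_sum => a; apply: econtM; first by case: (C1Q a).
  exact: econt_comp (cq a) UV cQ.
move=> i x Ux; apply: (chain_dir rV C1 (UVi Ux)) => a.
by case: (C1Q a) => _ _; apply.
Qed.

(** The chain rule differentiates [f] once and leaves [A] as a factor, so the Jacobian needs one
    order less than the composite. *)
Lemma Ck_comp k f : (forall i a, Ck k.-1 U (A i a)) -> Ck k V f -> Ck k U (f \o Q).
Proof.
elim: k f => [|k IH] f CA; first exact: adm_comp C1Q.
move=> /CkS[q C1 Cq]; apply/CkS.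
exists (fun i x => \sum_a A i a x * (q a \o Q) x) => [|i]; first exact: C1on_comp.
apply: Ck_sum => a; apply: Ck_mul => //.
apply: IH => // j b; by case: k CA {Cq} => [|k] CA; [exact: CA|apply: Ck_lower => //; exact: CA].
Qed.

End Composition.

End Ck_calculus.

Lemma C1onV U f q : (forall x, U x -> f x != 0) -> C1on U f q ->
  C1on U (fun x => (f x)^-1) (fun i x => - ((f x)^-1 * (f x)^-1 * q i x)).
Proof.
move=> f0 [cf cq dq]; have cV := econtV f0 cf; split=> // [i|i x Ux].
  apply: (@eq_econt _ _ _ (fun x => (-1) * ((f x)^-1 * (f x)^-1 * q i x))) => [x _|].
    by rewrite mulN1r.
  by apply: econtM; [exact: econt_cst|apply: econtM => //; exact: econtM].
have fx0 : f x != 0 by apply: f0; apply: interior_subset.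
have dx := dq i x Ux.
have [der] := dx; move=> E.
constructor; first exact: derivableV.
by rewrite deriveV // E -[LHS]/(_ * _) mulNr expr2 invfM.
Qed.

Lemma Ck_inv k U f : rdom U -> (forall x, U x -> f x != 0) ->
  Ck_with cont_class k U f -> Ck_with cont_class k U (fun x => (f x)^-1).
Proof.
move=> rU f0; have aP := adm_cont_class; elim: k => [|k IH].
  by move=> /within_econt cf; apply/within_econt; apply: econtV.
move=> Cf; have [q C1 Cq] := (CkS aP _ _ _).1 Cf; apply/(CkS aP).
exists (fun i x => - ((f x)^-1 * (f x)^-1 * q i x)) => [|i]; first exact: C1onV.
have CV : Ck_with cont_class k U (fun x => (f x)^-1) by apply: IH; apply: (Ck_lower aP).
apply: (@Ck_eq _ aP _ _ (fun x => (-1) * ((f x)^-1 * (f x)^-1 * q i x))) => [x _|].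
  by rewrite mulN1r.
by apply: (Ck_mul aP) => //; [exact: (Ck_cst aP)|apply: (Ck_mul aP) => //; exact: (Ck_mul aP)].
Qed.

End Classes.

(** * Total differential systems *)

Section Closed_systems.
Variables (R : realType) (n : nat).
Notation E := 'rV[R]_n.
Notation fn := (E -> R).
Notation e_ := (@basis_vec R n).
Implicit Types (U V W : set E) (x y z v : E) (f g : fn) (G : fn -> Prop).

(** The algebra generated by [G], as an inductive predicate: continuity, regularity and majorants
    each pass from the generators by a single induction. *)
Inductive poly G : fn -> Prop :=
| poly_cst (c : R) : poly G (fun=> c)
| poly_atom f : G f -> poly G f
| poly_add f g : poly G f -> poly G g -> poly G (fun x => f x + g x)
| poly_mul f g : poly G f -> poly G g -> poly G (fun x => f x * g x).

Lemma poly_opp G f : poly G f -> poly G (fun x => - f x).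
Proof.
move=> pf; have -> : (fun x => - f x) = (fun x => (-1) * f x) by apply/funext => x; rewrite mulN1r.
by apply: poly_mul => //; exact: poly_cst.
Qed.

Lemma poly_sub G f g : poly G f -> poly G g -> poly G (fun x => f x - g x).
Proof. by move=> pf pg; apply: poly_add => //; exact: poly_opp. Qed.

Lemma poly_sum G (I : Type) (s : seq I) (F : I -> fn) : (forall i, poly G (F i)) ->
  poly G (fun x => \sum_(i <- s) F i x).
Proof.
move=> pF; elim: s => [|i s IH].
  have -> : (fun x => \sum_(i <- [::]) F i x) = (fun=> 0) by apply/funext => x; rewrite big_nil.
  exact: poly_cst.
have -> : (fun x => \sum_(j <- i :: s) F j x) = (fun x => F i x + \sum_(j <- s) F j x).
  by apply/funext => x; rewrite big_cons.
exact: poly_add.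
Qed.

Lemma poly_bind G G' f : (forall a, G a -> poly G' a) -> poly G f -> poly G' f.
Proof.
move=> h; elim=> [c|a /h //|a b _ pa _ pb|a b _ pa _ pb]; first exact: poly_cst.
  exact: poly_add.
exact: poly_mul.
Qed.

Lemma poly_mono G G' f : (forall a, G a -> G' a) -> poly G f -> poly G' f.
Proof. by move=> h; apply: poly_bind => a /h; exact: poly_atom. Qed.

Lemma econt_poly G U f : (forall a, G a -> econt U a) -> poly G f -> econt U f.
Proof.
move=> h; elim=> [c|a /h //|a b _ pa _ pb|a b _ pa _ pb]; first exact: econt_cst.
  exact: econtD.
exact: econtM.
Qed.

Lemma Ck_poly P k G U f : adm P -> rdom U -> (forall a, G a -> Ck_with P k U a) ->
  poly G f -> Ck_with P k U f.
Proof.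
move=> aP rU h; elim=> [c|a /h //|a b _ pa _ pb|a b _ pa _ pb]; first exact: (Ck_cst aP).
  exact: (Ck_add aP).
exact: (Ck_mul aP).
Qed.

Definition der U i f q := forall x, U° x -> is_derive x (e_ i) f (q x).

(** [G'] must generate [G] as well, because the Leibniz rule keeps undifferentiated factors; it is
    larger when derivatives of atoms are higher jets. *)
Lemma poly_der G G' U i f : (forall a, G a -> poly G' a) ->
  (forall a, G a -> exists2 q, poly G' q & der U i a q) ->
  poly G f -> exists2 q, poly G' q & der U i f q.
Proof.
move=> hG h pf.
have {}pf' : poly G' f by exact: poly_bind pf.
elim: pf {pf'} => [c|a /h //|a b pa [q pq dq] pb [r pr dr]|a b pa [q pq dq] pb [r pr dr]].
- exists (fun=> 0); first exact: poly_cst.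
  by move=> x _; exact: is_derive_cst.
- exists (fun x => q x + r x); first exact: poly_add.
  by move=> x Ux; apply: is_deriveD; [exact: dq|exact: dr].
- exists (fun x => a x * r x + b x * q x).
    by apply: poly_add; apply: poly_mul => //; apply: poly_bind hG _.
  by move=> x Ux; apply: is_deriveM; [exact: dq|exact: dr].
Qed.

Section System.
Variables (I J H : Type) (u : I -> fn) (ka : J -> fn) (et : H -> fn) (Q : E -> E).

(** [u] are the unknowns, [ka] the data read at the point itself, [et] the data read at its image
    under [Q]. *)
Definition atoms : fn -> Prop := fun f =>
  (exists i, f = u i) \/ (exists j, f = ka j) \/ (exists h, f = et h \o Q).

Variables (U V : set E) (A : 'I_n -> 'I_n -> fn).

(** [am_int] serves the chain rule: functions on [V] are differentiated at [Q x], and derivatives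
    are only available at interior points. *)
Record admissible_map : Prop := AdmissibleMap {
  am_rdom : rdom U;
  am_rdom' : rdom V;
  am_map : forall x, U x -> V (Q x);
  am_int : forall x, U° x -> V° (Q x);
  am_C1 : forall a, C1on U (fun x => Q x 0 a) (A ^~ a) }.

(** The Jacobian of [Q] is among the unknowns, so the compositions [et h \o Q] are controlled by the
    system itself, although [Q] is not an unknown. *)
Record closed_system : Prop := ClosedSystem {
  cs_map : admissible_map;
  cs_A : forall i a, exists al, A i a = u al;
  cs_cont : forall al, econt U (u al);
  cs_der : forall al i, exists2 q, poly atoms q & der U i (u al) q }.

(** If the unknowns have order [j <= k], so do all atoms, hence the derivatives of the unknowns,
    which thus gain one order. The data, of order [k], stop this at [k.+1]. *)
Lemma closed_system_Ck P k : adm P -> closed_system ->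
  (forall j, Ck_with P k U (ka j)) -> (forall h, Ck_with P k V (et h)) ->
  forall al, Ck_with P k.+1 U (u al).
Proof.
move=> aP [[rU rV UV UVi C1Q] uA cu du] Cka Cet.
have cat f : atoms f -> econt U f.
  move=> [[i ->]//|[[j ->]|[h ->]]]; first exact: (Ck_cont aP) (Cka j).
  apply: (econt_comp (Ck_cont aP (Cet h)) UV) => a; by case: (C1Q a).
have C1u al : exists2 q, C1on U (u al) q & forall i, poly atoms (q i).
  have /boolp.choice[q hq] : forall i, exists q, poly atoms q /\ der U i (u al) q.
    by move=> i; have [q ? ?] := du al i; exists q.
  exists q => [|i]; last by case: (hq i).
  split=> // i; first by have [pq _] := hq i; exact: econt_poly pq.
  by case: (hq i) => _; apply.
have step j : (j <= k)%N -> (forall al, Ck_with P j U (u al)) ->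
    forall al, Ck_with P j.+1 U (u al).
  move=> jk Cu al; have [q C1 pq] := C1u al; apply/(CkS aP); exists q => // i.
  apply: (Ck_poly aP rU _ (pq i)) => f [[i' ->]//|[[b ->]|[h ->]]].
    exact: (Ck_le aP rU jk).
  apply: (Ck_comp aP rU rV UV UVi C1Q); last exact: (Ck_le aP rV jk).
  by move=> i' a; have [b ->] := uA i' a; apply: (Ck_le aP rU (leq_pred j)).
have : forall j, (j <= k.+1)%N -> forall al, Ck_with P j U (u al).
  elim=> [_ al|j IH jk]; last by apply: step => //; apply: IH; exact: ltnW.
  by have [q C1 _] := C1u al; exact: (adm_C1 aP rU C1).
by apply.
Qed.

End System.
End Closed_systems.

(** * The system of a conformal map *)

Section Contraction.
Variables (R : realType) (n : nat).

Lemma sum_delta (F : 'I_n -> R) (k : 'I_n) : \sum_i F i * (i == k)%:R = F k.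
Proof.
rewrite (bigD1 k) //= eqxx mulr1 big1 ?addr0 // => i /negPf ->; by rewrite mulr0.
Qed.

(* The contraction with gamma that recovers the Hessian of the conformal factor
   from the curvature identity; this is where n >= 3 enters. *)
Lemma hessian_contraction (g ga c2 : 'I_n -> 'I_n -> R) (R4 : 'I_n -> 'I_n -> 'I_n -> 'I_n -> R) :
  (3 <= n)%N ->
  (forall i k, \sum_j ga i j * g j k = (i == k)%:R) ->
  (forall i j, ga i j = ga j i) -> (forall i j, g i j = g j i) ->
  (forall l m i p, c2 l i * g m p - c2 l p * g m i - c2 m i * g l p + c2 m p * g l i = R4 l m i p) ->
  let Q l i := \sum_m \sum_p ga m p * R4 l m i p in
  forall l i, c2 l i = (n%:R - 2)^-1 * (Q l i - (2 * (n%:R - 1))^-1 * (\sum_l \sum_i ga l i * Q l i) * g l i).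
Proof.
move=> n3 gag gas gs H Q l i.
have n3' : (3:R) <= n%:R by rewrite ler_nat.
pose tau := \sum_m \sum_p ga m p * c2 m p.
(* The four terms contract to [n c2], [c2], [c2] and [tau g], with signs plus, minus, minus,
   plus. *)
have HQ l' i' : Q l' i' = (n%:R - 2) * c2 l' i' + tau * g l' i'.
  rewrite /Q; under eq_bigr do under eq_bigr do rewrite -H.
  transitivity (\sum_m \sum_p ga m p * (c2 l' i' * g m p) - \sum_m \sum_p ga m p * (c2 l' p * g m i')
     - \sum_m \sum_p ga m p * (c2 m i' * g l' p) + \sum_m \sum_p ga m p * (c2 m p * g l' i')).
    rewrite -!sumrB -big_split /=; apply: eq_bigr => m _.
    by rewrite -!sumrB -big_split /=; apply: eq_bigr => p _; ring.
  have -> : \sum_m \sum_p ga m p * (c2 l' i' * g m p) = n%:R * c2 l' i'.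
    transitivity (\sum_(m < n) c2 l' i'); last by rewrite sumr_const card_ord mulr_natl.
    apply: eq_bigr => m _; transitivity (c2 l' i' * \sum_p ga m p * g p m).
      by rewrite big_distrr; apply: eq_bigr => p _ /=; rewrite (gs p m); ring.
    by rewrite gag eqxx mulr1.
  have -> : \sum_m \sum_p ga m p * (c2 l' p * g m i') = c2 l' i'.
    rewrite exchange_big /= -(sum_delta (c2 l') i'); apply: eq_bigr => p _.
    by rewrite -gag big_distrr /=; apply: eq_bigr => m _; rewrite (gas p m); ring.
  have -> : \sum_m \sum_p ga m p * (c2 m i' * g l' p) = c2 l' i'.
    rewrite -(sum_delta (c2 ^~ i') l'); apply: eq_bigr => m _.
    by rewrite -gag big_distrr /=; apply: eq_bigr => p _; rewrite (gs l' p); ring.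
  have -> : \sum_m \sum_p ga m p * (c2 m p * g l' i') = tau * g l' i'.
    rewrite /tau big_distrl /=; apply: eq_bigr => m _; rewrite big_distrl /=.
    by apply: eq_bigr => p _; ring.
  by ring.
(* A second contraction gives [(n - 2) tau + n tau], which determines the trace [tau]. *)
have -> : \sum_l \sum_i ga l i * Q l i = 2 * (n%:R - 1) * tau.
  transitivity ((n%:R - 2) * tau + \sum_m \sum_p ga m p * (tau * g m p)).
    rewrite /tau big_distrr -big_split /=; apply: eq_bigr => m _.
    by rewrite big_distrr -big_split /=; apply: eq_bigr => p _; rewrite HQ /tau; ring.
  have -> : \sum_m \sum_p ga m p * (tau * g m p) = n%:R * tau.
    transitivity (\sum_(m < n) tau); last by rewrite sumr_const card_ord mulr_natl.
    apply: eq_bigr => m _; transitivity (tau * \sum_p ga m p * g p m).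
      by rewrite big_distrr; apply: eq_bigr => p _ /=; rewrite (gs p m); ring.
    by rewrite gag eqxx mulr1.
  by ring.
rewrite HQ; have ? : (n%:R - 1 : R) != 0 by lra.
have ? : (n%:R - 2 : R) != 0 by lra.
by field; apply/andP.
Qed.

End Contraction.

Section Poly_matrices.
Variables (R : realType) (n : nat).
Notation E := 'rV[R]_n.
Notation fn := (E -> R).
Implicit Types (G : fn -> Prop).

Lemma poly_prod G (I : Type) (s : seq I) (F : I -> fn) : (forall i, poly G (F i)) ->
  poly G (fun x => \prod_(i <- s) F i x).
Proof.
move=> pF; elim: s => [|i s IH].
  have -> : (fun x => \prod_(i <- [::]) F i x) = (fun=> 1) by apply/funext => x; rewrite big_nil.
  exact: poly_cst.
have -> : (fun x => \prod_(j <- i :: s) F j x) = (fun x => F i x * \prod_(j <- s) F j x).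
  by apply/funext => x; rewrite big_cons.
exact: poly_mul.
Qed.

Lemma poly_det G m (M : E -> 'M[R]_m) : (forall i j, poly G (fun x => M x i j)) ->
  poly G (fun x => \det (M x)).
Proof.
move=> pM; apply: poly_sum => s; apply: poly_mul; first exact: poly_cst.
exact: poly_prod.
Qed.

Lemma poly_adj G m (M : E -> 'M[R]_m) i j : (forall i j, poly G (fun x => M x i j)) ->
  poly G (fun x => (\adj (M x)) i j).
Proof.
move=> pM; have -> : (fun x => (\adj (M x)) i j) = (fun x => (-1) ^+ (j + i) * \det (row' j (col' i (M x)))).
  by apply/funext => x; rewrite mxE /cofactor.
apply: poly_mul; first exact: poly_cst.
apply: poly_det => k l.
have -> : (fun x => row' j (col' i (M x)) k l) = (fun x => M x (lift j k) (lift i l)).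
  by apply/funext => x; rewrite !mxE.
exact: pM.
Qed.

(** Cramer's rule: the entries are polynomials in those of [M] divided by a nonvanishing
    determinant. *)
Lemma Ck_invmx k (U : set E) m (M : E -> 'M[R]_m) : rdom U ->
  (forall x, U x -> M x \in unitmx) ->
  (forall i j, Ck_with (@cont_class R n) k U (fun x => M x i j)) ->
  forall i j, Ck_with (@cont_class R n) k U (fun x => invmx (M x) i j).
Proof.
move=> rU uM CM i j; have aP := @adm_cont_class R n.
pose G (f : fn) := Ck_with (@cont_class R n) k U f.
have pM i' j' : poly G (fun x => M x i' j') by apply: poly_atom; exact: CM.
have Gp f : poly G f -> G f by apply: (Ck_poly aP rU).
apply: (@Ck_eq _ _ _ aP _ _ (fun x => (\det (M x))^-1 * (\adj (M x)) i j)).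
  by move=> x Ux; rewrite /invmx uM // [RHS]mxE.
apply: (Ck_mul aP rU); last by apply/Gp/poly_adj.
apply: Ck_inv => //; last by apply/Gp/poly_det.
by move=> x /uM; rewrite unitmxE unitfE.
Qed.

End Poly_matrices.

Section Inverse_matrix.
Variables (R : realType) (n : nat).
Notation E := 'rV[R]_n.
Notation fn := (E -> R).
Implicit Types (f : fn).

Lemma C1on_sum (I : Type) (s : seq I) (F : I -> fn) (q : I -> 'I_n -> fn) (U : set E) :
  (forall i, C1on U (F i) (q i)) ->
  C1on U (fun x => \sum_(i <- s) F i x) (fun l x => \sum_(i <- s) q i l x).
Proof.
move=> C1; split.
- by apply: econt_sum => i; case: (C1 i).
- by move=> l; apply: econt_sum => i; case: (C1 i).
- move=> l x Ux; elim: s => [|i s IH].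
    have -> : (fun x => \sum_(i <- [::]) F i x) = (fun=> 0) by apply/funext => y; rewrite big_nil.
    rewrite big_nil; exact: is_derive_cst.
  have -> : (fun x => \sum_(j <- i :: s) F j x) = (fun x => F i x + \sum_(j <- s) F j x).
    by apply/funext => y; rewrite big_cons.
  by rewrite big_cons; apply: is_deriveD => //; case: (C1 i) => _ _; apply.
Qed.

(** Differentiating [F G = 1] gives [F' G = - F G']; multiply by [F] on the right, using
    [G F = 1]. *)
Lemma inverse_der (U : set E) m (F G : 'I_m -> 'I_m -> fn) (F1 G1 : 'I_n -> 'I_m -> 'I_m -> fn) :
  (forall i j, C1on U (F i j) (fun l => F1 l i j)) ->
  (forall i j, C1on U (G i j) (fun l => G1 l i j)) ->
  (forall x, U x -> forall i j, \sum_k F i k x * G k j x = (i == j)%:R) ->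
  forall l i j x, U° x -> F1 l i j x = - \sum_k \sum_p F i k x * G1 l k p x * F p j x.
Proof.
move=> HF HG FG l i j x Ux; have Ux' := interior_subset Ux.
have GF p q : \sum_k G p k x * F k q x = (p == q)%:R.
  have : (\matrix_(i, j) F i j x) *m (\matrix_(i, j) G i j x) = 1%:M.
    by apply/matrixP => p' q'; rewrite !mxE -(FG x Ux'); apply: eq_bigr => k _; rewrite !mxE.
  move=> /mulmx1C /matrixP/(_ p q); rewrite !mxE => <-; apply: eq_bigr => k _; by rewrite !mxE.
have E1 k : \sum_p (F i p x * G1 l p k x + G p k x * F1 l i p x) = 0.
  have [_ _ d1] := C1on_sum (index_enum 'I_m) (fun p => C1onM (HF i p) (HG p k)).
  have {}d1 := d1 l x Ux.
  have := is_derive_uniq (eq_is_derive Ux (fun y Uy => FG y Uy i k) d1).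
  by move=> /(_ _ (is_derive_cst _ _ _)).
apply/esym; transitivity (\sum_p F1 l i p x * (p == j)%:R); last exact: sum_delta.
transitivity (\sum_k (\sum_p G p k x * F1 l i p x) * F k j x).
  rewrite exchange_big -sumrN; apply: eq_bigr => k _ /=.
  have := E1 k; rewrite big_split /= addrC => /eqP; rewrite addr_eq0 => /eqP ->.
  by rewrite mulNr big_distrl.
rewrite (eq_bigr (fun k => \sum_p F1 l i p x * (G p k x * F k j x))).
  by rewrite exchange_big /=; apply: eq_bigr => p _; rewrite -big_distrr /= GF.
by move=> k _; rewrite big_distrl; apply: eq_bigr => p _ /=; ring.
Qed.

End Inverse_matrix.

Section Conformal_system.
Variables (R : realType) (n : nat).
Notation E := 'rV[R]_n.
Notation fn := (E -> R).
Notation e_ := (@basis_vec R n).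
Notation CK := (Ck_with (@cont_class R n)).
Implicit Types (f : fn).

Lemma CK2 (U : set E) f q (r : 'I_n -> 'I_n -> fn) : C1on U f q -> (forall i, C1on U (q i) (r i)) ->
  CK 2 U f.
Proof.
have aP := @adm_cont_class R n.
move=> C1 C2; apply/(CkS aP); exists q => // i; apply/(CkS aP); exists (r i) => // j.
by apply/within_econt; case: (C2 i) => _ + _; apply.
Qed.

(** Jets are packed into one family over a finite type, as the uniform constants of the analytic
    case are taken over finite types. *)
Definition jet1 (g : 'I_n -> 'I_n -> fn) (g1 : 'I_n -> 'I_n -> 'I_n -> fn)
    (s : 'I_n * 'I_n + 'I_n * 'I_n * 'I_n) : fn :=
  match s with inl p => g p.1 p.2 | inr p => g1 p.1.1 p.1.2 p.2 end.

Definition jet2 g g1 (g2 : 'I_n -> 'I_n -> 'I_n -> 'I_n -> fn)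
    (s : ('I_n * 'I_n + 'I_n * 'I_n * 'I_n) + 'I_n * 'I_n * 'I_n * 'I_n) : fn :=
  match s with inl s1 => jet1 g g1 s1 | inr p => g2 p.1.1.1 p.1.1.2 p.1.2 p.2 end.

(** Kept apart from [dc]: differentiating a polynomial in these produces [dc] but not the Hessian of
    [c], for which no formula is available at that stage. *)
Definition conf_unknowns0 (A ga : 'I_n -> 'I_n -> fn) (c : fn)
    (s : 'I_n * 'I_n + 'I_n * 'I_n + bool) : fn :=
  match s with
  | inl (inl p) => A p.1 p.2
  | inl (inr p) => ga p.1 p.2
  | inr b => if b then c else fun x => (c x)^-1
  end.

Definition conf_unknowns A ga c (c1 : 'I_n -> fn)
    (s : ('I_n * 'I_n + 'I_n * 'I_n + bool) + 'I_n) : fn :=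
  match s with inl s0 => conf_unknowns0 A ga c s0 | inr i => c1 i end.

Definition inv_metric (g : 'I_n -> 'I_n -> fn) i j : fn :=
  fun x => invmx (\matrix_(i, j) g i j x) i j.

(* The outermost derivative comes first: g2 l m i j is d_l d_m g_ij. *)
Variables (U V : set E) (Q : E -> E) (A : 'I_n -> 'I_n -> fn)
  (A1 : 'I_n -> 'I_n -> 'I_n -> fn) (A2 : 'I_n -> 'I_n -> 'I_n -> 'I_n -> fn)
  (g h : 'I_n -> 'I_n -> fn) (g1 h1 : 'I_n -> 'I_n -> 'I_n -> fn)
  (g2 h2 : 'I_n -> 'I_n -> 'I_n -> 'I_n -> fn) (c : fn).
Hypotheses (n3 : (3 <= n)%N) (am : admissible_map Q U V A)
  (HA1 : forall i a, C1on U (A i a) (fun l => A1 l i a))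
  (HA2 : forall l i a, C1on U (A1 l i a) (fun m => A2 m l i a))
  (Hg1 : forall i j, C1on U (g i j) (fun m => g1 m i j))
  (Hg2 : forall m i j, C1on U (g1 m i j) (fun l => g2 l m i j))
  (Hh1 : forall i j, C1on V (h i j) (fun m => h1 m i j))
  (Hh2 : forall m i j, C1on V (h1 m i j) (fun l => h2 l m i j))
  (gs : forall x, U x -> forall i j, g i j x = g j i x)
  (hs_ : forall x, V x -> forall i j, h i j x = h j i x)
  (gu : forall x, U x -> (\matrix_(i, j) g i j x) \in unitmx)
  (c0 : forall x, U x -> c x != 0)
  (conf : forall x, U x -> forall i j,
     \sum_a \sum_b A i a x * h a b (Q x) * A j b x = c x * g i j x).

Notation ga := (inv_metric g).

Let aP := @adm_cont_class R n.
Let rU : rdom U := am_rdom am.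
Let rV : rdom V := am_rdom' am.
Let UV := am_map am.
Let UVi := am_int am.
Let C1Q := am_C1 am.

Local Lemma ga_g x : U x -> forall i k, \sum_j ga i j x * g j k x = (i == k)%:R.
Proof.
move=> Ux i k; have := mulVmx (gu Ux) => /matrixP/(_ i k); rewrite !mxE => <-.
by apply: eq_bigr => j _; rewrite /inv_metric mxE.
Qed.

Local Lemma ga_sym x : U x -> forall i j, ga i j x = ga j i x.
Proof.
move=> Ux i j; rewrite /inv_metric; set G := \matrix_(i, j) _.
have GT : G^T = G by apply/matrixP => k l; rewrite !mxE gs.
by rewrite -[in LHS]GT -trmx_inv mxE.
Qed.

Local Lemma CKg i j : CK 2 U (g i j). Proof. exact: CK2 (Hg1 i j) (fun m => Hg2 m i j). Qed.
Local Lemma CKA i j : CK 2 U (A i j). Proof. exact: CK2 (HA1 i j) (fun m => HA2 m i j). Qed.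
Local Lemma CKga i j : CK 2 U (ga i j).
Proof.
apply: Ck_invmx => // i' j'; apply: (Ck_eq aP) (CKg i' j') => x _; by rewrite mxE.
Qed.
Local Lemma CKhQ i j : CK 2 U (h i j \o Q).
Proof.
apply: (Ck_comp aP rU rV UV UVi C1Q); last exact: CK2 (Hh1 i j) (fun m => Hh2 m i j).
by move=> k a; apply: (Ck_lower aP) => //; apply: CKA.
Qed.

(** By conformality [n c] is the trace of [g^-1 A h A^T], so [c] inherits the regularity of [A] and
    of the metrics. *)
Local Lemma CKc : CK 2 U c.
Proof.
apply: (@Ck_eq _ _ _ aP _ _ (fun x => n%:R^-1 * \sum_i \sum_j ga i j x * \sum_a \sum_b A j a x * (h a b \o Q) x * A i b x)).
  move=> x Ux; under eq_bigr do under eq_bigr do rewrite conf //.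
  rewrite (eq_bigr (fun=> c x)).
    rewrite sumr_const card_ord -(mulr_natl (c x) n) mulKf // pnatr_eq0; by case: n n3.
  move=> i _; transitivity (c x * \sum_j ga i j x * g j i x).
    by rewrite big_distrr; apply: eq_bigr => j _ /=; ring.
  by rewrite ga_g // eqxx mulr1.
apply: (Ck_mul aP) => //; first exact: (Ck_cst aP).
do 2!(apply: (Ck_sum aP) => ?); apply: (Ck_mul aP) => //; first exact: CKga.
do 2!(apply: (Ck_sum aP) => ?); apply: (Ck_mul aP) => //; last exact: CKA.
by apply: (Ck_mul aP) => //; [exact: CKA|exact: CKhQ].
Qed.

Section With_dc.
Variables (c1 : 'I_n -> fn) (c2 : 'I_n -> 'I_n -> fn).
Hypotheses (Hc1 : C1on U c c1) (Hc2 : forall i, C1on U (c1 i) (fun l => c2 l i)).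

(* Sf m i j stands for h(d_m A_i, A_j), which Koszul's formula extracts from the
   derivative of the conformality equation; Bf is the inverse of h A^T. *)
Let Kf m i j : fn := fun x => c x * g1 m i j x -
  \sum_e \sum_a \sum_b A m e x * (h1 e a b \o Q) x * A i a x * A j b x.
Let kf m i j : fn := fun x => 2^-1 * (Kf m i j x + Kf i m j x - Kf j m i x).
Let Bf j a : fn := fun x => (c x)^-1 * \sum_k ga j k x * A k a x.
Let Sf m i j : fn := fun x =>
  2^-1 * (c1 m x * g i j x + c1 i x * g m j x - c1 j x * g m i x) + kf m i j x.

(** [at0] lacks [dc], [at1] has it, [at2] adds the second jets. The derivative of [A] is a
    polynomial over [at1]; only the Hessian of [c] and the derivatives of jets require [at2]. *)
Notation at0 := (atoms (conf_unknowns0 A ga c) (jet1 g g1) (jet1 h h1) Q).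
Notation at1 := (atoms (conf_unknowns A ga c c1) (jet1 g g1) (jet1 h h1) Q).
Notation at2 := (atoms (conf_unknowns A ga c c1) (jet2 g g1 g2) (jet2 h h1 h2) Q).

Local Lemma at01 f : at0 f -> at1 f.
Proof. by case=> [[i ->]|[[j ->]|[k ->]]]; [left; exists (inl i)|right; left; exists j|right; right; exists k]. Qed.
Local Lemma at12 f : at1 f -> at2 f.
Proof. by case=> [[i ->]|[[j ->]|[k ->]]]; [left; exists i|right; left; exists (inl j)|right; right; exists (inl k)]. Qed.

Local Lemma pA i a : poly at0 (A i a). Proof. by apply: poly_atom; left; exists (inl (inl (i, a))). Qed.
Local Lemma pga i a : poly at0 (ga i a). Proof. by apply: poly_atom; left; exists (inl (inr (i, a))). Qed.
Local Lemma pc : poly at0 c. Proof. by apply: poly_atom; left; exists (inr true). Qed.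
Local Lemma pci : poly at0 (fun x => (c x)^-1). Proof. by apply: poly_atom; left; exists (inr false). Qed.
Local Lemma pg i j : poly at0 (g i j). Proof. by apply: poly_atom; right; left; exists (inl (i, j)). Qed.
Local Lemma pg1 m i j : poly at0 (g1 m i j). Proof. by apply: poly_atom; right; left; exists (inr (m, i, j)). Qed.
Local Lemma ph1 m i j : poly at0 (h1 m i j \o Q). Proof. by apply: poly_atom; right; right; exists (inr (m, i, j)). Qed.
Local Lemma pc1 i : poly at1 (c1 i). Proof. by apply: poly_atom; left; exists (inr i). Qed.
Local Lemma p01 f : poly at0 f -> poly at1 f. Proof. exact: poly_mono at01. Qed.
Local Lemma p12 f : poly at1 f -> poly at2 f. Proof. exact: poly_mono at12. Qed.

Local Lemma pk m i j : poly at0 (kf m i j).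
Proof.
have pK m' i' j' : poly at0 (Kf m' i' j').
  apply: poly_sub; first by apply: poly_mul; [exact: pc|exact: pg1].
  do 3!(apply: poly_sum => ?).
  by do 2!(apply: poly_mul; last exact: pA); apply: poly_mul; [exact: pA|exact: ph1].
apply: poly_mul; first exact: poly_cst.
by apply: poly_sub => //; apply: poly_add.
Qed.

Local Lemma pB j a : poly at0 (Bf j a).
Proof.
apply: poly_mul; first exact: pci.
by apply: poly_sum => k; apply: poly_mul; [exact: pga|exact: pA].
Qed.

Local Lemma pS m i j : poly at1 (Sf m i j).
Proof.
apply: poly_add; last exact/p01/pk.
apply: poly_mul; first exact: poly_cst.
by do 2?apply: poly_add; do ?apply: poly_opp; apply: poly_mul; try exact: pc1; exact/p01/pg.
Qed.

(** Conformality says that [h A^T c^-1 g^-1] is a right inverse of [A]; for square matrices it is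
    also a left inverse. *)
Local Lemma Binv_B x : U x ->
  ((\matrix_(a, b) h a b (Q x)) *m (\matrix_(i, a) A i a x)^T) *m (\matrix_(j, a) Bf j a x) = 1%:M.
Proof.
move=> Ux; set Am := \matrix_(i, a) A i a x; set Hm := \matrix_(a, b) h a b (Q x).
pose Gm := \matrix_(i, j) g i j x.
have -> : \matrix_(j, a) Bf j a x = (c x)^-1 *: (invmx Gm *m Am).
  apply/matrixP => j a; rewrite !mxE; congr (_ * _); apply: eq_bigr => k _; by rewrite !mxE.
have AHA : Am *m Hm *m Am^T = c x *: Gm.
  apply/matrixP => k l; rewrite !mxE -conf // exchange_big /=; apply: eq_bigr => b _.
  by rewrite !mxE big_distrl /=; apply: eq_bigr => a' _; rewrite !mxE.
have AB : Am *m (Hm *m Am^T *m ((c x)^-1 *: invmx Gm)) = 1%:M.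
  by rewrite !mulmxA AHA -scalemxAl -scalemxAr scalerA mulfV ?c0 // scale1r mulmxV // gu.
have := mulmx1C AB; rewrite -[_ *m _ *m _ *m Am]mulmxA => <-.
by rewrite -scalemxAl.
Qed.

(** As for Christoffel symbols: [S'] is symmetric in its first two indices by Schwarz, and its
    symmetrization in the last two is known from the differentiated conformality equation.
    Multiplying by [Bf] then recovers [dA]. *)
Local Lemma A1E x m i a : U° x -> A1 m i a x = \sum_j Sf m i j x * Bf j a x.
Proof.
move=> Ux; have Ux' := interior_subset Ux.
pose S' m i j := \sum_a \sum_b A1 m i a x * h a b (Q x) * A j b x.
have Ssym m' i' j' : S' m' i' j' = S' i' m' j'.
  apply: eq_bigr => a' _; apply: eq_bigr => b' _; congr (_ * _ * _).
  apply: (@schwarz R n U (fun x => Q x 0 a') (A ^~ a') (fun i m => A1 m i a') x i' m' rU Ux).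
    by move=> k y Uy; case: (C1Q a') => _ _; apply.
  by move=> k; apply: HA1.
have ST m' i' j' : S' m' i' j' + S' m' j' i' = c1 m' x * g i' j' x + Kf m' i' j' x.
  have d1 := C1on_sum (index_enum 'I_n) (fun a' => C1on_sum (index_enum 'I_n) (fun b' =>
     C1onM (C1onM (HA1 i' a') (C1on_comp rV UV UVi C1Q (Hh1 a' b'))) (HA1 j' b'))).
  have d2 := C1onM Hc1 (Hg1 i' j').
  case: d1 => _ _ /(_ m' x Ux) d1; case: d2 => _ _ /(_ m' x Ux) d2.
  have := is_derive_uniq (eq_is_derive Ux (fun y Uy => conf Uy i' j') d1) d2.
  rewrite /Kf => E1; transitivity (c x * g1 m' i' j' x + g i' j' x * c1 m' x -
    \sum_e \sum_a \sum_b A m' e x * (h1 e a b \o Q) x * A i' a x * A j' b x); last by ring.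
  have -> : \sum_e \sum_a \sum_b A m' e x * (h1 e a b \o Q) x * A i' a x * A j' b x =
     \sum_a \sum_b A j' b x * (A i' a x * \sum_e A m' e x * h1 e a b (Q x)).
    rewrite exchange_big /=; apply: eq_bigr => a' _; rewrite exchange_big /=.
    by apply: eq_bigr => b' _; rewrite !big_distrr /=; apply: eq_bigr => e _; ring.
  have -> : S' m' j' i' = \sum_a \sum_b A i' a x * h a b (Q x) * A1 m' j' b x.
    rewrite /S' exchange_big /=; apply: eq_bigr => a' _; apply: eq_bigr => b' _.
    by rewrite (hs_ (UV Ux') a' b'); ring.
  rewrite -E1 /S' -big_split -sumrB /=; apply: eq_bigr => a' _.
  rewrite -big_split -sumrB /=; apply: eq_bigr => b' _.
  by ring.
(* Two of the permuted identities minus the third leave twice [S' m i j]. *)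
have SE j : S' m i j = Sf m i j x.
  have := ST m i j; have := ST i m j; have := ST j m i.
  rewrite (Ssym i m j) (Ssym j m i) (Ssym j i m) /Sf /kf => ? ? ?.
  lra.
pose Am := \matrix_(i, a) A i a x; pose Hm := \matrix_(a, b) h a b (Q x).
pose Bm := \matrix_(j, a) Bf j a x; pose r := \row_a A1 m i a x.
have rE : r *m (Hm *m Am^T) = \row_j Sf m i j x.
  apply/rowP => j; rewrite mulmxA !mxE -SE /S' exchange_big /=; apply: eq_bigr => b _.
  by rewrite !mxE big_distrl /=; apply: eq_bigr => a' _; rewrite !mxE.
have : r = (\row_j Sf m i j x) *m Bm by rewrite -rE -mulmxA Binv_B // mulmx1.
by move/rowP/(_ a); rewrite !mxE => ->; apply: eq_bigr => j _; rewrite !mxE.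
Qed.


Let Binv a p : fn := fun x => \sum_b h a b (Q x) * A p b x.

Local Lemma B_Binv x : U x -> forall j p, \sum_a Bf j a x * Binv a p x = (j == p)%:R.
Proof.
move=> Ux j p; have := mulmx1C (Binv_B Ux) => /matrixP/(_ j p); rewrite !mxE => <-.
apply: eq_bigr => a _; rewrite !mxE; congr (_ * _).
by apply: eq_bigr => b _; rewrite !mxE.
Qed.

Local Lemma ga_der m i j x : U° x ->
  is_derive x (e_ m) (ga i j) (- \sum_k \sum_l ga i k x * g1 m k l x * ga l j x).
Proof.
move=> Ux; have /boolp.choice[r Hr] : forall p : 'I_n * 'I_n, exists q, C1on U (ga p.1 p.2) q.
  by move=> p; have /(CkS aP)[q ? _] := CKga p.1 p.2; exists q.
have HF i' j' : C1on U (ga i' j') (fun l => r (i', j') l) := Hr (i', j').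
rewrite -(inverse_der (F1 := fun l i j => r (i, j) l) HF Hg1 ga_g m i j Ux).
by case: (HF i j) => _ _; apply.
Qed.

Local Lemma h_der (H0 : fn) (H1 : 'I_n -> fn) l : C1on V H0 H1 ->
  der U l (H0 \o Q) (fun x => \sum_a A l a x * (H1 a \o Q) x).
Proof. by move=> C1 x Ux; have [_ _] := C1on_comp rV UV UVi C1Q C1; apply. Qed.

Local Lemma der0 l f : poly at0 f -> exists2 q, poly at2 q & der U l f q.
Proof.
apply: poly_der => a; first by move/at01/at12; exact: poly_atom.
have pSB m i j : poly at2 (fun x => \sum_k Sf m i k x * Bf k j x).
  by apply/p12; apply: poly_sum => k; apply: poly_mul; [exact: pS|exact/p01/pB].
case=> [[i ->]|[[j ->]|[k ->]]].
- case: i => [[[i b]|[i j]]|[]] /=.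
  + exists (fun x => \sum_k Sf l i k x * Bf k b x) => // x Ux; rewrite -A1E //.
    by case: (HA1 i b) => _ _; apply.
  + exists (fun x => - \sum_k \sum_m ga i k x * g1 l k m x * ga m j x).
      apply: poly_opp; do 2!(apply: poly_sum => ?); apply/p12/p01.
      by apply: poly_mul; [apply: poly_mul; [exact: pga|exact: pg1]|exact: pga].
    by move=> x Ux; apply: ga_der.
  + by exists (c1 l); [exact/p12/pc1|case: Hc1 => _ _; apply].
  + exists (fun x => - ((c x)^-1 * (c x)^-1 * c1 l x)).
      apply: poly_opp; apply: poly_mul; last exact/p12/pc1.
      by apply: poly_mul; exact/p12/p01/pci.
    by move=> x Ux; have [_ _] := C1onV c0 Hc1; apply.
- case: j => [[i j]|[[m i] j]] /=.
    by exists (g1 l i j); [exact/p12/p01/pg1|case: (Hg1 i j) => _ _; apply].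
  exists (g2 l m i j); last by case: (Hg2 m i j) => _ _; apply.
  by apply: poly_atom; right; left; exists (inr (l, m, i, j)).
- case: k => [[i j]|[[m i] j]] /=.
    exists (fun x => \sum_a A l a x * (h1 a i j \o Q) x); last exact: h_der.
    by apply: poly_sum => b; apply: poly_mul; [exact/p12/p01/pA|exact/p12/p01/ph1].
  exists (fun x => \sum_a A l a x * (h2 a m i j \o Q) x); last exact: h_der (Hh2 m i j).
  apply: poly_sum => b; apply: poly_mul; first exact/p12/p01/pA.
  by apply: poly_atom; right; right; exists (inr (b, m, i, j)).
Qed.

(** The integrability condition of the formula for [dA]. The Hessian of [c] enters it linearly,
    through its Kulkarni-Nomizu product with [g], and [hessian_contraction] solves for it. *)
Local Lemma c2_poly l i : exists2 q, poly at2 q & forall x, U° x -> c2 l i x = q x.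
Proof.
(* The derivatives of [kf] and [Bf] are kept abstract: it only matters that they are polynomials
   over [at2] and so do not contain the Hessian of [c]. *)
have /boolp.choice[k1 hk1] : forall p : 'I_n * 'I_n * 'I_n * 'I_n, exists q, poly at2 q /\
    der U p.1.1.1 (kf p.1.1.2 p.1.2 p.2) q.
  by move=> p; have [q ? ?] := der0 p.1.1.1 (pk p.1.1.2 p.1.2 p.2); exists q.
have /boolp.choice[B1 hB1] : forall p : 'I_n * 'I_n * 'I_n, exists q, poly at2 q /\
    der U p.1.1 (Bf p.1.2 p.2) q.
  by move=> p; have [q ? ?] := der0 p.1.1 (pB p.1.2 p.2); exists q.
(* [Zf] is the part of the derivative of [Sf] without the Hessian of [c]. [R4] collects everything
   of this kind; its factor 2 undoes the [2^-1] in [Sf]. *)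
pose Zf l m i j : fn := fun x => 2^-1 * (c1 m x * g1 l i j x + c1 i x * g1 l m j x - c1 j x * g1 l m i x) + k1 (l, m, i, j) x.
pose R4 l m i p : fn := fun x => 2 * (- (Zf l m i p x - Zf m l i p x) -
   \sum_a (\sum_j (Sf m i j x * B1 (l, j, a) x - Sf l i j x * B1 (m, j, a) x)) * Binv a p x).
pose Qf l i : fn := fun x => \sum_m \sum_p ga m p x * R4 l m i p x.
have pR l' m i' p : poly at2 (R4 l' m i' p).
  have pZ l0 m0 i0 j0 : poly at2 (Zf l0 m0 i0 j0).
    apply: poly_add; last by case: (hk1 (l0, m0, i0, j0)).
    apply: poly_mul; first exact: poly_cst.
    do 2?apply: poly_add; do ?apply: poly_opp; apply: poly_mul; try exact/p12/pc1; exact/p12/p01/pg1.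
  apply: poly_mul; first exact: poly_cst.
  apply: poly_sub; first by apply: poly_opp; apply: poly_sub.
  apply: poly_sum => a; apply: poly_mul.
    apply: poly_sum => j; apply: poly_sub; apply: poly_mul; try exact/p12/pS.
      by case: (hB1 (l', j, a)).
    by case: (hB1 (m, j, a)).
  apply: poly_sum => b; apply: poly_mul; last exact/p12/p01/pA.
  by apply: poly_atom; right; right; exists (inl (inl (a, b))).
have pQ l' i' : poly at2 (Qf l' i').
  by do 2!(apply: poly_sum => ?); apply: poly_mul; [exact/p12/p01/pga|exact: pR].
exists (fun x => (n%:R - 2)^-1 * (Qf l i x - (2 * (n%:R - 1))^-1 * (\sum_l \sum_i ga l i x * Qf l i x) * g l i x)).
  apply: poly_mul; first exact: poly_cst.
  apply: poly_sub => //; apply: poly_mul; last exact/p12/p01/pg.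
  apply: poly_mul; first exact: poly_cst.
  by do 2!(apply: poly_sum => ?); apply: poly_mul; [exact/p12/p01/pga|exact: pQ].
move=> x Ux; have Ux' := interior_subset Ux.
apply: (@hessian_contraction R n (fun i j => g i j x) (fun i j => ga i j x) (fun l i => c2 l i x)
  (fun l m i p => R4 l m i p x) n3) => //; first exact: ga_g; first exact: ga_sym; first exact: gs.
clear l i; move=> l m i p.
pose dS l m i j := 2^-1 * (c2 l m x * g i j x + c1 m x * g1 l i j x + (c2 l i x * g m j x + c1 i x * g1 l m j x)
   - (c2 l j x * g m i x + c1 j x * g1 l m i x)) + k1 (l, m, i, j) x.
have D2 l' m' i' a : A2 l' m' i' a x = \sum_j (Sf m' i' j x * B1 (l', j, a) x + Bf j a x * dS l' m' i' j).
  have dcg b j k : is_derive x (e_ l') (fun y => c1 b y * g j k y) (c1 b x * g1 l' j k x + g j k x * c2 l' b x).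
    by apply: is_deriveM; [case: (Hc2 b) => _ _; apply|case: (Hg1 j k) => _ _; apply].
  have dSj j : is_derive x (e_ l') (Sf m' i' j) (dS l' m' i' j).
    have -> : dS l' m' i' j = 2^-1 *: (c1 m' x * g1 l' i' j x + g i' j x * c2 l' m' x +
        (c1 i' x * g1 l' m' j x + g m' j x * c2 l' i' x) - (c1 j x * g1 l' m' i' x + g m' i' x * c2 l' j x))
        + k1 (l', m', i', j) x.
      by rewrite /dS -[_ *: _]/(_ * _); ring.
    apply: is_deriveD; last by have [_] := hk1 (l', m', i', j); apply.
  have dB j : is_derive x (e_ l') (Bf j a) (B1 (l', j, a) x) by have [_] := hB1 (l', j, a); apply.
  have dR : is_derive x (e_ l') (fun y => \sum_j Sf m' i' j y * Bf j a y)
      (\sum_j (Sf m' i' j x * B1 (l', j, a) x + Bf j a x * dS l' m' i' j)).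
    rewrite (_ : (fun y => _) = \sum_j (fun y => Sf m' i' j y * Bf j a y)); last first.
      by apply/funext => y; rewrite fct_sumE.
    by apply: is_derive_sum => j; apply: is_deriveM.
  have dL : is_derive x (e_ l') (A1 m' i' a) (A2 l' m' i' a x) by case: (HA2 m' i' a) => _ _; apply.
  have Ux2 : (U°)° x by have /interior_id -> := @open_interior _ U.
  exact: is_derive_uniq (eq_is_derive Ux2 (fun y Uy => A1E m' i' a Uy) dL) dR.
have A2s a : A2 l m i a x = A2 m l i a x.
  apply/esym; apply: (@schwarz R n U (A i a) (fun m => A1 m i a) (fun m l => A2 l m i a) x l m rU Ux).
    by move=> k y Uy; case: (HA1 i a) => _ _; apply.
  by move=> k; exact: HA2.
have c2s j k : c2 j k x = c2 k j x.
  apply/esym; apply: (@schwarz R n U c c1 (fun i l => c2 l i) x j k rU Ux).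
    by move=> b y Uy; case: Hc1 => _ _; apply.
  by move=> b; exact: Hc2.
(* Let [d_l] and [d_m] commute on [A], then multiply by [Binv] to remove the factor [Bf] of [dS]. *)
have key : dS l m i p - dS m l i p +
   \sum_a (\sum_j (Sf m i j x * B1 (l, j, a) x - Sf l i j x * B1 (m, j, a) x)) * Binv a p x = 0.
  transitivity (\sum_a (A2 l m i a x - A2 m l i a x) * Binv a p x); last first.
    by rewrite big1 // => a _; rewrite A2s subrr mul0r.
  rewrite -(sum_delta (fun j => dS l m i j - dS m l i j) p).
  under eq_bigr do rewrite -(B_Binv Ux') big_distrr /=.
  rewrite exchange_big -big_split /=; apply: eq_bigr => a _.
  rewrite !D2 -sumrB !big_distrl -big_split /=; apply: eq_bigr => j _; ring.
rewrite /R4; move/eqP: key; rewrite addrC addr_eq0 => /eqP ->.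
rewrite /dS /Zf (c2s l m); lra.
Qed.

Local Lemma conformal_system_aux :
  closed_system (conf_unknowns A ga c c1) (jet2 g g1 g2) (jet2 h h1 h2) Q U V A /\
  forall m i a, exists2 q, poly at1 q & der U m (A i a) q.
Proof.
have dA m i a : exists2 q, poly at1 q & der U m (A i a) q.
  exists (fun x => \sum_k Sf m i k x * Bf k a x).
    by apply: poly_sum => k; apply: poly_mul; [exact: pS|exact/p01/pB].
  by move=> x Ux; rewrite -A1E //; case: (HA1 i a) => _ _; apply.
split=> //; split=> //.
- by move=> i a; exists (inl (inl (inl (i, a)))).
- case=> [[[[i a]|[i j]]|[]]|i] /=.
  + by case: (HA1 i a).
  + exact: (Ck_cont aP) (CKga i j).
  + by case: Hc1.
  + by apply: econtV => //; case: Hc1.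
  + by case: (Hc2 i).
- case=> [s|i] l.
    by apply: der0; apply: poly_atom; left; exists s.
  have [q pq E1] := c2_poly l i; exists q => // x Ux.
  by rewrite -E1 //; case: (Hc2 i) => _ _; apply.
Qed.

End With_dc.

(** The second clause is what avoids the loss of a derivative: [dA] only needs the first jets of the
    metrics, which are one order smoother than the second jets in the closed system. *)
Theorem conformal_system : exists c1 : 'I_n -> fn,
  closed_system (conf_unknowns A ga c c1) (jet2 g g1 g2) (jet2 h h1 h2) Q U V A /\
  forall m i a, exists2 q,
    poly (atoms (conf_unknowns A ga c c1) (jet1 g g1) (jet1 h h1) Q) q & der U m (A i a) q.
Proof.
have /(CkS aP)[c1 Hc1 C2] := CKc.
have /boolp.choice[c2 Hc2] : forall i, exists q, C1on U (c1 i) q.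
  by move=> i; have /(CkS aP)[q ? _] := C2 i; exists q.
exists c1; exact: (@conformal_system_aux c1 (fun l i => c2 i l)).
Qed.

End Conformal_system.

(** * Bounds on all derivatives *)

Section Majorants.
Variable (R : realType).
Implicit Types (F G : nat -> R) (M L K : R).

(* The Leibniz rule for sequences bounding successive derivatives. *)
Definition conv F G l : R := \sum_(j < l.+1) 'C(l, j)%:R * F j * G (l - j)%N.

Lemma conv0 F G : conv F G 0 = F 0 * G 0.
Proof. by rewrite /conv big_ord1 mul1r. Qed.

(** Pascal's rule; it mirrors the derivative of a product. *)
Lemma convS F G l : conv F G l.+1 = conv (F \o S) G l + conv F (G \o S) l.
Proof.
rewrite /conv big_ord_recl /= bin0 subn0 mul1r.
rewrite [X in _ = _ + X]big_ord_recl /= bin0 subn0 mul1r addrCA; congr (_ + _).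
transitivity (\sum_(j < l.+1) ('C(l, j)%:R * F j.+1 * G (l - j)%N + 'C(l, j.+1)%:R * F j.+1 * G (l - j)%N)).
  apply: eq_bigr => j _; rewrite /bump /= add1n subSS binS natrD; ring.
rewrite big_split /=; congr (_ + _).
rewrite big_ord_recr /= bin_small // !mul0r addr0; apply: eq_bigr => j _.
rewrite /bump /= add1n; congr (_ * G _).
by rewrite subnSK.
Qed.

Lemma sum_inv_sqr l : \sum_(j < l.+1) ((j.+1%:R : R)^-1) ^+ 2 <= 2 - l.+1%:R^-1.
Proof.
elim: l => [|l IH]; first by rewrite big_ord1 invr1 expr1n; lra.
rewrite big_ord_recr /=; apply: (@le_trans _ _ (2 - l.+1%:R^-1 + (l.+2%:R^-1) ^+ 2)); first by rewrite lerD2r.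
have a0 : (0:R) < l.+1%:R by rewrite ltr0n.
rewrite -(natr1 l.+1); set a : R := l.+1%:R in a0 *.
have a1 : 0 < a + 1 by lra.
have -> : 2 - a^-1 + (a + 1)^-1 ^+ 2 = 2 - (a + 1)^-1 - a^-1 * ((a + 1)^-1) ^+ 2.
  by field; rewrite !gt_eqF.
by rewrite lerBlDr lerDl mulr_ge0 ?sqr_ge0 // invr_ge0 ltW.
Qed.

(** With [a = j + 1] and [b = l - j + 1] one has [1/(ab) = (1/a + 1/b)/(a + b)] and
    [a + b >= l + 1]. Squaring costs a factor 2, and each of the two sums of inverse squares is at
    most 2, whence 8. *)
Lemma sum_inv_sqr2 l : \sum_(j < l.+1) ((j.+1%:R : R)^-1 * ((l - j)%N.+1%:R)^-1) ^+ 2 <=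
  8 * (l.+1%:R^-1) ^+ 2.
Proof.
have S2 : \sum_(j < l.+1) ((j.+1%:R : R)^-1) ^+ 2 <= 2.
  by apply: le_trans (sum_inv_sqr l) _; rewrite lerBlDr lerDl invr_ge0.
have S2' : \sum_(j < l.+1) (((l - j)%N.+1%:R : R)^-1) ^+ 2 <= 2.
  rewrite (reindex_inj rev_ord_inj) /=; apply: le_trans S2.
  by apply: ler_sum => j _; rewrite subSS subKn ?leq_ord.
apply: (@le_trans _ _ (\sum_(j < l.+1) (2 * (l.+1%:R^-1) ^+ 2 * (((j.+1%:R : R)^-1) ^+ 2 + (((l - j)%N.+1%:R : R)^-1) ^+ 2)))).
  apply: ler_sum => j _.
  have a0 : (0:R) < j.+1%:R by rewrite ltr0n.
  have b0 : (0:R) < (l - j)%N.+1%:R by rewrite ltr0n.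
  have ab : (l.+1%:R : R) <= j.+1%:R + (l - j)%N.+1%:R.
    by rewrite -natrD ler_nat addSn addnS subnKC ?leq_ord ?leqnSn.
  have c0 : (0:R) < l.+1%:R by rewrite ltr0n.
  move: a0 b0 ab c0; set a : R := j.+1%:R; set b : R := (l - j)%N.+1%:R; set c : R := l.+1%:R.
  move=> a0 b0 ab c0.
  have -> : a^-1 * b^-1 = (a + b)^-1 * (a^-1 + b^-1) by field; rewrite !gt_eqF // addr_gt0.
  have -> : 2 * c^-1 ^+ 2 * (a^-1 ^+ 2 + b^-1 ^+ 2) = c^-1 ^+ 2 * (2 * (a^-1 ^+ 2 + b^-1 ^+ 2)) by ring.
  rewrite exprMn; apply: ler_pM; [exact: sqr_ge0|exact: sqr_ge0| |].
    have ab0 : 0 < a + b by exact: addr_gt0.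
    have le1 : (a + b)^-1 <= c^-1 by rewrite lef_pV2.
    by apply: lerXn2r; rewrite ?nnegrE ?invr_ge0 ?(ltW ab0) ?(ltW c0).
  by have := sqr_ge0 (a^-1 - b^-1); move: (a^-1) (b^-1) => x y; rewrite !expr2; nra.
rewrite -big_distrr /= big_split /=.
have c0 : 0 <= (l.+1%:R^-1 : R) ^+ 2 by exact: sqr_ge0.
by move: S2 S2' c0; set x := \sum_j _; set y := \sum_j _; set z := _ ^+ 2; nra.
Qed.

(* The factor (l+1)^-2 makes these weights stable under the Leibniz convolution. *)
Definition wt M g l : R := M ^+ l * (l + g)`!%:R * (l.+1%:R^-1) ^+ 2.

Lemma wt_ge0 M g l : 0 <= M -> 0 <= wt M g l.
Proof. by move=> M0; rewrite /wt !mulr_ge0 ?exprn_ge0 ?sqr_ge0. Qed.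

(** The binomial and factorials are absorbed by [(l + g)!], because 'l choose j' is at most 'l + g
    choose j'. What remains is the sum of the squared weights. *)
Lemma conv_wt M g l : 0 <= M -> conv (wt M 0) (wt M g) l <= 8 * wt M g l.
Proof.
move=> M0; apply: (@le_trans _ _ (\sum_(j < l.+1) M ^+ l * (l + g)`!%:R * ((j.+1%:R : R)^-1 * ((l - j)%N.+1%:R)^-1) ^+ 2)); last first.
  rewrite -big_distrr /=; apply: le_trans (ler_wpM2l _ (sum_inv_sqr2 l)) _.
    by rewrite mulr_ge0 ?exprn_ge0.
  by rewrite /wt le_eqVlt; apply/orP; left; apply/eqP; ring.
apply: ler_sum => j _; have jl : (j <= l)%N by exact: leq_ord.
rewrite /wt addn0 exprMn.
have -> : M ^+ l = M ^+ j * M ^+ (l - j) by rewrite -exprD subnKC.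
set x := _^-1 ^+ 2; set y := _^-1 ^+ 2.
have -> : 'C(l, j)%:R * (M ^+ j * j`!%:R * x) * (M ^+ (l - j) * (l - j + g)`!%:R * y) =
  M ^+ j * M ^+ (l - j) * ('C(l, j) * (j`! * (l - j + g)`!))%:R * (x * y) by rewrite !natrM; ring.
rewrite ler_wpM2r ?mulr_ge0 ?sqr_ge0 // ler_wpM2l ?mulr_ge0 ?exprn_ge0 // ler_nat.
have jlg : (j <= l + g)%N by rewrite (leq_trans jl) // leq_addr.
have -> : (l - j + g = l + g - j)%N by rewrite addnBAC.
rewrite -(bin_fact jlg) leq_mul2r; apply/orP; right.
by apply: leq_bin2l; rewrite leq_addr.
Qed.

Lemma conv_scale (a b : R) F G l : conv (fun l => a * F l) (fun l => b * G l) l = a * b * conv F G l.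
Proof. by rewrite /conv big_distrr /=; apply: eq_bigr => j _; ring. Qed.

(** Raising the order by one gains a factor [M] and loses at most 4, by [(l + 2)^2 <= 4 (l + 1)^2].
    A large [M] can therefore pay for all other constants. *)
Lemma wt_shift M g l : 0 <= M -> 4^-1 * M * wt M g.+1 l <= wt M g l.+1.
Proof.
move=> M0; rewrite /wt addnS addSn (exprS M).
have a0 : (0:R) < l.+1%:R by rewrite ltr0n.
have a1 : (0:R) < l.+2%:R by rewrite ltr0n.
have : 4^-1 * (l.+1%:R^-1 : R) ^+ 2 <= (l.+2%:R^-1) ^+ 2.
  rewrite !exprVn -invfM lef_pV2 ?posrE ?mulr_gt0 ?exprn_gt0 //.
  by rewrite -!natrX -natrM ler_nat; nia.
set x := _^-1 ^+ 2; set y := _^-1 ^+ 2 => xy.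
have : 0 <= M * M ^+ l * ((l + g).+1)`!%:R by rewrite !mulr_ge0 ?exprn_ge0.
move=> z0; have := ler_wpM2l z0 xy; congr (_ <= _); ring.
Qed.

Lemma wt_shift0 M l : 0 <= M -> 4^-1 * M * wt M 0 l <= wt M 0 l.+1.
Proof.
move=> M0; apply: le_trans (wt_shift 0 l M0).
rewrite ler_wpM2l ?mulr_ge0 ?invr_ge0 // /wt ler_wpM2r ?sqr_ge0 // ler_wpM2l ?exprn_ge0 // ler_nat.
by rewrite addn1 addn0 factS leq_pmull.
Qed.

(** The factor [4 ^ l] between the powers of [M] and [L] pays for the weight, as
    [(l + 1)^2 <= 4 ^ l]. *)
Lemma geometric_wt L M l : 0 <= L -> 4 * L <= M -> L ^+ l * l`!%:R <= wt M 0 l.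
Proof.
move=> L0 LM; have M0 : 0 <= M by lra.
have h : (l.+1 ^ 2 <= 4 ^ l)%N.
  elim: l => // l IH; rewrite [(4 ^ l.+1)%N]expnS; apply: leq_trans (leq_mul (leqnn 4) IH).
  nia.
have : L ^+ l <= M ^+ l / (l.+1%:R ^+ 2).
  rewrite ler_pdivlMr ?exprn_gt0 ?ltr0n //.
  apply: (@le_trans _ _ ((4 * L) ^+ l)); last by apply: lerXn2r; rewrite ?nnegrE ?mulr_ge0.
  by rewrite exprMn mulrC ler_wpM2r ?exprn_ge0 // -!natrX ler_nat.
move=> /(ler_wpM2l (ler0n R l`!)); rewrite /wt addn0 exprVn; congr (_ <= _); ring.
Qed.

End Majorants.

(** * Functions with majorized derivatives, and the analytic bootstrap *)

Section Bounds.
Variables (R : realType) (n : nat).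
Notation E := 'rV[R]_n.
Notation fn := (E -> R).
Implicit Types (U V W : set E) (x y z v : E) (f g : fn) (F G : nat -> R) (M L K : R).

(** Differentiation shifts the sequence [F], so no multi-indices are needed: [F l] bounds all
    iterated partial derivatives of order [l], for [l] up to [m]. *)
Fixpoint bnd U F m f : Prop :=
  [/\ econt U f, (forall x, U x -> `|f x| <= F 0%N) &
   if m is m'.+1 then forall i, exists2 q, bnd U (F \o S) m' q & der U i f q else True].

Lemma bnd_cont U F m f : bnd U F m f -> econt U f. Proof. by case: m => [|m] []. Qed.
Lemma bndS U F m f : bnd U F m.+1 f <->
  (forall x, U x -> `|f x| <= F 0%N) /\ exists2 q, C1on U f q & forall i, bnd U (F \o S) m (q i).
Proof.
split=> [[cf lf h]|[lf [q [cf cq dq] Bq]]].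
  have /boolp.choice[q hq] : forall i, exists q, bnd U (F \o S) m q /\ der U i f q.
    by move=> i; have [q ? ?] := h i; exists q.
  split=> //; exists q => [|i]; last by case: (hq i).
  by split=> // i; case: (hq i) => // /bnd_cont.
by split=> // i; exists (q i) => //; apply: dq.
Qed.

Lemma bnd_le U F G m f : (forall l, F l <= G l) -> bnd U F m f -> bnd U G m f.
Proof.
elim: m F G f => [|m IH] F G f FG.
  by case=> cf lf _; split=> // x /lf /le_trans; apply.
move=> /bndS[lf [q C1 Bq]]; apply/bndS; split; first by move=> x /lf /le_trans; apply.
by exists q => // i; apply: IH (Bq i) => l; apply: FG.
Qed.

Lemma bnd_lower U F m f : bnd U F m.+1 f -> bnd U F m f.
Proof.
elim: m F f => [|m IH] F f; first by case=> cf lf _; split.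
by move=> /bndS[lf [q C1 Bq]]; apply/bndS; split=> //; exists q => // i; apply: IH.
Qed.

Lemma bnd_lem U F j m f : (j <= m)%N -> bnd U F m f -> bnd U F j f.
Proof.
elim: m => [|m IH]; first by rewrite leqn0 => /eqP ->.
by rewrite leq_eqVlt => /orP[/eqP -> //|jm] /bnd_lower; apply: IH.
Qed.

Lemma C1on_eq U f g q : (forall x, U x -> f x = g x) -> C1on U f q -> C1on U g q.
Proof.
move=> fg [cf cq dq]; split=> //; first exact: eq_econt cf.
by move=> i x Ux; exact: (eq_is_derive Ux fg (dq i x Ux)).
Qed.

Lemma bnd_eq U F m f g : (forall x, U x -> f x = g x) -> bnd U F m f -> bnd U F m g.
Proof.
case: m => [|m] fg.
  by case=> cf lf _; split=> //; [exact: eq_econt cf|move=> x Ux; rewrite -fg //; exact: lf].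
move=> /bndS[lf [q C1 Bq]]; apply/bndS; split.
  by move=> x Ux; rewrite -fg //; exact: lf.
by exists q => //; apply: C1on_eq C1.
Qed.

Lemma C1onS U V f q : V `<=` U -> C1on U f q -> C1on V f q.
Proof.
move=> VU [cf cq dq]; split; first exact: econtS cf.
  by move=> i; exact: econtS (cq i).
by move=> i x /(interiorS VU); apply: dq.
Qed.

Lemma bnd_sub U V F m f : V `<=` U -> bnd U F m f -> bnd V F m f.
Proof.
move=> VU; elim: m F f => [|m IH] F f.
  by case=> cf lf _; split=> //; [exact: econtS cf|move=> x /VU; exact: lf].
move=> /bndS[lf [q C1 Bq]]; apply/bndS; split; first by move=> x /VU; exact: lf.
by exists q => [|i]; [exact: C1onS C1|exact: IH].
Qed.

Lemma bnd_cst U F m (c : R) : (forall l, 0 <= F l) -> `|c| <= F 0%N -> bnd U F m (fun=> c).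
Proof.
elim: m F c => [|m IH] F c F0 cF; first by split=> // *; exact: econt_cst.
split=> //; first exact: econt_cst.
move=> i; exists (fun=> 0); last by move=> x _; exact: is_derive_cst.
by apply: IH => [l|] /=; rewrite ?normr0.
Qed.

Lemma bnd_add U F G m f g : bnd U F m f -> bnd U G m g ->
  bnd U (fun l => F l + G l) m (fun x => f x + g x).
Proof.
elim: m F G f g => [|m IH] F G f g.
  case=> cf lf _ [cg lg _]; split=> //; first exact: econtD.
  by move=> x Ux; apply: le_trans (ler_normD _ _) _; apply: lerD; [exact: lf|exact: lg].
move=> [cf lf df] [cg lg dg]; split; first exact: econtD.
  by move=> x Ux; apply: le_trans (ler_normD _ _) _; apply: lerD; [exact: lf|exact: lg].
move=> i; have [q Bq dq] := df i; have [r Br dr] := dg i.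
exists (fun x => q x + r x); first exact: IH.
by move=> x Ux; apply: is_deriveD; [exact: dq|exact: dr].
Qed.

Lemma bnd_mul U F G m f g : (forall l, 0 <= F l) -> (forall l, 0 <= G l) ->
  bnd U F m f -> bnd U G m g -> bnd U (conv F G) m (fun x => f x * g x).
Proof.
elim: m F G f g => [|m IH] F G f g F0 G0.
  case=> cf lf _ [cg lg _]; split=> //; first exact: econtM.
  by move=> x Ux; rewrite conv0 normrM; apply: ler_pM; [| |exact: lf|exact: lg].
move=> Bf Bg; have [cf lf df] := Bf; have [cg lg dg] := Bg; split; first exact: econtM.
  by move=> x Ux; rewrite conv0 normrM; apply: ler_pM; [| |exact: lf|exact: lg].
move=> i; have [q Bq dq] := df i; have [r Br dr] := dg i.
exists (fun x => q x * g x + f x * r x); last first.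
  move=> x Ux; rewrite addrC [q x * _]mulrC; apply: is_deriveM; [exact: dq|exact: dr].
have B1 : bnd U (conv (F \o S) G) m (fun x => q x * g x).
  by apply: IH => //; [move=> l; exact: F0|exact: bnd_lower].
have B2 : bnd U (conv F (G \o S)) m (fun x => f x * r x).
  by apply: IH => //; [move=> l; exact: G0|exact: bnd_lower].
by apply: bnd_le (bnd_add B1 B2) => l /=; rewrite convS.
Qed.

Definition swt K M l : R := K * wt M 0 l.

Lemma swt_ge0 K M l : 0 <= K -> 0 <= M -> 0 <= swt K M l.
Proof. by move=> K0 M0; rewrite mulr_ge0 ?wt_ge0. Qed.

Lemma wt00 M (g : nat) : wt M g 0 = g`!%:R.
Proof. by rewrite /wt expr0 add0n invr1 expr1n mul1r mulr1. Qed.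

(** The point is the order of quantifiers: [K'] depends on the polynomial and on [K] but not on [M],
    so that [M] can be chosen afterwards. *)
Lemma bnd_poly (G : fn -> Prop) f : poly G f -> forall K, 0 <= K -> exists2 K', 0 <= K' &
  forall U M m, 0 <= M -> (forall a, G a -> bnd U (swt K M) m a) -> bnd U (swt K' M) m f.
Proof.
move=> pf K K0; elim: pf => [c|a Ga|a b _ [Ka Ka0 Ba] _ [Kb Kb0 Bb]|a b _ [Ka Ka0 Ba] _ [Kb Kb0 Bb]].
- exists `|c| => // U M m M0 _; apply: bnd_cst => [l|]; first exact: swt_ge0.
  by rewrite /swt wt00 mulr1.
- by exists K => // U M m M0; apply.
- exists (Ka + Kb); first exact: addr_ge0.
  move=> U M m M0 BG; apply: bnd_le (bnd_add (Ba U M m M0 BG) (Bb U M m M0 BG)) => l.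
  by rewrite /swt mulrDl.
- exists (8 * (Ka * Kb)); first by rewrite !mulr_ge0.
  move=> U M m M0 BG; apply: bnd_le (bnd_mul _ _ (Ba U M m M0 BG) (Bb U M m M0 BG)) => l;
    try exact: swt_ge0.
  rewrite /swt conv_scale; have := ler_wpM2l (mulr_ge0 Ka0 Kb0) (conv_wt 0 l M0).
  by congr (_ <= _); ring.
Qed.

Lemma bnd_sum (I : Type) (s : seq I) (F : I -> fn) U K M (g : nat) m : 0 <= K -> 0 <= M ->
  (forall i, bnd U (fun l => K * wt M g l) m (F i)) ->
  bnd U (fun l => (size s)%:R * K * wt M g l) m (fun x => \sum_(i <- s) F i x).
Proof.
move=> K0 M0 BF; elim: s => [|i s IH].
  apply: (@bnd_eq _ _ _ (fun=> 0)) => [x _|]; first by rewrite big_nil.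
  by apply: bnd_cst => [l|]; rewrite ?normr0; apply: mulr_ge0; [apply: mulr_ge0| |apply: mulr_ge0|]; rewrite ?wt_ge0.
apply: (@bnd_eq _ _ _ (fun x => F i x + \sum_(j <- s) F j x)) => [x _|]; first by rewrite big_cons.
apply: bnd_le (bnd_add (BF i) IH) => l; rewrite -[size (i :: s)]/(size s).+1 -natr1.
by rewrite le_eqVlt; apply/orP; left; apply/eqP; ring.
Qed.

(* The k-th derivatives of eta composed with Q are treated as independent
   unknowns, so that no formula for higher derivatives of a composition is needed. *)
Lemma bnd_comp U V Q (A : 'I_n -> 'I_n -> fn) KA K L M m :
  admissible_map Q U V A -> 0 <= KA -> 0 <= K -> 0 <= L -> 0 <= M -> 32 * n%:R * KA * L <= M ->
  (forall i a, bnd U (swt KA M) m (A i a)) ->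
  forall j (g : nat) eta, (j <= m.+1)%N -> bnd V (fun l => K * L ^+ (g + l) * (g + l)`!%:R) j eta ->
  bnd U (fun l => K * L ^+ g * wt M g l) j (eta \o Q).
Proof.
move=> am KA0 K0 L0 M0 LM BA; have [rU rV UV UVi C1Q] := am.
have cQ a : econt U (fun x => Q x 0 a) by case: (C1Q a).
elim=> [|j IH] g eta jm.
  case=> ce le _; split=> //; first exact: econt_comp ce UV cQ.
  by move=> x Ux; rewrite wt00; have := le _ (UV _ Ux); rewrite addn0.
move=> /bndS[le [q C1 Bq]]; apply/bndS; split.
  by move=> x Ux; rewrite wt00; have := le _ (UV _ Ux); rewrite addn0.
exists (fun i x => \sum_a A i a x * (q a \o Q) x) => [|i]; first exact: C1on_comp C1.
have Bqa a : bnd U (fun l => K * L ^+ g.+1 * wt M g.+1 l) j (q a \o Q).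
  apply: IH; first exact: ltnW.
  by apply: bnd_le (Bq a) => l /=; rewrite addnS addSn.
have KL : 0 <= K * L ^+ g.+1 by rewrite mulr_ge0 ?exprn_ge0.
have Bm a : bnd U (fun l => 8 * KA * (K * L ^+ g.+1) * wt M g.+1 l) j (fun x => A i a x * (q a \o Q) x).
  have jm' : (j <= m)%N by [].
  have p1 l : 0 <= swt KA M l by exact: swt_ge0.
  have p2 l : 0 <= K * L ^+ g.+1 * wt M g.+1 l by apply: mulr_ge0 => //; exact: wt_ge0.
  apply: bnd_le (bnd_mul p1 p2 (bnd_lem jm' (BA i a)) (Bqa a)) => l.
  - rewrite /swt conv_scale; have := ler_wpM2l (mulr_ge0 KA0 KL) (conv_wt g.+1 l M0).
    by congr (_ <= _); ring.
have := bnd_sum (index_enum 'I_n) _ M0 Bm; rewrite !mulr_ge0 ?exprn_ge0 // => /(_ isT).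
apply: bnd_le => l /=.
have -> : size (index_enum 'I_n) = n by rewrite [index_enum _]unlock -enumT size_enum_ord.
have := ler_wpM2l (mulr_ge0 K0 (exprn_ge0 g L0)) (wt_shift g l M0).
apply: le_trans.
have W0 := @wt_ge0 R M g.+1 l M0.
have T0 : 0 <= K * L ^+ g * wt M g.+1 l by rewrite !mulr_ge0 ?exprn_ge0.
(* The constant [32 n] is 8 from the Leibniz rule, [n] from the sum over components and 4 from the
   shift of the weight. *)
have := ler_wpM2r T0 LM; rewrite exprS; lra.
Qed.

Lemma fin_max (I : finType) (F : I -> R -> Prop) :
  (forall i, exists2 K, 0 <= K & forall K', K <= K' -> F i K') -> exists2 K, 0 <= K & forall i K', K <= K' -> F i K'.
Proof.
move=> h; have /boolp.choice[k hk] : forall i, exists K, 0 <= K /\ forall K', K <= K' -> F i K'.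
  by move=> i; have [K ? ?] := h i; exists K.
exists (\sum_i k i); first by apply: sumr_ge0 => i _; case: (hk i).
move=> i K' KK'; case: (hk i) => _; apply; apply: le_trans KK'.
by rewrite (bigD1 i) //= lerDl sumr_ge0 // => j _; case: (hk j).
Qed.

(** Bounds of order [m] on the unknowns give bounds of order [m] on the atoms with the same [K],
    hence bounds with [K'] on the derivatives of the unknowns. Shifting the weight gains
    [M / 4 >= K'], which restores [K] at order [m.+1]. *)
Theorem closed_system_bnd (I : finType) (J H : Type) (u : I -> fn) (ka : J -> fn) (et : H -> fn)
  (Q : E -> E) U V A K L : 1 <= K -> 1 <= L ->
  closed_system u ka et Q U V A ->
  (forall i x, U x -> `|u i x| <= K) ->
  (forall j m, bnd U (fun l => K * (L ^+ l * l`!%:R)) m (ka j)) ->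
  (forall h m, bnd V (fun l => K * (L ^+ l * l`!%:R)) m (et h)) ->
  exists2 M, 0 <= M & forall m i, bnd U (swt K M) m (u i).
Proof.
move=> K1 L1 [am uA cu du] uK Bka Bet.
have K0 : 0 <= K by lra.
have L0 : 0 <= L by lra.
have [K' K'0 hK'] : exists2 K', 0 <= K' & forall (p : I * 'I_n) K'', K' <= K'' ->
   exists2 q, der U p.2 (u p.1) q & forall U M m, 0 <= M ->
     (forall a, atoms u ka et Q a -> bnd U (swt K M) m a) -> bnd U (swt K'' M) m q.
  apply: fin_max => p; have [q pq dq] := du p.1 p.2; have [Kp Kp0 hp] := bnd_poly pq K0.
  exists Kp => // K'' KK; exists q => // W M m M0 /(hp W M m M0); apply: bnd_le => l.
  by rewrite /swt ler_wpM2r ?wt_ge0.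
(* The three summands serve the data at the point, the data composed with [Q], and the closing of
   the induction. *)
pose M := 4 * L + 32 * n%:R * K * L + 4 * K'.
have n0 : 0 <= n%:R :> R by [].
have t0 : 0 <= 32 * n%:R * K * L by rewrite !mulr_ge0.
have M0 : 0 <= M by rewrite /M; lra.
exists M => //; elim=> [|m IH] i.
  split=> // x Ux; by rewrite /swt wt00 mulr1; exact: uK.
have Bat a : atoms u ka et Q a -> bnd U (swt K M) m a.
  case=> [[j ->]//|[[j ->]|[h ->]]].
    apply: bnd_le (Bka j m) => l; rewrite ler_wpM2l // geometric_wt //; rewrite /M; lra.
  have := @bnd_comp U V Q A K K L M m am K0 K0 L0 M0.
  move=> /(_ _ _ m 0%N (et h)) => H1; apply: bnd_le (H1 _ _ _ _) => //.
  - by move=> l; rewrite expr0 mulr1.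
  - by rewrite /M; lra.
  - by move=> j b; have [b' ->] := uA j b; apply: IH.
  - by apply: bnd_le (Bet h m) => l; rewrite add0n mulrA.
split; first exact: cu.
  by move=> x Ux; rewrite /swt wt00 mulr1; exact: uK.
move=> j; have [q dq Bq] := hK' (i, j) K' (lexx _); exists q => //.
apply: bnd_le (Bq U M m M0 Bat) => l; rewrite /swt /=.
have := ler_wpM2l K0 (wt_shift0 l M0); apply: le_trans.
have W0 := @wt_ge0 R M 0 l M0.
have h1 : 4 * K' <= M by rewrite /M; lra.
have h2 : 0 <= (K - 1) * M by rewrite mulr_ge0 // subr_ge0.
have h3 : K' <= K * 4^-1 * M by lra.
have := ler_wpM2r W0 h3; move: (wt M 0 l) => W; congr (_ <= _); ring.
Qed.

End Bounds.

(** * Analytic functions and derivative bounds *)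

Section Homogeneous.
Variables (R : realType) (n : nat).
Notation E := 'rV[R]_n.
Notation fn := (E -> R).
Notation e_ := (@basis_vec R n).
Implicit Types (p q f : fn) (y : E) (C D : R).

(* Homogeneous polynomials of degree m whose coefficients have absolute sum <= C. *)
Inductive hpoly : nat -> R -> fn -> Prop :=
| hp0 m : hpoly m 0 (fun=> 0)
| hp1 : hpoly 0 1 (fun=> 1)
| hpZ m C (c : R) p : hpoly m C p -> hpoly m (`|c| * C) (fun y => c * p y)
| hpD m C D p q : hpoly m C p -> hpoly m D q -> hpoly m (C + D) (fun y => p y + q y)
| hpX m C i p : hpoly m C p -> hpoly m.+1 C (fun y => y 0 i * p y)
| hpW m C D p : C <= D -> hpoly m C p -> hpoly m D p.

Lemma hpoly_norm m C p : hpoly m C p -> 0 <= C /\ forall y, `|p y| <= C * `|y| ^+ m.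
Proof.
elim=> {m C p} [m||m C c p _ [C0 h]|m C D p q _ [C0 hp] _ [D0 hq]|m C i p _ [C0 h]|m C D p CD _ [C0 h]].
- by split=> // y; rewrite normr0 mul0r.
- by split=> // y; rewrite normr1 expr0 mulr1.
- split; first by rewrite mulr_ge0.
  by move=> y; rewrite normrM -mulrA ler_wpM2l.
- split; first exact: addr_ge0.
  by move=> y; apply: le_trans (ler_normD _ _) _; rewrite mulrDl; apply: lerD.
- split=> // y; rewrite normrM exprS mulrCA; apply: ler_pM => //; exact: coord_le.
- split; first exact: le_trans CD.
  by move=> y; apply: le_trans (h y) _; rewrite ler_wpM2r ?exprn_ge0.
Qed.

Lemma hpoly_sum (I : Type) (s : seq I) (F : I -> fn) (C : I -> R) m :
  (forall i, hpoly m (C i) (F i)) -> hpoly m (\sum_(i <- s) C i) (fun y => \sum_(i <- s) F i y).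
Proof.
move=> hF; elim: s => [|i s IH].
  rewrite big_nil (_ : (fun y => _) = (fun=> 0)); first exact: hp0.
  by apply/funext => y; rewrite big_nil.
rewrite big_cons (_ : (fun y => _) = (fun y => F i y + \sum_(j <- s) F j y)); first exact: hpD.
by apply/funext => y; rewrite big_cons.
Qed.

Lemma coord_is_derive (i j : 'I_n) y : is_derive y (e_ i) (fun y => y 0 j) ((i == j)%:R).
Proof.
apply/is_deriveP => e e0; exists 1 => // h _.
rewrite /basis_vec !mxE eqxx /= (eq_sym j) [X in `|X|](_ : _ = 0); last by ring.
by rewrite normr0 mulr_ge0 // ltW.
Qed.

Lemma hpoly_der m C p : hpoly m C p -> forall i, exists2 q, hpoly m.-1 (m%:R * C) q &
  forall y, is_derive y (e_ i) p (q y).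
Proof.
elim=> {m C p} [m||m C c p _ IH|m C D p q _ IHp _ IHq|m C j p hp IH|m C D p CD hp IH] i.
- by exists (fun=> 0) => [|y]; [rewrite mulr0; exact: hp0|exact: is_derive_cst].
- by exists (fun=> 0) => [|y]; [rewrite mul0r; exact: hp0|exact: is_derive_cst].
- have [q hq dq] := IH i; exists (fun y => c * q y).
    by rewrite mulrCA; exact: hpZ.
  by move=> y; exact: (is_deriveZ c (dq y)).
- have [p' hp' dp] := IHp i; have [q' hq' dq] := IHq i; exists (fun y => p' y + q' y).
    by rewrite mulrDr; exact: hpD.
  by move=> y; exact: is_deriveD.
- have [q hq dq] := IH i; exists (fun y => y 0 j * q y + p y * (i == j)%:R); last first.
    by move=> y; apply: is_deriveM => //; exact: coord_is_derive.
  have h1 : hpoly m (m%:R * C) (fun y => y 0 j * q y).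
    (* In degree 0 the rule [hpX] would yield degree 1; but there the derivative [q] has bound 0 and
       vanishes. *)
    case: m hp hq {IH} => [|m] hp hq; last exact: hpX.
    rewrite mul0r in hq *; rewrite (_ : (fun y => _) = (fun=> 0)); first exact: hp0.
    apply/funext => y; have [_ /(_ y)] := hpoly_norm hq.
    by rewrite mul0r normr_le0 => /eqP ->; rewrite mulr0.
  have h2 : hpoly m C (fun y => p y * (i == j)%:R).
    have [C0 _] := hpoly_norm hp.
    apply: (@hpW _ (`|(i == j)%:R| * C)).
      by case: (i == j); rewrite ?normr1 ?normr0 ?mul1r ?mul0r.
    rewrite (_ : (fun y => _) = (fun y => (i == j)%:R * p y)); first exact: hpZ.
    by apply/funext => y; rewrite mulrC.
  by rewrite -natr1 mulrDl mul1r; exact: hpD.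
- by have [q hq dq] := IH i; exists q => //; apply: hpW hq; rewrite ler_wpM2l.
Qed.

Definition mono_sum m (a : ('I_n -> nat) -> R) y : R :=
  \sum_(b : {ffun 'I_n -> 'I_m.+1} | (\sum_i b i == m)%N) a (fun i => b i) * \prod_i y 0 i ^+ b i.

Definition mono_norm m (a : ('I_n -> nat) -> R) : R :=
  \sum_(b : {ffun 'I_n -> 'I_m.+1} | (\sum_i b i == m)%N) `|a (fun i => b i)|.

Lemma hpoly_monomial (b : 'I_n -> nat) : hpoly (\sum_i b i) 1 (fun y => \prod_i y 0 i ^+ b i).
Proof.
suff : forall s : seq 'I_n, hpoly (\sum_(i <- s) b i) 1 (fun y => \prod_(i <- s) y 0 i ^+ b i) by [].
elim=> [|i s IH].
  rewrite big_nil (_ : (fun y => _) = (fun=> 1)); first exact: hp1.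
  by apply/funext => y; rewrite big_nil.
rewrite big_cons (_ : (fun y => _) = (fun y => y 0 i ^+ b i * \prod_(j <- s) y 0 j ^+ b j)); last first.
  by apply/funext => y; rewrite big_cons.
elim: (b i) => [|k IHk].
  rewrite (_ : (fun y => _) = (fun y => \prod_(j <- s) y 0 j ^+ b j)) //.
  by apply/funext => y; rewrite expr0 mul1r.
rewrite addSn (_ : (fun y => _) = (fun y => y 0 i * (y 0 i ^+ k * \prod_(j <- s) y 0 j ^+ b j))).
  exact: hpX.
by apply/funext => y; rewrite exprS mulrA.
Qed.

Lemma mono_hpoly m a : hpoly m (mono_norm m a) (mono_sum m a).
Proof.
rewrite /mono_norm /mono_sum (_ : (fun y => _) = (fun y =>
   \sum_(b : {ffun 'I_n -> 'I_m.+1}) if (\sum_i b i == m)%N then a (fun i => b i) * \prod_i y 0 i ^+ b i else 0)).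
  rewrite big_mkcond; apply: hpoly_sum => b; case: eqP => bm; last exact: hp0.
  rewrite -[X in hpoly _ X]mulr1; apply: hpZ; rewrite -[X in hpoly X]bm; exact: hpoly_monomial.
by apply/funext => y; rewrite big_mkcond.
Qed.

(** The explicit monomial form required by [analytic_on]; every [hpoly] has one with the same
    coefficient bound. *)
Definition canon m C p := exists a, (forall y, p y = mono_sum m a y) /\ mono_norm m a <= C.

Lemma canon0 m : canon m 0 (fun=> 0).
Proof.
exists (fun=> 0); split; first by move=> y; rewrite /mono_sum big1 // => b _; rewrite mul0r.
by rewrite /mono_norm big1 // => b _; rewrite normr0.
Qed.

Lemma canonD m C D p q : canon m C p -> canon m D q -> canon m (C + D) (fun y => p y + q y).
Proof.
move=> [a [pa na]] [b [qb nb]]; exists (fun i => a i + b i); split.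
  move=> y; rewrite pa qb /mono_sum -big_split /=; apply: eq_bigr => k _; by rewrite mulrDl.
apply: le_trans (lerD na nb); rewrite /mono_norm -big_split /=.
by apply: ler_sum => k _; exact: ler_normD.
Qed.

Lemma canonZ m C c p : canon m C p -> canon m (`|c| * C) (fun y => c * p y).
Proof.
move=> [a [pa na]]; exists (fun i => c * a i); split.
  by move=> y; rewrite pa /mono_sum big_distrr /=; apply: eq_bigr => k _; rewrite mulrA.
apply: le_trans (ler_wpM2l (normr_ge0 c) na); rewrite /mono_norm big_distrr /=.
by apply: ler_sum => k _; rewrite normrM.
Qed.

Lemma canonW m C D p : C <= D -> canon m C p -> canon m D p.
Proof. by move=> CD [a [pa na]]; exists a; split=> //; exact: le_trans CD. Qed.

Lemma canon_sum (I : Type) (s : seq I) (F : I -> fn) (C : I -> R) m :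
  (forall i, canon m (C i) (F i)) -> canon m (\sum_(i <- s) C i) (fun y => \sum_(i <- s) F i y).
Proof.
move=> hF; elim: s => [|i s IH].
  rewrite big_nil (_ : (fun y => _) = (fun=> 0)); first exact: canon0.
  by apply/funext => y; rewrite big_nil.
rewrite big_cons (_ : (fun y => _) = (fun y => F i y + \sum_(j <- s) F j y)); first exact: canonD.
by apply/funext => y; rewrite big_cons.
Qed.

Lemma canon_monomial (b : 'I_n -> nat) m : (\sum_i b i)%N = m ->
  canon m 1 (fun y => \prod_i y 0 i ^+ b i).
Proof.
move=> bm; have bi i : (b i < m.+1)%N by rewrite ltnS -bm (bigD1 i) //= leq_addr.
pose b0 : {ffun 'I_n -> 'I_m.+1} := [ffun i => Ordinal (bi i)].
have b0E : (fun i => b0 i : nat) = b by apply/funext => i; rewrite ffunE.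
pose a (k : 'I_n -> nat) : R := if k == b then 1 else 0.
have ab (k : {ffun 'I_n -> 'I_m.+1}) : k != b0 -> a (fun i => k i) = 0.
  rewrite /a; case: (_ =P b) => // kb /negP[]; apply/eqP/ffunP => i; apply: val_inj.
  by rewrite -[RHS]/((fun i => b0 i : nat) i) b0E -kb.
have ab0 : a (fun i => b0 i) = 1 by rewrite b0E /a eqxx.
have sb0 : (\sum_i b0 i == m)%N.
  apply/eqP; apply: etrans bm; by apply: eq_bigr => i _; rewrite ffunE.
exists a; split.
  move=> y; rewrite /mono_sum (bigD1 b0) //= ab0 mul1r [X in _ = _ + X]big1 ?addr0.
    by apply: eq_bigr => i _; rewrite ffunE.
  by move=> k /andP[_ /ab ->]; rewrite mul0r.
rewrite /mono_norm (bigD1 b0) //= ab0 normr1 big1 ?addr0 //.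
by move=> k /andP[_ /ab ->]; rewrite normr0.
Qed.

(** Each multiplied monomial is put into canonical form separately and the results are added, which
    avoids reindexing the sum over multi-indices. *)
Lemma canonX m C i p : canon m C p -> canon m.+1 C (fun y => y 0 i * p y).
Proof.
move=> [a [pa na]]; apply: canonW na _.
rewrite /mono_norm big_mkcond (_ : (fun y => _) = (fun y => \sum_(b : {ffun 'I_n -> 'I_m.+1})
   if (\sum_i b i == m)%N then a (fun i => b i) * \prod_j y 0 j ^+ (b j + (i == j)) else 0)); last first.
  apply/funext => y; rewrite pa /mono_sum big_mkcond big_distrr /=; apply: eq_bigr => b _.
  case: ifP => _; last by rewrite mulr0.
  rewrite mulrCA; congr (_ * _); rewrite [RHS](bigD1 i) //= eqxx addn1 exprS (bigD1 i) //= mulrA.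
  by congr (_ * _); apply: eq_bigr => j /negPf; rewrite eq_sym => ->; rewrite addn0.
apply: canon_sum => b; case: eqP => bm; last exact: canon0.
rewrite -[X in canon _ X]mulr1; apply: canonZ; apply: canon_monomial.
by rewrite big_split /= bm (bigD1 i) //= eqxx big1 ?addn0 ?addn1 // => j /negPf; rewrite eq_sym => ->.
Qed.

Lemma hpoly_canon m C p : hpoly m C p -> canon m C p.
Proof.
elim=> {m C p}; [exact: canon0| |by move=> *; exact: canonZ|by move=> *; exact: canonD
  |by move=> *; exact: canonX|by move=> m C D p CD _; exact: canonW].
have := @canon_monomial (fun=> 0%N) 0; rewrite big1 // => /(_ erefl).
by congr canon; apply/funext => y; rewrite big1.
Qed.

End Homogeneous.

(** * Power series and their derivatives *)

Section Power_series.
Variables (R : realType) (n : nat).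
Notation E := 'rV[R]_n.
Notation fn := (E -> R).
Notation e_ := (@basis_vec R n).
Implicit Types (U : set E) (p q f : fn) (y v : E).

Lemma tendsP (u : nat -> R) (l : R) : u @ \oo --> l <->
  forall e : R, 0 < e -> exists N0, forall N, (N0 <= N)%N -> `|u N - l| < e.
Proof.
split=> [/cvgrPdist_lt h e e0|h].
  by have [N0 _ hN] := h e e0; exists N0 => N NN; rewrite distrC; exact: hN.
apply/cvgrPdist_lt => e e0; have [N0 hN] := h e e0.
by exists N0 => // N NN; rewrite distrC; exact: hN.
Qed.

Lemma series_ord (u : nat -> R) N : series u N = \sum_(m < N) u m.
Proof. by rewrite /series /= big_mkord. Qed.

Lemma bounded_series_cvg (u : nat -> R) (B : R) :
  (forall N, \sum_(m < N) `|u m| <= B) -> cvgn (series u).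
Proof.
move=> uB; apply: normed_cvg; apply: nondecreasing_is_cvgn.
  by apply: nondecreasing_series => k _ _; exact: normr_ge0.
by exists B => _ [N _ <-]; rewrite -[leLHS]/(series (fun m => `|u m|) N) series_ord.
Qed.

Lemma hpoly0_cst m C p : hpoly m C p -> m = 0%N -> forall y, p y = p 0.
Proof.
elim=> {m C p} // [m C c p _ IH m0 y|m C D p q _ IHp _ IHq m0 y]; first by rewrite IH.
by rewrite IHp // IHq.
Qed.

Section Pser.
Variables (x0 : E) (rho rho' C : R) (c : nat -> R).
Hypotheses (rho'0 : 0 < rho') (rhorho : rho' < rho) (c0 : forall m, 0 <= c m)
  (cC : forall N, \sum_(m < N) c m * rho ^+ m <= C).

(* Coefficient bounds of an l-th derivative of a series with coefficient bounds c. *)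
Let w l m : R := ((m + l) ^_ l)%:R * c (m + l).
Definition pser_bound l : R := C * (l`!%:R / (rho - rho') ^+ l).
Notation B := pser_bound.

Local Lemma C0 : 0 <= C. Proof. by have := cC 0; rewrite big_ord0. Qed.
Local Lemma d0 : 0 < rho - rho'. Proof. by rewrite subr_gt0. Qed.

Lemma pser_bound_ge0 l : 0 <= B l.
Proof. by rewrite mulr_ge0 ?C0 // divr_ge0 // exprn_ge0 // ltW // d0. Qed.

(** A Cauchy estimate by real means: ['C(m + l, l) rho'^m (rho - rho')^l] is a single term of the
    binomial expansion of [rho ^ (m + l)]. *)
Local Lemma weight_bound l N : \sum_(m < N) w l m * rho' ^+ m <= B l.
Proof.
have dl : 0 < (rho - rho') ^+ l by rewrite exprn_gt0 ?d0.
apply: (@le_trans _ _ (\sum_(m < N) l`!%:R / (rho - rho') ^+ l * (c (m + l) * rho ^+ (m + l)))).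
  apply: ler_sum => m _; rewrite /w -bin_ffact natrM.
  have h : ('C(m + l, l))%:R * rho' ^+ m * (rho - rho') ^+ l <= rho ^+ (m + l).
    have -> : rho ^+ (m + l) = (rho' + (rho - rho')) ^+ (m + l) by congr (_ ^+ _); ring.
    have ll : (l < (m + l).+1)%N by rewrite ltnS leq_addl.
    rewrite [leRHS]exprDn (bigD1 (Ordinal ll)) //= addnK -[X in _ <= X + _]mulr_natl mulrA lerDl.
    apply: sumr_ge0 => i _; rewrite mulrn_wge0 // mulr_ge0 // exprn_ge0 // ?ltW // d0 //.
  have : 0 <= l`!%:R / (rho - rho') ^+ l * c (m + l).
    by rewrite mulr_ge0 // divr_ge0 // ltW.
  move=> /ler_wpM2l/(_ _ _ h); congr (_ <= _); last by ring.
  by field; rewrite gt_eqF // d0.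
rewrite -big_distrr /= /B mulrC ler_wpM2r ?divr_ge0 ?(ltW dl) //.
apply: le_trans (cC (l + N)); rewrite big_split_ord /= addrC -[leLHS]addr0; apply: lerD.
  by apply: ler_sum => m _; rewrite addnC.
by apply: sumr_ge0 => i _; rewrite mulr_ge0 // exprn_ge0 // ltW // (lt_trans rho'0).
Qed.

Definition hseq l (p : nat -> fn) := forall m, hpoly m (w l m) (p m).

Local Lemma hseq_abs l (p : nat -> fn) N v : hseq l p -> `|v| < rho' -> \sum_(m < N) `|p m v| <= B l.
Proof.
move=> hp vr; apply: le_trans (weight_bound l N); apply: ler_sum => m _.
have [W0 /(_ v) h] := hpoly_norm (hp m); apply: le_trans h _; rewrite ler_wpM2l //.
by apply: lerXn2r; rewrite ?nnegrE // ltW.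
Qed.

Local Lemma hseq_bound l (p : nat -> fn) N v : hseq l p -> `|v| < rho' -> `|\sum_(m < N) p m v| <= B l.
Proof. by move=> hp vr; apply: le_trans (ler_norm_sum _ _ _) _; exact: hseq_abs. Qed.

(** The constant term disappears and degrees drop by one, hence [N.+1] terms against [N]. *)
Local Lemma hseq_der l (p : nat -> fn) i : hseq l p -> exists2 q : nat -> fn, hseq l.+1 q &
  forall N v, is_derive v (e_ i) (fun v => \sum_(m < N.+1) p m v) (\sum_(m < N) q m v).
Proof.
move=> hp; have /boolp.choice[q hq] : forall m, exists q, hpoly m (w l.+1 m) q /\
    forall v, is_derive v (e_ i) (p m.+1) (q v).
  move=> m; have [q hq dq] := hpoly_der (hp m.+1) i; exists q; split=> //.
  move: hq => /=; congr hpoly; rewrite /w addSnnS ffactnSr -(addSnnS m l) addnK natrM; ring.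
exists q; first by move=> m; case: (hq m).
move=> N v.
have -> : (fun v => \sum_(m < N.+1) p m v) = (fun v => p 0%N 0 + \sum_(m < N) p m.+1 v).
  by apply/funext => y; rewrite big_ord_recl /= (hpoly0_cst (hp 0%N) erefl).
have D1 : is_derive v (e_ i) (\sum_(m < N) (p m.+1)) (\sum_(m < N) q m v).
  by apply: is_derive_sum => m; case: (hq m).
rewrite -[X in is_derive _ _ _ X]add0r.
rewrite (_ : (fun v => _) = cst (p 0%N 0) + \sum_(m < N) (p m.+1)); last first.
  by apply/funext => y; rewrite /= fct_sumE.
exact: is_deriveD.
Qed.

Definition pser l f := exists2 p : nat -> fn, hseq l p &
  forall y, nball x0 rho' y -> (fun N => \sum_(m < N) p m (y - x0)) @ \oo --> f y.

Lemma pser_le l f y : pser l f -> nball x0 rho' y -> `|f y| <= B l.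
Proof.
move=> [p hp cp] yx; apply/ler_addgt0Pr => e e0.
have /tendsP/(_ e e0)[N /(_ N (leqnn _)) h] := cp y yx.
have := hseq_bound N hp yx.
set s := \sum_(m < N) _ in h *; move=> hs.
have := ler_normB s (s - f y); rewrite subKr; lra.
Qed.

(** Two mean value estimates bound the first-order remainder of all partial sums by the same
    multiple of the squared increment, so the remainder passes to the limit. *)
Lemma pser_der l f i : pser l f -> exists2 f', pser l.+1 f' &
  forall y, nball x0 rho' y -> is_derive y (e_ i) f (f' y).
Proof.
move=> [p hp cp]; have [q hq dq] := hseq_der i hp; have [r hr dr] := hseq_der i hq.
pose f' y := limn (fun N => \sum_(m < N) q m (y - x0)).
have cq y : nball x0 rho' y -> (fun N => \sum_(m < N) q m (y - x0)) @ \oo --> f' y.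
  move=> yx; have := @bounded_series_cvg (fun m => q m (y - x0)) (B l.+1).
  have -> : series (fun m => q m (y - x0)) = (fun N => \sum_(m < N) q m (y - x0)).
    by apply/funext => N; rewrite series_ord.
  by apply => N; exact: hseq_abs.
exists f'; first by exists q.
move=> y yx; apply/is_deriveP => e e0.
have rr : 0 < rho' - `|y - x0| by rewrite subr_gt0.
have Bl := pser_bound_ge0 l.+2.
have Bl1 : 0 < B l.+2 + 1 by rewrite ltr_wpDl.
exists (Num.min (rho' - `|y - x0|) (e / (B l.+2 + 1))); first by rewrite lt_min rr divr_gt0.
move=> h; rewrite lt_min => /andP[h1]; rewrite ltr_pdivlMr // => h2.
have inb s : `|s| <= `|h| -> `|y - x0 + s *: e_ i| < rho'.
  move=> sh; apply: le_lt_trans (ler_normD _ _) _; rewrite normrZ.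
  have : `|s| * `|e_ i| <= `|h| by apply: le_trans sh; rewrite ler_piMr // norm_basis_vec_le.
  lra.
have yhx : nball x0 rho' (y + h *: e_ i) by rewrite /nball /= addrAC; exact: inb.
have key N : `|\sum_(m < N.+2) p m (y + h *: e_ i - x0) - \sum_(m < N.+2) p m (y - x0) -
   h * \sum_(m < N.+1) q m (y - x0)| <= B l.+2 * (`|h| * `|h|).
  have hs (s : R) : (0 <= s <= h) || (h <= s <= 0) -> `|s| <= `|h|.
    by case/orP=> /andP[? ?]; [rewrite !ger0_norm //; lra|rewrite !ler0_norm //; lra].
  have := @mvt_bound R (fun s => \sum_(m < N.+2) p m (y - x0 + s *: e_ i))
    (fun s => \sum_(m < N.+1) q m (y - x0 + s *: e_ i)) 0 h
    (\sum_(m < N.+1) q m (y - x0)) (B l.+2 * `|h|).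
  rewrite subr0 scale0r addr0 [y - x0 + _]addrAC mulrA; apply => s sh; split.
    exact: (line_is_derive (dq N.+1 _)).
  have := @mvt_bound R (fun s => \sum_(m < N.+1) q m (y - x0 + s *: e_ i))
    (fun s => \sum_(m < N) r m (y - x0 + s *: e_ i)) 0 s 0 (B l.+2).
  rewrite subr0 mulr0 subr0 scale0r addr0 => H.
  apply: le_trans (H _) _; last by rewrite ler_wpM2l // hs.
  move=> s' s's; split; first exact: (line_is_derive (dr N _)).
  rewrite subr0; apply: hseq_bound => //; apply: inb; apply: hs.
  by move: s's sh => /orP[] /andP[? ?] /orP[] /andP[? ?]; apply/orP; [left|right|left|right]; apply/andP; split; lra.
have h3 : `|f (y + h *: e_ i) - f y - h * f' y| <= B l.+2 * (`|h| * `|h|).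
  apply/ler_addgt0Pr => e' e'0.
  (* Three errors are to be added, with weights 1, 1 and the size of [h]. *)
  have e30 : 0 < e' / (2 + `|h|) by rewrite divr_gt0 // ltr_wpDr.
  have /tendsP/(_ _ e30)[N1 T1] := cp _ yhx.
  have /tendsP/(_ _ e30)[N2 T2] := cp _ yx.
  have /tendsP/(_ _ e30)[N3 T3] := cq _ yx.
  pose N := (N1 + N2 + N3)%N; have := key N.
  have l1 : (N1 <= N)%N by rewrite /N -addnA leq_addr.
  have l2 : (N2 <= N)%N by rewrite /N addnAC leq_addl.
  have l3 : (N3 <= N)%N by rewrite /N leq_addl.
  set a := \sum_(m < N.+2) _; set b := \sum_(m < N.+2) _; set d := \sum_(m < N.+1) _ => KN.
  have H3 : `|d - f' y| <= e' / (2 + `|h|) by apply/ltW/T3/leqW.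
  have H2 : `|b - f y| <= e' / (2 + `|h|) by apply/ltW/T2/leqW/leqW.
  have H1 : `|a - f (y + h *: e_ i)| <= e' / (2 + `|h|) by apply/ltW/T1/leqW/leqW.
  have -> : f (y + h *: e_ i) - f y - h * f' y = (a - b - h * d) - (a - f (y + h *: e_ i)) + (b - f y) + h * (d - f' y) by ring.
  have E' : e' = e' / (2 + `|h|) + e' / (2 + `|h|) + `|h| * (e' / (2 + `|h|)).
    by field; rewrite gt_eqF // ltr_wpDr.
  rewrite [in leRHS]E' [leRHS]addrA [X in _ <= X + _]addrA; apply: le_trans (ler_normD _ _) _; apply: lerD; last first.
    by rewrite normrM ler_wpM2l.
  apply: le_trans (ler_normD _ _) _; apply: lerD => //.
  by apply: le_trans (ler_normB _ _) _; apply: lerD.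
apply: le_trans h3 _; rewrite mulrA ler_wpM2r // mulrC.
by move: h2; rewrite mulrDr mulr1; have := normr_ge0 h; lra.
Qed.

Lemma pser_cont l f : pser l f -> econt (nball x0 rho') f.
Proof.
move=> pf; have /boolp.choice[g hg] : forall i, exists f', pser l.+1 f' /\
    forall y, nball x0 rho' y -> is_derive y (e_ i) f (f' y).
  by move=> i; have [f' ? ?] := pser_der i pf; exists f'.
have B0 := pser_bound_ge0 l.+1.
move=> x xx e e0; pose L := 2 * B l.+1 * n%:R + \sum_i `|g i x0|.
have L0 : 0 <= L by apply: addr_ge0; [apply: mulr_ge0 => //; exact: mulr_ge0|exact: sumr_ge0].
exists (e / (L + 1)); first by rewrite divr_gt0 // ltr_wpDl.
(* The flag [false] means a full ball; each partial derivative stays within [2 * B l.+1] of its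
   value at the centre. *)
move=> y yx0 yx; have := @path_bound R n false x0 rho' (2 * B l.+1) f g y x.
rewrite mulr_ge0 // => /(_ isT) H.
have {}H : `|f y - f x - \sum_i (y - x) 0 i * g i x0| <= 2 * B l.+1 * n%:R * `|y - x|.
  apply: H => // p px _ i; have [pg dg] := hg i; split; first exact: dg.
  apply: le_trans (ler_normB _ _) _.
  have x00 : nball x0 rho' x0 by rewrite /nball /= subrr normr0.
  by have := pser_le pg px; have := pser_le pg x00; lra.
have hS : `|\sum_i (y - x) 0 i * g i x0| <= (\sum_i `|g i x0|) * `|y - x|.
  apply: le_trans (ler_norm_sum _ _ _) _; rewrite big_distrl /=.
  by apply: ler_sum => i _; rewrite normrM mulrC ler_wpM2l // coord_le.
move: H hS; set S := \sum_i (y - x) 0 i * _ => H hS.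
have -> : f y - f x = (f y - f x - S) + S by rewrite subrK.
apply: le_lt_trans (ler_normD _ _) _.
apply: (@le_lt_trans _ _ (L * `|y - x|)); first by rewrite /L mulrDl; lra.
have : `|y - x| * (L + 1) < e by rewrite -ltr_pdivlMr // ltr_wpDl.
by have := normr_ge0 (y - x); lra.
Qed.

Lemma pser_bnd m l f : pser l f ->
  bnd (nball x0 rho') (fun k => B (l + k)) m f.
Proof.
elim: m l f => [|m IH] l f pf.
  by split=> //; [exact: pser_cont pf|move=> x xx; rewrite addn0; exact: pser_le].
split; first exact: pser_cont pf.
  by move=> x xx; rewrite addn0; exact: pser_le.
move=> i; have [f' pf' df'] := pser_der i pf; exists f'.
  by apply: bnd_le (IH _ _ pf') => k /=; rewrite addnS addSn.
by move=> y /interior_subset; exact: df'.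
Qed.

End Pser.

(** The series converges on a full ball, also around a boundary point, and agrees with [f] on the
    part inside [U]; its bounds there restrict to [f]. *)
Lemma analytic_bnd U f x0 : analytic_on U f -> U x0 ->
  exists2 d : R, 0 < d & exists K L, [/\ 0 <= K, 0 <= L &
    forall m, bnd (U `&` nball x0 d) (fun l => K * (L ^+ l * l`!%:R)) m f].
Proof.
move=> af Ux0; have [a [rho [rho0 cv hf]]] := af x0 Ux0.
pose c m := mono_norm m a.
have c0 m : 0 <= c m by apply: sumr_ge0.
pose S : R^nat := [series c m * rho ^+ m]_m.
have nd : {homo S : k l / (k <= l)%N >-> k <= l}.
  by apply: nondecreasing_series => k _ _; rewrite mulr_ge0 // exprn_ge0 // ltW.
have cC N : \sum_(m < N) c m * rho ^+ m <= limn S.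
  by rewrite -(series_ord (fun m => c m * rho ^+ m)); apply: nondecreasing_cvgn_le.
have r2 : 0 < rho / 2 by rewrite divr_gt0.
have rr : rho / 2 < rho by lra.
pose ft y := limn (fun N => \sum_(m < N) mono_sum m a (y - x0)).
have pf : @pser x0 (rho / 2) c 0 ft.
  exists (fun m => mono_sum m a).
    move=> m; rewrite ffactn0 mul1r addn0; exact: mono_hpoly.
  move=> y yx; have := @bounded_series_cvg (fun m => mono_sum m a (y - x0)) (limn S).
  have -> : series (fun m => mono_sum m a (y - x0)) = (fun N => \sum_(m < N) mono_sum m a (y - x0)).
    by apply/funext => N; rewrite series_ord.
  apply => N; apply: le_trans (cC N); apply: ler_sum => m _.
  have [W0 /(_ (y - x0)) h] := hpoly_norm (mono_hpoly m a); apply: le_trans h _; rewrite ler_wpM2l //.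
  by apply: lerXn2r; rewrite ?nnegrE ?(ltW rho0) ?(ltW (lt_trans yx rr)).
exists (rho / 2) => //; exists (limn S), ((rho - rho / 2)^-1); split.
- by have := cC 0%N; rewrite big_ord0.
- by rewrite invr_ge0; lra.
move=> m; have fE y : (U `&` nball x0 (rho / 2)) y -> ft y = f y.
  move=> [Uy yx]; have h := hf y Uy (lt_trans yx rr).
  rewrite -(cvg_lim _ h) // /ft; congr (limn _); apply/funext => N.
  rewrite series_ord; apply: eq_bigr => k _; apply: eq_bigr => b _; congr (_ * _).
  by apply: eq_bigr => i _; rewrite !mxE.
apply: bnd_eq fE _; apply: (@bnd_sub _ _ (nball x0 (rho / 2))); first by move=> y [].
apply: bnd_le (pser_bnd r2 rr c0 cC m pf) => l.
by rewrite /pser_bound add0n exprVn [_^-1 * _]mulrC.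
Qed.

End Power_series.

(** * Taylor's formula up to the boundary *)

Section Taylor.
Variables (R : realType) (n : nat).
Notation E := 'rV[R]_n.
Notation fn := (E -> R).
Implicit Types (p q f : fn) (y v : E).

Lemma der_uniq (U : set E) i f q q' : rdom U -> econt U q -> econt U q' -> der U i f q -> der U i f q' ->
  forall x, U x -> q x = q' x.
Proof.
by move=> rU cq cq' dq dq'; apply: econt_ext => // x Ux; exact: is_derive_uniq (dq x Ux) (dq' x Ux).
Qed.

Definition bndoo (U : set E) F f := forall m, bnd U F m f.

(** The derivative witnesses in [bnd] may depend on the order [m]; by [der_uniq] they agree on [U],
    so one of them serves all orders. *)
Lemma bndoo_der U F f : rdom U -> bndoo U F f -> forall i,
  exists2 q, bndoo U (F \o S) q & der U i f q.
Proof.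
move=> rU Bf i; have [_ _ /(_ i)[q Bq dq]] := Bf 1%N.
exists q => // m; have [_ _ /(_ i)[r Br dr]] := Bf m.+1.
have cq : econt U q by case: Bq.
have cr : econt U r by exact: (bnd_cont (F := F \o S) (m := m)).
have rq := der_uniq rU cr cq dr dq.
exact: bnd_eq rq Br.
Qed.

Section Family.
Variables (U : set E) (rU : rdom U).

(** Bundling a function with its bounds lets a single choice function differentiate again and again,
    as the recursion for Taylor terms requires. *)
Record jet := Jet { jfun : fn; jbd : nat -> R; jP : bndoo U jbd jfun }.

Lemma jet_cont t : econt U (jfun t).
Proof. by have [] := jP t 0%N. Qed.

Lemma jet_le t x : U x -> `|jfun t x| <= jbd t 0.
Proof. by have [_ h _] := jP t 0%N; exact: h. Qed.

Lemma jet_next : exists nx : 'I_n -> jet -> jet, forall i t,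
  jbd (nx i t) = jbd t \o S /\ der U i (jfun t) (jfun (nx i t)).
Proof.
have /boolp.choice[nx hnx] : forall p : 'I_n * jet, exists t,
   jbd t = jbd p.2 \o S /\ der U p.1 (jfun p.2) (jfun t).
  by move=> [i t]; have [q Bq dq] := bndoo_der rU (jP t) i; exists (Jet Bq).
by exists (fun i t => nx (i, t)) => i t; exact: hnx (i, t).
Qed.

Variables (nx : 'I_n -> jet -> jet).
Hypothesis hnx : forall i t, jbd (nx i t) = jbd t \o S /\ der U i (jfun t) (jfun (nx i t)).

(** The [m]-th differential at [x] in direction [v] divided by [m!], one factor of the factorial per
    level. *)
Fixpoint taylor_term m (t : jet) (x v : E) : R :=
  if m is m'.+1 then (m'.+1%:R)^-1 * \sum_i v 0 i * taylor_term m' (nx i t) x v else jfun t x.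

Lemma jet_C1 t : C1on U (jfun t) (fun i => jfun (nx i t)).
Proof.
split; first exact: jet_cont.
  by move=> i; exact: jet_cont.
by move=> i x Ux; case: (hnx i t) => _; apply.
Qed.

Lemma taylor_term_cont m t v : econt U (fun x => taylor_term m t x v).
Proof.
elim: m t => [|m IH] t /=; first exact: jet_cont.
apply: econtM; first exact: econt_cst.
by apply: econt_sum => i; apply: econtM; [exact: econt_cst|exact: IH].
Qed.

Lemma taylor_term_scale m t x v (s : R) : taylor_term m t x (s *: v) = s ^+ m * taylor_term m t x v.
Proof.
elim: m t => [|m IH] t /=; first by rewrite expr0 mul1r.
rewrite mulrCA; congr (_ * _); rewrite big_distrr /=; apply: eq_bigr => i _.
by rewrite IH mxE exprS; ring.
Qed.

(** The power of [n] counts index sequences: mixed derivatives are not grouped by multi-index. *)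
Lemma taylor_term_hpoly m t x : U x -> hpoly m (n%:R ^+ m * jbd t m / m`!%:R) (taylor_term m t x).
Proof.
move=> Ux; elim: m t => [|m IH] t /=.
  rewrite expr0 mul1r fact0 divr1; apply: (@hpW _ _ _ (`|jfun t x| * 1)).
    by rewrite mulr1; exact: jet_le.
  rewrite (_ : (fun=> _) = (fun y => jfun t x * 1)); last by apply/funext => y; rewrite mulr1.
  by apply: hpZ; exact: hp1.
have h i : hpoly m.+1 (n%:R ^+ m * jbd t m.+1 / m`!%:R) (fun v => v 0 i * taylor_term m (nx i t) x v).
  by apply: hpX; have [Eb _] := hnx i t; have := IH (nx i t); rewrite Eb.
have := hpZ (m.+1%:R)^-1 (hpoly_sum (index_enum 'I_n) h).
rewrite big_const_seq count_predT; apply: hpW.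
have -> : size (index_enum 'I_n) = n by rewrite [index_enum _]unlock -enumT size_enum_ord.
rewrite iter_addr addr0 ger0_norm ?invr_ge0 // -(mulr_natl _ n) factS natrM exprS.
rewrite le_eqVlt; apply/orP; left; apply/eqP; field.
by rewrite nat1r !pnatr_eq0 -lt0n fact_gt0.
Qed.

(** Stands in for integrating [c * s ^+ N]: the mean value theorem is applied to the difference
    between its primitive and plus or minus [phi]. *)
Lemma power_mvt (phi dphi : R -> R) (c : R) N :
  (forall s : R, 0 <= s <= 1 -> is_derive s (1:R) phi (dphi s) /\ `|dphi s| <= c * s ^+ N) ->
  phi 0 = 0 -> `|phi 1| <= c / N.+1%:R.
Proof.
move=> h phi0.
have N0 : (0 : R) < N.+1%:R by rewrite ltr0n.
suff H (e : R) : `|e| = 1 -> 0 <= c / N.+1%:R - e * phi 1.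
  have := H 1 (normr1 _); have := H (-1) (normrN1 _); rewrite mulN1r mul1r ler_norml.
  move: (c / _) => C h1 h2; apply/andP; split; lra.
move=> e1; pose psi s := c / N.+1%:R * s ^+ N.+1 - e * phi s.
have dpsi (s : R) : 0 <= s <= 1 -> is_derive s (1:R) psi (c * s ^+ N - e * dphi s).
  move=> s01; have [d1 _] := h s s01.
  have d2 : is_derive s (1:R) (fun s : R => s ^+ N.+1) (N.+1%:R * s ^+ N).
    have := is_deriveX N.+1 (is_derive_id s (1:R)).
    rewrite (_ : (id ^+ N.+1) = (fun s : R => s ^+ N.+1)); last by apply/funext => y; rewrite fctE.
    move=> d; apply: is_derive_eq d _; rewrite -[LHS]/(_ * _) mulr1 -mulr_natl //.
  have d3 := is_deriveB (is_deriveZ (c / N.+1%:R) d2) (is_deriveZ e d1).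
  apply: is_derive_eq d3 _; rewrite -![_ *: _]/(_ * _).
  by field; rewrite gt_eqF.
have := @MVT_segment R psi (fun s => c * s ^+ N - e * dphi s) 0 1 ler01.
case.
- by move=> s; rewrite in_itv /= => /andP[s0 s1]; apply: dpsi; rewrite !ltW.
- apply: derivable_within_continuous => s; rewrite in_itv /= => s01.
  by have [] := dpsi s s01.
move=> s; rewrite in_itv /= => s01; rewrite subr0 mulr1 /psi phi0 expr1n mulr1 expr0n /= mulr0 mulr0 subr0 subr0.
move=> ->; rewrite subr_ge0; have [_] := h s s01; apply: le_trans.
by apply: le_trans (ler_norm _) _; rewrite normrM e1 mul1r.
Qed.

(** Along the segment, the derivative of the remainder of order [N.+1] is a combination of
    remainders of order [N] of the partial derivatives; [power_mvt] integrates the induction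
    hypothesis. *)
Lemma taylor_interior N t x v : (forall s : R, 0 <= s <= 1 -> U° (x + s *: v)) ->
  `|jfun t (x + v) - \sum_(m < N) taylor_term m t x v| <= (n%:R * `|v|) ^+ N * jbd t N / N`!%:R.
Proof.
elim: N t v => [|N IH] t v seg.
  have := seg 1; rewrite ler01 lexx scale1r => /(_ isT) /interior_subset Uv.
  rewrite big_ord0 subr0 expr0 mul1r fact0 divr1; exact: jet_le.
have Ux : U° x by have := seg 0; rewrite lexx ler01 scale0r addr0; apply.
pose phi (s : R) := jfun t (x + s *: v) - \sum_(m < N.+1) s ^+ m * taylor_term m t x v.
pose dphi (s : R) := \sum_i v 0 i * (jfun (nx i t) (x + s *: v) - \sum_(m < N) taylor_term m (nx i t) x (s *: v)).
have -> : jfun t (x + v) - \sum_(m < N.+1) taylor_term m t x v = phi 1.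
  by rewrite /phi scale1r; congr (_ - _); apply: eq_bigr => m _; rewrite expr1n mul1r.
have := @power_mvt phi dphi ((n%:R * `|v|) ^+ N.+1 * jbd t N.+1 / N`!%:R) N.
have -> : (n%:R * `|v|) ^+ N.+1 * jbd t N.+1 / N`!%:R / N.+1%:R = (n%:R * `|v|) ^+ N.+1 * jbd t N.+1 / N.+1`!%:R.
  by rewrite factS natrM; field; rewrite nat1r !pnatr_eq0 -lt0n fact_gt0.
apply; last first.
  rewrite /phi scale0r addr0 big_ord_recl expr0 mul1r /= big1 ?addr0 ?subrr // => m _.
  by rewrite exprS mul0r mul0r.
move=> s s01; split.
  have d1 : is_derive s (1:R) (fun s : R => jfun t (x + s *: v)) (\sum_i v 0 i * jfun (nx i t) (x + s *: v)).
    apply: line_is_derive; apply: (C1on_dir v rU (jet_C1 t)); exact: seg.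
  have d2 : is_derive s (1:R) (fun s : R => \sum_(m < N.+1) s ^+ m * taylor_term m t x v)
     (\sum_i v 0 i * \sum_(m < N) taylor_term m (nx i t) x (s *: v)).
    rewrite (_ : (fun s => _) = cst (jfun t x) + \sum_(m < N) (fun s : R => taylor_term m.+1 t x v *: (s ^+ m.+1 : R))); last first.
      apply/funext => y; rewrite big_ord_recl expr0 mul1r /=; congr (_ + _).
      by rewrite fct_sumE; apply: eq_bigr => m _; rewrite -[RHS]/(_ * _) mulrC.
    have d3 (m : 'I_N) : is_derive s (1:R) (fun s : R => taylor_term m.+1 t x v *: (s ^+ m.+1 : R)) (taylor_term m.+1 t x v *: (m.+1%:R * s ^+ m)).
      apply: is_deriveZ.
      have := is_deriveX m.+1 (is_derive_id s (1:R)).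
      rewrite (_ : (id ^+ m.+1) = (fun s : R => s ^+ m.+1)); last by apply/funext => y; rewrite fctE.
      by move=> d; apply: is_derive_eq d _; rewrite -[LHS]/(_ * _) mulr1 -mulr_natl.
    have d4 := is_deriveD (is_derive_cst (jfun t x) s (1:R)) (is_derive_sum d3).
    apply: is_derive_eq d4 _; rewrite add0r.
    rewrite (eq_bigr (fun m : 'I_N => \sum_i v 0 i * taylor_term m (nx i t) x (s *: v))); last first.
      move=> m _; rewrite -[LHS]/(_ * _) /= mulrC mulrA [_ * (m.+1%:R)^-1]mulrC.
      rewrite mulrA mulVf ?pnatr_eq0 // mul1r big_distrr /=; apply: eq_bigr => i _.
      by rewrite taylor_term_scale mulrCA.
    by rewrite exchange_big /=; apply: eq_bigr => i _; rewrite big_distrr.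
  have d5 : is_derive s (1:R) phi _ := is_deriveB d1 d2.
  apply: (is_derive_eq d5).
  by rewrite -sumrB; apply: eq_bigr => i _; rewrite mulrBr.
have /andP[s0 s1] := s01.
rewrite /dphi; apply: le_trans (ler_norm_sum _ _ _) _.
apply: (@le_trans _ _ (\sum_(i < n) `|v| * ((n%:R * (s * `|v|)) ^+ N * jbd t N.+1 / N`!%:R))).
  apply: ler_sum => i _; rewrite normrM; apply: ler_pM => //; first exact: coord_le.
  have := IH (nx i t) (s *: v); have [-> _] := hnx i t.
  rewrite normrZ (ger0_norm s0); apply => r /andP[r0 r1].
  rewrite scalerA; apply: seg; rewrite mulr_ge0 //=; nra.
rewrite sumr_const card_ord -mulr_natl !exprMn !exprS.
by rewrite le_eqVlt; apply/orP; left; apply/eqP; ring.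
Qed.

End Family.

(* Boundary points are reached by pushing the whole segment inward. *)
Lemma taylor_bound (U : set E) (rU : rdom U) (nx : 'I_n -> jet U -> jet U)
  (hnx : forall i t, jbd (nx i t) = jbd t \o S /\ der U i (jfun t) (jfun (nx i t)))
  b (x0 : E) (d : R) N t x y :
  (forall z, `|z - x0| < d -> hs b z -> U z) -> (forall z, `|z - x0| < d -> hsi b z -> U° z) ->
  `|x - x0| < d -> `|y - x0| < d -> hs b x -> hs b y ->
  `|jfun t y - \sum_(m < N) taylor_term nx m t x (y - x)| <= (n%:R * `|y - x|) ^+ N * jbd t N / N`!%:R.
Proof.
move=> bU biU xd yd hx hy; apply/ler_addgt0Pr => e e0.
have Ux : U x by exact: bU. have Uy : U y by exact: bU.
have e2 : 0 < e / 2 by rewrite divr_gt0.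
have cT : econt U (fun x' => \sum_(m < N) taylor_term nx m t x' (y - x)).
  by apply: econt_sum => m; exact: taylor_term_cont.
have [d1 d10 h1] := cT x Ux _ e2.
have [d2 d20 h2] := jet_cont t Uy e2.
pose T := Num.min (Num.min d1 d2) (Num.min (d - `|x - x0|) (d - `|y - x0|)).
have T0 : 0 < T by rewrite !lt_min d10 d20 !subr_gt0 xd yd.
pose s := T / 2; have s0 : 0 < s by rewrite divr_gt0.
have : s < T by rewrite /s; lra.
rewrite !lt_min => /andP[/andP[sd1 sd2] /andP[sx sy]].
have ni : `|inward n s| <= s by apply: le_trans (norm_inward _ _) _; rewrite gtr0_norm.
have aux w : `|w - x0| + s < d -> `|w + inward n s - x0| < d.
  move=> h; rewrite -addrA [_ - x0]addrC addrA; apply: le_lt_trans (ler_normD _ _) _.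
  by apply: le_lt_trans h; rewrite lerD2l.
have xd' : `|x + inward n s - x0| < d by apply: aux; lra.
have yd' : `|y + inward n s - x0| < d by apply: aux; lra.
have hx' : hsi b (x + inward n s) by exact: hsi_inward.
have hy' : hsi b (y + inward n s) by exact: hsi_inward.
have yxE : y + inward n s - (x + inward n s) = y - x by rewrite opprD addrACA subrr addr0.
have := @taylor_interior U rU nx hnx N t (x + inward n s) (y - x).
have -> : x + inward n s + (y - x) = y + inward n s by apply/rowP => i; rewrite !mxE; ring.
move=> H; have {}H := H _.
have {}H : `|jfun t (y + inward n s) - \sum_(m < N) taylor_term nx m t (x + inward n s) (y - x)| <=
    (n%:R * `|y - x|) ^+ N * jbd t N / N`!%:R.
  apply: H => r r01; rewrite -yxE; apply: biU; first exact: ball_convex.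
  exact: hsi_convex.
have Ux' : U (x + inward n s) by apply: bU => //; exact: hsi_hs.
have Uy' : U (y + inward n s) by apply: bU => //; exact: hsi_hs.
have := h1 _ Ux'; rewrite addrAC subrr add0r => /(_ (le_lt_trans ni sd1)).
have := h2 _ Uy'; rewrite addrAC subrr add0r => /(_ (le_lt_trans ni sd2)).
move: H; set B := _ / _; set a := jfun t _; set c := \sum_(m < N) _; set a' := jfun t y; set c' := \sum_(m < N) _.
rewrite !ltr_norml => H /andP[? ?] /andP[? ?]; move: H; rewrite !ler_norml => /andP[? ?].
apply/andP; split; lra.
Qed.

Lemma bnd_analytic (U : set E) f K M : rdom U -> 0 <= K -> 0 <= M ->
  (forall m, bnd U (fun l => K * (M ^+ l * l`!%:R)) m f) -> analytic_on U f.
Proof.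
move=> rU K0 M0 Bf x Ux.
have [nx hnx] := jet_next rU.
pose t := Jet Bf.
have [b [d [d0 Ub bU biU]]] := rdom_box rU Ux.
have /boolp.choice[a ha] : forall m, exists a : ('I_n -> nat) -> R,
    (forall v, taylor_term nx m t x v = mono_sum m a v) /\ mono_norm m a <= K * (n%:R * M) ^+ m.
  move=> m; have [a [a1 a2]] := hpoly_canon (taylor_term_hpoly hnx m t Ux); exists a; split=> //.
  apply: le_trans a2 _; rewrite /t /= exprMn.
  rewrite le_eqVlt; apply/orP; left; apply/eqP; field.
  by rewrite pnatr_eq0 -lt0n fact_gt0.
(* One coefficient family for all degrees: the degree is read off the multi-index. *)
pose A (k : 'I_n -> nat) : R := a (\sum_i k i)%N k.
have mA m v : mono_sum m A v = mono_sum m (a m) v.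
  by apply: eq_bigr => k /eqP km; rewrite /A km.
have nA m : mono_norm m A = mono_norm m (a m).
  by apply: eq_bigr => k /eqP km; rewrite /A km.
(* Chosen so that [n * M * r <= 1/2], which makes the remainder geometric; adding 1 keeps the
   denominator positive when [n * M = 0]. *)
pose r := Num.min d ((2 * (n%:R * M + 1))^-1).
have nM0 : 0 <= n%:R * M by rewrite mulr_ge0.
have nM1 : 0 < 2 * (n%:R * M + 1) by lra.
have r0 : 0 < r by rewrite lt_min d0 invr_gt0.
have rM : n%:R * M * r <= 2^-1.
  have : r <= (2 * (n%:R * M + 1))^-1 by rewrite ge_min lexx orbT.
  move=> /(ler_wpM2l nM0)/le_trans; apply.
  by rewrite ler_pdivrMr //; lra.
have nr0 : 0 <= n%:R * M * r by rewrite mulr_ge0 // ltW.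
have half1 : `|2^-1 : R| < 1 by rewrite ger0_norm; lra.
exists A, r; split=> //.
  apply: (@series_le_cvg _ (fun m => mono_norm m A * r ^+ m) (geometric K 2^-1)).
  - by move=> m; rewrite mulr_ge0 ?exprn_ge0 ?(ltW r0) //; exact: sumr_ge0.
  - by move=> m; rewrite mulr_ge0 // exprn_ge0 // invr_ge0.
  - move=> m; rewrite nA /=; have [_ h] := ha m.
    apply: (@le_trans _ _ (K * (n%:R * M) ^+ m * r ^+ m)).
      by rewrite ler_wpM2r // exprn_ge0 // ltW.
    rewrite -mulrA -exprMn ler_wpM2l //; apply: lerXn2r => //; rewrite nnegrE //.
  - exact: is_cvg_geometric_series.
move=> y Uy yx.
have -> : [series \sum_(b0 : {ffun 'I_n -> 'I_m.+1} | (\sum_i b0 i == m)%N)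
     A (fun i => b0 i) * \prod_i (y 0 i - x 0 i) ^+ b0 i]_m = (fun N => \sum_(m < N) taylor_term nx m t x (y - x)).
  apply/funext => N; rewrite series_ord; apply: eq_bigr => m _.
  have [-> _] := ha m; rewrite -mA; apply: eq_bigr => k _; congr (_ * _); apply: eq_bigr => i _.
  by rewrite !mxE.
have g0 := @cvg_geometric R K _ half1.
apply/tendsP => e e0; have /tendsP/(_ e e0)[N0 hN] := g0; exists N0 => N NN.
have := hN N NN; rewrite subr0 /= => he; rewrite distrC.
have xd : `|x - x| < d by rewrite subrr normr0.
have yd : `|y - x| < d by apply: lt_le_trans yx _; rewrite ge_min lexx.
apply: le_lt_trans (taylor_bound rU hnx N t bU biU xd yd (Ub _ Ux) (Ub _ Uy)) _.
apply: le_lt_trans he; rewrite /t /=.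
have -> : (n%:R * `|y - x|) ^+ N * (K * (M ^+ N * N`!%:R)) / N`!%:R = K * (n%:R * M * `|y - x|) ^+ N.
  by rewrite !exprMn; field; rewrite pnatr_eq0 -lt0n fact_gt0.
apply: le_trans (ler_norm _); rewrite ler_wpM2l //; apply: lerXn2r; rewrite ?nnegrE ?mulr_ge0 //.
by apply: le_trans rM; rewrite ler_wpM2l // ltW.
Qed.

End Taylor.

(** * Jacobians and inverse maps *)

Section Jacobians.
Variables (R : realType) (n : nat).
Notation E := 'rV[R]_n.
Notation fn := (E -> R).
Notation e_ := (@basis_vec R n).
Implicit Types (U V : set E) (Q : E -> E) (x y : E).

Definition jac_mx (A : 'I_n -> 'I_n -> fn) x : 'M[R]_n := \matrix_(i, a) A i a x.

Lemma C1on_jacobian U Q A x : rdom U -> (forall a, C1on U (fun x => Q x 0 a) (A ^~ a)) -> U x ->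
  is_jacobian_within U Q x (jac_mx A x).
Proof.
move=> rU C1 Ux e e0.
have [d d0 hd] : exists2 d : R, 0 < d & forall a y, U y -> `|y - x| < d ->
    `|Q y 0 a - Q x 0 a - \sum_i (y - x) 0 i * A i a x| <= e * `|y - x|.
  apply: fin_delta => a; have [d d0 hd] := strict_diff rU (C1 a) Ux e0.
  exists d => // d' /andP[d'0 dd] y Uy yx; apply: hd => //; first exact: lt_le_trans dd.
  by rewrite subrr normr0.
rewrite near_withinE; apply/nbhs_normE; exists d => // y yx Uy.
apply: rV_norm_le => [|a]; first by rewrite mulr_ge0 // ltW.
have := hd a y Uy yx; rewrite !mxE; congr (`|_ - _| <= _).
by apply: eq_bigr => i _; rewrite !mxE.
Qed.

Lemma rdom_basis U x : rdom U -> U x -> exists2 d : R, 0 < d &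
  forall (t : R) i, 0 < t < d -> U (x + t *: e_ i).
Proof.
move=> rU Ux; have [b [d [d0 Ub bU _]]] := rdom_box rU Ux.
exists d => // t i /andP[t0 td]; apply: bU.
  rewrite addrAC subrr add0r normrZ gtr0_norm //; apply: le_lt_trans td.
  by rewrite ler_piMr ?norm_basis_vec_le // ltW.
move=> bT j jn; rewrite !mxE; have := Ub _ Ux bT j jn => ?.
by apply: addr_ge0 => //; apply: mulr_ge0; rewrite ?(ltW t0).
Qed.

Lemma mul_basis_vec (J : 'M[R]_n) i a : (e_ i *m J) 0 a = J i a.
Proof.
rewrite mxE (bigD1 i) //= big1 ?addr0.
  by rewrite /basis_vec mxE !eqxx mul1r.
by move=> j /negPf ji; rewrite /basis_vec mxE ji andbF mul0r.
Qed.

(** Small positive multiples of the basis vectors stay in [U] even from a boundary point, and they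
    determine every row of the Jacobian. *)
Lemma jacobian_within_uniq U Q x J J' : rdom U -> U x ->
  is_jacobian_within U Q x J -> is_jacobian_within U Q x J' -> J = J'.
Proof.
move=> rU Ux h h'; apply/matrixP => i a; apply/eqP; rewrite -subr_eq0 -normr_le0.
apply/ler_addgt0Pr => e e0; rewrite add0r.
have e2 : 0 < e / 2 by rewrite divr_gt0.
have := h _ e2; rewrite near_withinE => /nbhs_normE[d1 d10 h1].
have := h' _ e2; rewrite near_withinE => /nbhs_normE[d2 d20 h2].
have [d d0 hd] := rdom_basis rU Ux.
pose t := Num.min d (Num.min d1 d2) / 2.
have m0 : 0 < Num.min d (Num.min d1 d2) by rewrite !lt_min d0 d10.
have t0 : 0 < t by rewrite divr_gt0.
have : t < Num.min d (Num.min d1 d2) by rewrite /t; lra.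
rewrite !lt_min => /and3P[td td1 td2].
have Ut : U (x + t *: e_ i) by apply: hd; rewrite t0.
have xt : x + t *: e_ i - x = t *: e_ i by rewrite addrAC subrr add0r.
have nt : `|t *: e_ i| <= t by rewrite normrZ gtr0_norm // ler_piMr ?norm_basis_vec_le // ltW.
have := h1 (x + t *: e_ i); have := h2 (x + t *: e_ i); rewrite xt.
move=> /(_ (le_lt_trans nt td2) Ut) k2 /(_ (le_lt_trans nt td1) Ut) k1.
have : `|t *: e_ i *m (J - J')| <= e * t.
  rewrite mulmxBr; set u := Q _ - Q _ in k1 k2 *.
  have -> : t *: e_ i *m J - t *: e_ i *m J' = (u - t *: e_ i *m J') - (u - t *: e_ i *m J).
    by rewrite opprB [RHS]addrC -addrA addKr.
  apply: le_trans (ler_normB _ _) _.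
  have : e / 2 * `|t *: e_ i| <= e / 2 * t by rewrite ler_wpM2l // ltW.
  lra.
move=> /(le_trans (coord_le _ a)); rewrite -scalemxAl mxE mul_basis_vec !mxE normrM gtr0_norm //.
by rewrite mulrC ler_pM2r.
Qed.

Lemma C1on_jacobian_within U Q A x : rdom U -> (forall a, C1on U (fun x => Q x 0 a) (A ^~ a)) -> U x ->
  jacobian_within U Q x = jac_mx A x.
Proof.
move=> rU C1 Ux; have h := C1on_jacobian rU C1 Ux.
apply: (jacobian_within_uniq rU Ux _ h).
by rewrite /jacobian_within; apply: (@xgetPex _ 0 [set J | is_jacobian_within U Q x J]); exists (jac_mx A x).
Qed.

Lemma mulmx_norm_le (v : E) (J : 'M[R]_n) : `|v *m J| <= (\sum_i \sum_a `|J i a|) * `|v|.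
Proof.
apply: rV_norm_le => [|a].
  by rewrite mulr_ge0 // sumr_ge0 // => i _; exact: sumr_ge0.
rewrite mxE; apply: le_trans (ler_norm_sum _ _ _) _; rewrite big_distrl /=.
apply: ler_sum => i _; rewrite normrM mulrC; apply: ler_pM => //; last exact: coord_le.
by rewrite (bigD1 a) //= lerDl sumr_ge0.
Qed.

(* A one-sided chain rule: only points of U and V are ever compared. *)
Lemma jacobian_inverse U V Q S x A B : rdom U -> U x -> (forall y, U y -> V (Q y)) ->
  (forall y, U y -> S (Q y) = y) ->
  is_jacobian_within U Q x A -> is_jacobian_within V S (Q x) B -> A *m B = 1%:M.
Proof.
move=> rU Ux UV SQ hA hB.
apply: (@jacobian_within_uniq U id x _ _ rU Ux); last first.
  move=> e e0; rewrite near_withinE; apply/nbhs_normE; exists 1 => // y _ _.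
  by rewrite mulmx1 subrr normr0 mulr_ge0 // ltW.
move=> e e0.
pose KA := \sum_i \sum_a `|A i a|; pose KB := \sum_i \sum_a `|B i a|.
have KA0 : 0 <= KA by apply: sumr_ge0 => i _; exact: sumr_ge0.
have KB0 : 0 <= KB by apply: sumr_ge0 => i _; exact: sumr_ge0.
pose e1 := Num.min 1 (e / (2 * (KB + 1))); pose e2 := e / (2 * (KA + 1)).
have e10 : 0 < e1 by rewrite lt_min ltr01 divr_gt0 // mulr_gt0 // ltr_wpDl.
have e20 : 0 < e2 by rewrite divr_gt0 // mulr_gt0 // ltr_wpDl.
have := hA _ e10; rewrite near_withinE => /nbhs_normE[d1 d10 h1].
have := hB _ e20; rewrite near_withinE => /nbhs_normE[d2 d20 h2].
rewrite near_withinE; apply/nbhs_normE.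
exists (Num.min d1 (d2 / (KA + 1))); first by rewrite lt_min d10 divr_gt0 // ltr_wpDl.
move=> y; rewrite lt_min => /andP[yd1]; rewrite ltr_pdivlMr ?ltr_wpDl // => yd2 Uy.
have k1 := h1 y yd1 Uy.
have nQ : `|Q y - Q x| <= `|y - x| * (KA + 1).
  have -> : Q y - Q x = (Q y - Q x - (y - x) *m A) + (y - x) *m A by rewrite subrK.
  apply: le_trans (ler_normD _ _) _; have := mulmx_norm_le (y - x) A; rewrite -/KA.
  have : e1 * `|y - x| <= 1 * `|y - x| by rewrite ler_wpM2r // ge_min lexx.
  lra.
have := h2 (Q y) (le_lt_trans nQ yd2) (UV _ Uy); rewrite !SQ // => k2.
have -> : y - x - (y - x) *m (A *m B) =
  (y - x - (Q y - Q x) *m B) + (Q y - Q x - (y - x) *m A) *m B.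
  by move: (y - x) (Q y - Q x) => a w; rewrite mulmxBl mulmxA addrA subrK.
apply: le_trans (ler_normD _ _) _.
have := mulmx_norm_le (Q y - Q x - (y - x) *m A) B; rewrite -/KB => k3.
have b1 : e2 * `|Q y - Q x| <= e / 2 * `|y - x|.
  have := ler_wpM2l (ltW e20) nQ; move/le_trans; apply.
  rewrite /e2 le_eqVlt; apply/orP; left; apply/eqP; field; lra.
have b2 : KB * `|Q y - Q x - (y - x) *m A| <= e / 2 * `|y - x|.
  have := ler_wpM2l KB0 k1; move/le_trans; apply.
  rewrite mulrA ler_wpM2r //.
  have : KB * e1 <= KB * (e / (2 * (KB + 1))) by rewrite ler_wpM2l // ge_min lexx orbT.
  move/le_trans; apply; rewrite mulrA ler_pdivrMr ?mulr_gt0 ?ltr_wpDl //.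
  have e00 := ltW e0; lra.
lra.
Qed.

Lemma unit_col_neq0 (A B : 'M[R]_n) i : A *m B = 1%:M -> ~ (forall j, A j i = 0).
Proof.
move=> /mulmx1C /matrixP/(_ i i); rewrite !mxE eqxx => h A0.
by move: h; rewrite big1 => [/eqP|j _]; rewrite ?A0 ?mulr0 // eq_sym oner_eq0.
Qed.

(* An interior point cannot be sent to the face of a half-space: the last
   component would have a minimum there and the Jacobian would be singular. *)
Lemma interior_map U V Q A (B : 'M[R]_n) x : rdom U -> rdom V -> (forall y, U y -> V (Q y)) ->
  (forall a, C1on U (fun x => Q x 0 a) (A ^~ a)) -> U° x -> jac_mx A x *m B = 1%:M -> V° (Q x).
Proof.
move=> rU rV UV C1 Ux AB; have Ux' := interior_subset Ux.
have [b [d [d0 Vb _ biV]]] := rdom_box rV (UV _ Ux').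
apply: biV; first by rewrite subrr normr0.
move=> bT i iE; rewrite lt_def (Vb _ (UV _ Ux') bT i iE) andbT; apply/eqP => Qi0.
apply: (unit_col_neq0 (i := i) AB) => j; rewrite mxE.
have [_ _ dQ] := C1 i.
apply: (min_derive0 Ux (dQ j x Ux)) => y Uy /=.
by rewrite Qi0; exact: Vb (UV _ Uy) bT i iE.
Qed.

End Jacobians.

(** * Closed systems with analytic data *)

Section Analytic_systems.
Variables (R : realType) (n : nat).
Notation E := 'rV[R]_n.
Notation fn := (E -> R).
Implicit Types (U V : set E) (f : fn).

Definition anb U f := exists K L : R, [/\ 0 <= K, 0 <= L & bndoo U (fun l => K * (L ^+ l * l`!%:R)) f].

Lemma anb_sub U V f : V `<=` U -> anb U f -> anb V f.
Proof. by move=> VU [K [L [K0 L0 Bf]]]; exists K, L; split=> // m; exact: bnd_sub VU (Bf m). Qed.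

Lemma anb_cont U f : anb U f -> econt U f.
Proof. by move=> [K [L [_ _ /(_ 0%N)[]]]]. Qed.

Lemma anb_der U f : rdom U -> anb U f -> exists2 q, C1on U f q & forall i, anb U (q i).
Proof.
move=> rU [K [L [K0 L0 Bf]]].
have /boolp.choice[q hq] : forall i, exists q, bndoo U ((fun l => K * (L ^+ l * l`!%:R)) \o S) q /\ der U i f q.
  by move=> i; have [q ? ?] := bndoo_der rU Bf i; exists q.
have aq i : anb U (q i).
  exists (K * L), (2 * L); split; rewrite ?mulr_ge0 // => m.
  have [Bq _] := hq i; apply: bnd_le (Bq m) => l /=.
  (* The extra factor [l.+1] of the shifted factorial is paid for by doubling [L]. *)
  have h : (l.+1 <= 2 ^ l)%N by exact: ltn_expl.
  rewrite factS natrM exprMn exprS.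
  have : (l.+1%:R : R) <= 2 ^+ l by rewrite -natrX ler_nat.
  have p0 : 0 <= K * L * L ^+ l * l`!%:R by rewrite !mulr_ge0 ?exprn_ge0.
  move=> /(ler_wpM2l p0); congr (_ <= _); ring.
exists q => //; split; first by have [] := Bf 0%N.
  by move=> i; exact: anb_cont (aq i).
by move=> i; case: (hq i).
Qed.

(** One number plays both [K] and [L] and may be enlarged freely, so that [fin_max] applies. *)
Lemma anb_uniform U (J : finType) (F : J -> fn) : (forall j, anb U (F j)) ->
  exists2 K, 0 <= K & forall j K', K <= K' -> bndoo U (fun l => K' * (K' ^+ l * l`!%:R)) (F j).
Proof.
move=> aF; apply: (fin_max (F := fun j K' => bndoo U (fun l => K' * (K' ^+ l * l`!%:R)) (F j))) => j.
have [K [L [K0 L0 Bf]]] := aF j; exists (K + L); first exact: addr_ge0.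
move=> K' KK' m; have K'0 : 0 <= K' by apply: le_trans KK'; exact: addr_ge0.
apply: bnd_le (Bf m) => l; apply: ler_pM; rewrite ?mulr_ge0 ?exprn_ge0 //; first lra.
by rewrite ler_wpM2r //; apply: lerXn2r; rewrite ?nnegrE //; lra.
Qed.

Lemma nball_interior x (d : R) : (nball x d)° = nball x d :> set E.
Proof. by apply/interior_id; exact: open_nball. Qed.

Lemma nball_min x (d e : R) : nball x (Num.min d e) = nball x d `&` nball x e :> set E.
Proof. by apply/seteqP; split=> y; rewrite /nball /= lt_min => /andP. Qed.

Lemma admissible_mapS U V Q A x0 z0 (d e : R) : admissible_map Q U V A ->
  (forall x, (U `&` nball x0 d) x -> nball z0 e (Q x)) ->
  admissible_map Q (U `&` nball x0 d) (V `&` nball z0 e) A.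
Proof.
move=> [rU rV UV UVi C1Q] h; split.
- by apply: rdomI => //; exact: open_nball.
- by apply: rdomI => //; exact: open_nball.
- by move=> x Ux; split; [apply: UV; case: Ux|exact: h].
- move=> x; rewrite !interiorI !nball_interior => -[Ux xd]; split; first exact: UVi.
  by apply: h; split=> //; exact: interior_subset.
- by move=> a; apply: C1onS (C1Q a) => x [].
Qed.

Lemma admissible_mapSl U V Q A x0 (d : R) : admissible_map Q U V A ->
  admissible_map Q (U `&` nball x0 d) V A.
Proof.
move=> [rU rV UV UVi C1Q]; split=> //.
- by apply: rdomI => //; exact: open_nball.
- by move=> x [/UV].
- by move=> x; rewrite interiorI => -[/UVi].
- by move=> a; apply: C1onS (C1Q a) => x [].
Qed.

Lemma closed_systemS I J H (u : I -> fn) (ka : J -> fn) (et : H -> fn) Q U V A x0 (d : R) :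
  closed_system u ka et Q U V A -> closed_system u ka et Q (U `&` nball x0 d) V A.
Proof.
move=> [am uA cu du]; split=> //; first exact: admissible_mapSl.
  by move=> al; apply: econtS (cu al) => x [].
move=> al i; have [q pq dq] := du al i; exists q => // x.
by rewrite interiorI => -[/dq].
Qed.

Lemma analytic_on_local U f : (forall x, U x -> exists2 d : R, 0 < d & analytic_on (U `&` nball x d) f) ->
  analytic_on U f.
Proof.
move=> h x Ux; have [d d0 af] := h x Ux.
have xx : nball x d x by rewrite /nball /= subrr normr0.
have [a [rho [rho0 cv hf]]] := af x (conj Ux xx).
exists a, (Num.min rho d); split; first by rewrite lt_min rho0.
  apply: (series_le_cvg _ _ _ cv) => m.
  - rewrite mulr_ge0 ?sumr_ge0 // exprn_ge0 // le_min !ltW //.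
  - by rewrite mulr_ge0 ?sumr_ge0 // exprn_ge0 // ltW.
  - rewrite ler_wpM2l ?sumr_ge0 //; apply: lerXn2r; rewrite ?nnegrE ?(ltW rho0) //.
      by rewrite le_min !ltW.
    by rewrite ge_min lexx.
by move=> y Uy; rewrite lt_min => /andP[y1 y2]; apply: hf.
Qed.

(** [Q] is not an unknown of the system, but its Jacobian is: a bound on [Q] and the bounds on the
    unknowns, shifted by one order, give the Taylor expansion. *)
Lemma closed_system_analytic (I J H : finType) (u : I -> fn) (ka : J -> fn) (et : H -> fn) Q U V A x0 :
  closed_system u ka et Q U V A -> U x0 ->
  (forall j, anb U (ka j)) -> (forall h, anb V (et h)) ->
  exists2 d : R, 0 < d & forall a, analytic_on (U `&` nball x0 d) (fun x => Q x 0 a).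
Proof.
move=> cs Ux0 aka aet; have [[rU rV UV UVi C1Q] uA cu _] := cs.
have [d1 d10 hu] : exists2 d : R, 0 < d & forall i y, U y -> `|y - x0| < d -> `|u i y| <= `|u i x0| + 1.
  apply: fin_delta => i; have [d d0 h] := econt_bounded (cu i) Ux0.
  by exists d => // d' /andP[_ dd] y Uy yx; apply: h => //; exact: lt_le_trans dd.
have [d2 d20 hQ] : exists2 d : R, 0 < d & forall a y, U y -> `|y - x0| < d -> `|Q y 0 a| <= `|Q x0 0 a| + 1.
  apply: fin_delta => a; have cQ : econt U (fun x => Q x 0 a) by case: (C1Q a).
  have [d d0 h] := econt_bounded cQ Ux0.
  by exists d => // d' /andP[_ dd] y Uy yx; apply: h => //; exact: lt_le_trans dd.
pose d := Num.min d1 d2.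
have d0 : 0 < d by rewrite lt_min d10.
have [K1 K10 hK1] := anb_uniform aka.
have [K2 K20 hK2] := anb_uniform aet.
(* A sum of nonnegative terms, so that it dominates every bound needed. *)
pose K := 1 + K1 + K2 + \sum_i (`|u i x0| + 1) + \sum_a (`|Q x0 0 a| + 1).
have S1 : 0 <= \sum_i (`|u i x0| + 1) by apply: sumr_ge0 => i _; exact: addr_ge0.
have S2 : 0 <= \sum_a (`|Q x0 0 a| + 1) by apply: sumr_ge0 => i _; exact: addr_ge0.
have K1' : 1 <= K by rewrite /K; lra.
have K0 : 0 <= K by lra.
set U2 := U `&` nball x0 d.
have cs2 : closed_system u ka et Q U2 V A := closed_systemS x0 d cs.
have term (T : finType) (F : T -> R) (i : T) (C : R) : (forall i, 0 <= F i) -> \sum_i F i <= C -> F i <= C.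
  by move=> F0; apply: le_trans; rewrite (bigD1 i) //= lerDl sumr_ge0.
have uK i x : U2 x -> `|u i x| <= K.
  move=> [Ux]; rewrite /nball /= /d lt_min => /andP[xd _]; apply: le_trans (hu i x Ux xd) _.
  apply: (term _ (fun i => `|u i x0| + 1)) => [k|]; [exact: addr_ge0|rewrite /K; lra].
have QK a x : U2 x -> `|Q x 0 a| <= K.
  move=> [Ux]; rewrite /nball /= /d lt_min => /andP[_ xd]; apply: le_trans (hQ a x Ux xd) _.
  apply: (term _ (fun a => `|Q x0 0 a| + 1)) => [k|]; [exact: addr_ge0|rewrite /K; lra].
have Bka j m : bnd U2 (fun l => K * (K ^+ l * l`!%:R)) m (ka j).
  by apply: (@bnd_sub _ _ U) => [x []//|]; apply: hK1; rewrite /K; lra.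
have Bet h m : bnd V (fun l => K * (K ^+ l * l`!%:R)) m (et h).
  by apply: hK2; rewrite /K; lra.
have [M M0 BM] := closed_system_bnd K1' K1' cs2 uK Bka Bet.
have rU2 : rdom U2 by apply: rdomI => //; exact: open_nball.
exists d => // a; have M1 : 0 <= M + 1 by lra.
apply: (bnd_analytic rU2 K0 M1) => m.
(* Derivatives of [Q] of order [l.+1] are derivatives of [A] of order [l]; a base [M + 1 >= 1]
   absorbs the shift. *)
have lM l : swt K M l <= K * ((M + 1) ^+ l.+1 * (l.+1)`!%:R).
  rewrite /swt ler_wpM2l // /wt addn0.
  apply: (@le_trans _ _ (M ^+ l * l`!%:R)).
    rewrite ler_piMr ?mulr_ge0 ?exprn_ge0 // exprn_ile1 ?invr_ge0 //.
    by rewrite invf_le1 ?ltr0n // ler1n.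
  apply: ler_pM; rewrite ?exprn_ge0 //.
    apply: (@le_trans _ _ ((M + 1) ^+ l)); first by apply: lerXn2r; rewrite ?nnegrE //; lra.
    by rewrite exprS ler_peMl ?exprn_ge0 //; lra.
  by rewrite ler_nat factS leq_pmull.
apply: bnd_lower; apply/bndS; split; first by move=> x; rewrite expr0 mul1r mulr1; exact: QK.
exists (A ^~ a) => [|i]; first by apply: C1onS (C1Q a) => x [].
by have [al ->] := uA i a; apply: bnd_le (BM m al) => l; exact: lM.
Qed.

End Analytic_systems.

(** * The system of an inverse map *)

Section Inverse_map.
Variables (R : realType) (n : nat).
Notation E := 'rV[R]_n.
Notation fn := (E -> R).
Implicit Types (U V : set E) (f : fn).

(** The unknowns are the entries of [B], with [dB = - B d(A \o Q) B], and the chain rule brings in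
    [B] once more. There are no data at the point itself, hence [void]. *)
Lemma inverse_system U V Q (A B : 'I_n -> 'I_n -> fn) (A1 : 'I_n -> 'I_n -> 'I_n -> fn) :
  admissible_map Q V U B -> (forall i a, C1on U (A i a) (fun l => A1 l i a)) ->
  (forall y, V y -> jac_mx B y *m jac_mx A (Q y) = 1%:M) ->
  closed_system (fun p : 'I_n * 'I_n => B p.1 p.2) (fun f : void => match f with end)
    (fun p : 'I_n * 'I_n * 'I_n => A1 p.1.1 p.1.2 p.2) Q V U B.
Proof.
move=> am C1A BA; have [rV rU VU VUi C1Q] := am; have aP := @adm_cont_class R n.
have CB i a : econt V (B i a) by case: (C1Q a).
have CAQ i a : Ck_with (@cont_class R n) 1 V (A i a \o Q).
  apply: (Ck_comp aP rV rU VU VUi C1Q); first by move=> j b; apply/within_econt.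
  apply/(CkS aP); exists (fun l => A1 l i a) => // l; apply/within_econt.
  by case: (C1A i a).
(* [B] is only known to be continuous, but as the inverse matrix of the $C^1$ function [A \o Q] it
   is $C^1$. *)
have C1B i a : Ck_with (@cont_class R n) 1 V (B i a).
  apply: (@Ck_eq _ _ _ aP _ _ (fun y => invmx (jac_mx A (Q y)) i a)).
    move=> y Vy; have := BA y Vy => h; have [_ uA] := mulmx1_unit h.
    have -> : B i a y = jac_mx B y i a by rewrite mxE.
    by rewrite -[jac_mx B y]mulmx1 -(mulmxV uA) mulmxA h mul1mx.
  apply: Ck_invmx => // [y /BA /mulmx1_unit[] //|j b].
  by apply: (Ck_eq aP) (CAQ j b) => y _; rewrite mxE.
have /boolp.choice[r Hr] : forall p : 'I_n * 'I_n, exists q, C1on V (B p.1 p.2) q.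
  by move=> p; have /(CkS aP)[q ? _] := C1B p.1 p.2; exists q.
have HB i a : C1on V (B i a) (fun l => r (i, a) l) := Hr (i, a).
have HAQ i a := C1on_comp rU VU VUi C1Q (C1A i a).
have BAQ y : V y -> forall i j, \sum_k B i k y * (A k j \o Q) y = (i == j)%:R.
  move=> Vy i j; have /matrixP/(_ i j) := BA y Vy; rewrite !mxE => <-.
  by apply: eq_bigr => k _; rewrite !mxE.
split=> //; first by move=> i a; exists (i, a).
move=> [i j] l /=.
exists (fun y => - \sum_k \sum_p B i k y * (\sum_a B l a y * (A1 a k p \o Q) y) * B p j y).
  have pB i' j' : poly (atoms (fun p : 'I_n * 'I_n => B p.1 p.2) (fun f : void => match f with end)
    (fun p : 'I_n * 'I_n * 'I_n => A1 p.1.1 p.1.2 p.2) Q) (B i' j').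
    by apply: poly_atom; left; exists (i', j').
  apply: poly_opp; do 2!(apply: poly_sum => ?); apply: poly_mul => //; apply: poly_mul => //.
  apply: poly_sum => a; apply: poly_mul => //.
  by apply: poly_atom; right; right; eexists (_, _, _).
move=> y Vy; rewrite -(inverse_der (F1 := fun l i j => r (i, j) l) HB HAQ BAQ l i j Vy).
by case: (HB i j) => _ _; apply.
Qed.

Lemma inverse_Ck P k U V Q (A B : 'I_n -> 'I_n -> fn) :
  adm P -> admissible_map Q V U B -> (forall i a, Ck_with P k.+1 U (A i a)) ->
  (forall y, V y -> jac_mx B y *m jac_mx A (Q y) = 1%:M) ->
  forall a, Ck_with P k.+2 V (fun y => Q y 0 a).
Proof.
move=> aP am CA BA.
have /boolp.choice[A1 HA1] : forall p : 'I_n * 'I_n, exists q, C1on U (A p.1 p.2) q /\ forall l, Ck_with P k U (q l).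
  by move=> p; have /(CkS aP)[q ? ?] := CA p.1 p.2; exists q.
have C1A i a : C1on U (A i a) (fun l => A1 (i, a) l) by case: (HA1 (i, a)).
have cs := inverse_system (A1 := fun l i a => A1 (i, a) l) am C1A BA.
have CB := closed_system_Ck aP cs (fun v : void => match v with end) (fun p => (HA1 (p.1.2, p.2)).2 p.1.1).
move=> a; apply/(CkS aP); exists (B ^~ a); first by case: am => _ _ _ _; apply.
by move=> i; exact: CB (i, a).
Qed.

Lemma inverse_analytic U V Q (A B : 'I_n -> 'I_n -> fn) (Phi : 'I_n -> fn) :
  admissible_map Q V U B -> (forall a, C1on U (Phi a) (A ^~ a)) -> (forall a, analytic_on U (Phi a)) ->
  (forall y, V y -> jac_mx B y *m jac_mx A (Q y) = 1%:M) ->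
  forall a, analytic_on V (fun y => Q y 0 a).
Proof.
move=> am C1A aPhi BA a; apply: analytic_on_local => y0 Vy0.
have [rV rU VU VUi C1Q] := am.
have [d d0 ha] : exists2 d : R, 0 < d & forall b, anb (U `&` nball (Q y0) d) (Phi b).
  apply: fin_delta => b; have [d d0 [K [L [K0 L0 Bf]]]] := analytic_bnd (aPhi b) (VU _ Vy0).
  exists d => // d' /andP[_ dd]; apply: (@anb_sub _ _ (U `&` nball (Q y0) d)); last by exists K, L.
  by move=> y [Uy yd]; split=> //; exact: lt_le_trans dd.
set U1 := U `&` nball (Q y0) d in ha.
have rU1 : rdom U1 by apply: rdomI => //; exact: open_nball.
have cQ b : econt V (fun y => Q y 0 b) by case: (C1Q b).
have [e e0 he] := econt_map cQ Vy0 d0.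
have am1 : admissible_map Q (V `&` nball y0 e) U1 B.
  by apply: admissible_mapS am _ => y [Vy ye]; exact: he.
(* [A] is only given as a derivative of [Phi]; by uniqueness up to the boundary it is the one with
   factorial bounds. *)
have aA i b : anb U1 (A i b).
  have [q C1q aq] := anb_der rU1 (ha b).
  have [K [L [K0 L0 Bq]]] := aq i; exists K, L; split=> // m; apply: bnd_eq (Bq m).
  have C1A' := C1onS (_ : U1 `<=` U) (C1A b).
  have [_ cq dq] := C1q; have [|_ cA dA] := C1A'; first by move=> ? [].
  exact: der_uniq rU1 (cq i) (cA i) (dq i) (dA i).
have /boolp.choice[A1 HA1] : forall p : 'I_n * 'I_n, exists q, C1on U1 (A p.1 p.2) q /\ forall l, anb U1 (q l).
  by move=> p; have [q ? ?] := anb_der rU1 (aA p.1 p.2); exists q.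
have C1A1 i b : C1on U1 (A i b) (fun l => A1 (i, b) l) by case: (HA1 (i, b)).
have BA1 y : (V `&` nball y0 e) y -> jac_mx B y *m jac_mx A (Q y) = 1%:M by move=> [/BA].
have cs := inverse_system (A1 := fun l i a => A1 (i, a) l) am1 C1A1 BA1.
have yy : (V `&` nball y0 e) y0 by split=> //; rewrite /nball /= subrr normr0.
have [d2 d20 h2] := closed_system_analytic cs yy (fun v : void => match v with end)
  (fun p => (HA1 (p.1.2, p.2)).2 p.1.1).
exists (Num.min e d2); first by rewrite lt_min e0.
by rewrite nball_min setIA.
Qed.

End Inverse_map.

(** * Regularity in charts *)

Section Conformal_regularity.
Variables (R : realType) (n : nat).
Notation E := 'rV[R]_n.
Notation fn := (E -> R).
Implicit Types (U V : set E) (f : fn).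

Lemma Ck_tower P k U (g : 'I_n -> 'I_n -> fn) : adm P -> (forall i j, Ck_with P k.+2 U (g i j)) ->
  exists g1 g2, [/\ forall i j, C1on U (g i j) (fun m => g1 m i j),
    forall m i j, C1on U (g1 m i j) (fun l => g2 l m i j),
    forall m i j, Ck_with P k.+1 U (g1 m i j) & forall l m i j, Ck_with P k U (g2 l m i j)].
Proof.
move=> aP Cg.
have /boolp.choice[g1 H1] : forall p : 'I_n * 'I_n, exists q, C1on U (g p.1 p.2) q /\ forall l, Ck_with P k.+1 U (q l).
  by move=> p; have /(CkS aP)[q ? ?] := Cg p.1 p.2; exists q.
have /boolp.choice[g2 H2] : forall p : 'I_n * 'I_n * 'I_n, exists q, C1on U (g1 p.1 p.2) q /\ forall l, Ck_with P k U (q l).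
  by move=> p; have /(CkS aP)[q ? ?] := (H1 p.1).2 p.2; exists q.
exists (fun m i j => g1 (i, j) m), (fun l m i j => g2 (i, j, m) l); split.
- by move=> i j; case: (H1 (i, j)).
- by move=> m i j; case: (H2 (i, j, m)).
- by move=> m i j; case: (H1 (i, j)).
- by move=> l m i j; case: (H2 (i, j, m)).
Qed.

Lemma anb_tower U (g : 'I_n -> 'I_n -> fn) : rdom U -> (forall i j, anb U (g i j)) ->
  exists g1 g2, [/\ forall i j, C1on U (g i j) (fun m => g1 m i j),
    forall m i j, C1on U (g1 m i j) (fun l => g2 l m i j),
    forall m i j, anb U (g1 m i j) & forall l m i j, anb U (g2 l m i j)].
Proof.
move=> rU Cg.
have /boolp.choice[g1 H1] : forall p : 'I_n * 'I_n, exists q, C1on U (g p.1 p.2) q /\ forall l, anb U (q l).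
  by move=> p; have [q ? ?] := anb_der rU (Cg p.1 p.2); exists q.
have /boolp.choice[g2 H2] : forall p : 'I_n * 'I_n * 'I_n, exists q, C1on U (g1 p.1 p.2) q /\ forall l, anb U (q l).
  by move=> p; have [q ? ?] := anb_der rU ((H1 p.1).2 p.2); exists q.
exists (fun m i j => g1 (i, j) m), (fun l m i j => g2 (i, j, m) l); split.
- by move=> i j; case: (H1 (i, j)).
- by move=> m i j; case: (H2 (i, j, m)).
- by move=> m i j; case: (H1 (i, j)).
- by move=> l m i j; case: (H2 (i, j, m)).
Qed.

(* The hypotheses on a conformal map between coordinate domains which do not
   involve the regularity of the metrics. *)
Record conformal_chart U V (Q : E -> E) A A1 A2 (g h : 'I_n -> 'I_n -> fn) c : Prop := ConformalChart {
  cc_map : admissible_map Q U V A;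
  cc_A1 : forall i a, C1on U (A i a) (fun l => A1 l i a);
  cc_A2 : forall l i a, C1on U (A1 l i a) (fun m => A2 m l i a);
  cc_gs : forall x, U x -> forall i j, g i j x = g j i x;
  cc_hs : forall x, V x -> forall i j, h i j x = h j i x;
  cc_gu : forall x, U x -> (\matrix_(i, j) g i j x) \in unitmx;
  cc_c0 : forall x, U x -> c x != 0;
  cc_conf : forall x, U x -> forall i j,
     \sum_a \sum_b A i a x * h a b (Q x) * A j b x = c x * g i j x }.

(** The second jets have order [k], so the closed system gives [A] and [dc] order [k.+1]; the
    first-jet formula for [dA] raises [A] to [k.+2]. *)
Lemma conformal_Ck P k U V Q A A1 A2 g h c : (3 <= n)%N -> adm P ->
  conformal_chart U V Q A A1 A2 g h c ->
  (forall i j, Ck_with P k.+2 U (g i j)) -> (forall i j, Ck_with P k.+2 V (h i j)) ->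
  forall a, Ck_with P k.+3 U (fun x => Q x 0 a).
Proof.
move=> n3 aP [am HA1 HA2 gs hs gu c0 conf] Cg Ch; have [rU rV UV UVi C1Q] := am.
have [g1 [g2 [Hg1 Hg2 Cg1 Cg2]]] := Ck_tower aP Cg.
have [h1 [h2 [Hh1 Hh2 Ch1 Ch2]]] := Ck_tower aP Ch.
have [c1 [cs dA]] := conformal_system n3 am HA1 HA2 Hg1 Hg2 Hh1 Hh2 gs hs gu c0 conf.
have Cu al : Ck_with P k.+1 U (conf_unknowns A (inv_metric g) c c1 al).
  apply: (closed_system_Ck aP cs).
    case=> [[p|p]|p] /=; last exact: Cg2.
      by apply: (Ck_le aP rU _ (Cg p.1 p.2)); rewrite leqW.
    by apply: (Ck_lower aP rU); exact: Cg1.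
  case=> [[p|p]|p] /=; last exact: Ch2.
    by apply: (Ck_le aP rV _ (Ch p.1 p.2)); rewrite leqW.
  by apply: (Ck_lower aP rV); exact: Ch1.
have CA i a : Ck_with P k.+1 U (A i a) := Cu (inl (inl (inl (i, a)))).
(* The recovered derivative: every atom of the formula for [dA] has order [k.+1]. *)
have CA2 i a : Ck_with P k.+2 U (A i a).
  have /boolp.choice[q hq] : forall m, exists q, poly (atoms (conf_unknowns A (inv_metric g) c c1)
      (jet1 g g1) (jet1 h h1) Q) q /\ der U m (A i a) q.
    by move=> m; have [q ? ?] := dA m i a; exists q.
  have CA' j b : Ck_with P k.+1.-1 U (A j b) := Ck_lower aP rU (CA j b).
  have Cq m : Ck_with P k.+1 U (q m).
    apply: (Ck_poly aP rU _ (hq m).1) => f [[al ->]|[[[p|p] ->]|[[p|p] ->]]]; first exact: Cu.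
    - exact: (Ck_lower aP rU (Cg p.1 p.2)).
    - exact: Cg1.
    - exact: (Ck_comp aP rU rV UV UVi C1Q CA' (Ck_lower aP rV (Ch p.1 p.2))).
    - exact: (Ck_comp aP rU rV UV UVi C1Q CA' (Ch1 p.1.1 p.1.2 p.2)).
  apply/(CkS aP); exists q => //; split; first by case: (HA1 i a).
    by move=> m; exact: (Ck_cont aP) (Cq m).
  by move=> m; case: (hq m).
by move=> a; apply/(CkS aP); exists (A ^~ a).
Qed.

Lemma conformal_analytic U V Q A A1 A2 g h c : (3 <= n)%N ->
  conformal_chart U V Q A A1 A2 g h c ->
  (forall i j, analytic_on U (g i j)) -> (forall i j, analytic_on V (h i j)) ->
  forall a, analytic_on U (fun x => Q x 0 a).
Proof.
move=> n3 [am HA1 HA2 gs hs gu c0 conf] ag ah a; apply: analytic_on_local => x0 Ux0.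
have [rU rV UV UVi C1Q] := am.
have loc W (f : 'I_n -> 'I_n -> fn) z0 : (forall i j, analytic_on W (f i j)) -> W z0 ->
    exists2 d : R, 0 < d & forall p : 'I_n * 'I_n, anb (W `&` nball z0 d) (f p.1 p.2).
  move=> af Wz; apply: fin_delta => p; have [d d0 [K [L [K0 L0 Bf]]]] := analytic_bnd (af p.1 p.2) Wz.
  exists d => // d' /andP[_ dd]; apply: (@anb_sub _ _ (W `&` nball z0 d)); last by exists K, L.
  by move=> y [Wy yd]; split=> //; exact: lt_le_trans dd.
have [e e0 ahb] := loc V h (Q x0) ah (UV _ Ux0).
have [d1 d10 agb] := loc U g x0 ag Ux0.
have cQ b : econt U (fun y => Q y 0 b) by case: (C1Q b).
have [d2 d20 hQ] := econt_map cQ Ux0 e0.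
pose d := Num.min d1 d2; have d0 : 0 < d by rewrite lt_min d10.
set U1 := U `&` nball x0 d; set V1 := V `&` nball (Q x0) e in ahb.
have U1U : U1 `<=` U by move=> x [].
have V1V : V1 `<=` V by move=> x [].
have am1 : admissible_map Q U1 V1 A.
  apply: admissible_mapS am _ => y [Uy]; rewrite /nball /= /d lt_min => /andP[_ yd].
  exact: hQ.
have rU1 := am_rdom am1; have rV1 := am_rdom' am1.
have ag1 i j : anb U1 (g i j).
  apply: anb_sub (agb (i, j)) => y [Uy]; rewrite /nball /= /d lt_min => /andP[yd _]; by split.
have [g1 [g2 [Hg1 Hg2 Ag1 Ag2]]] := anb_tower rU1 ag1.
have [h1 [h2 [Hh1 Hh2 Ah1 Ah2]]] := anb_tower rV1 (fun i j => ahb (i, j)).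
have [c1 [cs _]] := conformal_system n3 am1 (fun i a => C1onS U1U (HA1 i a))
  (fun l i a => C1onS U1U (HA2 l i a)) Hg1 Hg2 Hh1 Hh2 (fun x Ux => gs x (U1U _ Ux))
  (fun x Vx => hs x (V1V _ Vx)) (fun x Ux => gu x (U1U _ Ux)) (fun x Ux => c0 x (U1U _ Ux))
  (fun x Ux => conf x (U1U _ Ux)).
have U1x : U1 x0 by split=> //; rewrite /nball /= subrr normr0.
have [] := closed_system_analytic cs U1x.
- by case=> [[p|p]|p] /=; [exact: ag1|exact: Ag1|exact: Ag2].
- by case=> [[p|p]|p] /=; [exact: ahb (p.1, p.2)|exact: Ah1|exact: Ah2].
move=> d' d'0 h'; exists (Num.min d d'); first by rewrite lt_min d0.
by rewrite nball_min setIA.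
Qed.

End Conformal_regularity.

(** * Charts and manifolds *)

Section Charts.
Variables (R : realType) (n : nat).
Notation E := 'rV[R]_n.

Lemma within_nbhs (X Y : topologicalType) (A : set X) (f : X -> Y) p (B : set Y) :
  {within A, continuous f} -> A p -> nbhs (f p) B -> nbhs p [set q | A q -> B (f q)].
Proof. by move=> /subspace_continuousP h Ap nB; exact: h p Ap B nB. Qed.

Lemma chart_rdom (M : topologicalType) (d : chart R n M) : rdom (cimage d).
Proof. exact: rdomP (cimage_open d). Qed.

Lemma cimageK (M : topologicalType) (d : chart R n M) x : cimage d x -> d (cinv d x) = x /\ cdom d (cinv d x).
Proof. by move=> [p dp <-]; rewrite cfunK. Qed.

Variables (M N : topologicalType).
Implicit Types (F : M -> N) (d : chart R n M) (e : chart R n N).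

Lemma rep_dom_cimage A F d e : rep_dom A F d e `<=` cimage d.
Proof. by move=> x []. Qed.

Lemma rep_image A F d e x : rep_dom A F d e x -> cimage e (rep F d e x).
Proof. by move=> [_ [_ /= ?]]; exists (F (cinv d x)). Qed.

Lemma nbhs_chart d x (B : set M) : cimage d x -> nbhs (cinv d x) B ->
  nbhs x [set y | cimage d y -> B (cinv d y)].
Proof. by move=> dx nB; exact: (within_nbhs (@cinv_continuous _ _ _ d) dx nB). Qed.

Lemma nbhs_rep_source A F e p : open A -> {within A, continuous F} -> A p -> cdom e (F p) ->
  nbhs p (A `&` F @^-1` cdom e).
Proof.
move=> oA cF Ap Fp; have nA : nbhs p A by exact: open_nbhs_nbhs.
have ne : nbhs (F p) (cdom e) by apply: open_nbhs_nbhs; split=> //; exact: cdom_open.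
by have := within_nbhs cF Ap ne; apply: filterS2 nA => q Aq /(_ Aq).
Qed.

Lemma rep_dom_rdom A F d e : open A -> {within A, continuous F} -> rdom (rep_dom A F d e).
Proof.
move=> oA cF.
(* [cinv] is meaningful only on the image of the chart, so the condition is stated as an
   implication; this gives a neighbourhood of each point of the domain, and its interior is the open
   set sought. *)
pose W : set E := [set y | cimage d y -> (A `&` F @^-1` cdom e) (cinv d y)]°.
have -> : rep_dom A F d e = cimage d `&` W.
  apply/seteqP; split=> x [dx hx]; split=> //; last exact: (interior_subset hx).
  apply: nbhs_chart => //; case: hx => Ax Fx; exact: nbhs_rep_source.
by apply: rdomI; [exact: chart_rdom|exact: open_interior].
Qed.

Lemma rep_cont A F d e a : open A -> {within A, continuous F} ->
  econt (rep_dom A F d e) (fun x => rep F d e x 0 a).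
Proof.
move=> oA cF x [dx [Ax Fx]] eps eps0.
have n1 : nbhs (e (F (cinv d x))) [set y | `|y - e (F (cinv d x))| < eps].
  by apply/nbhs_normE; exists eps.
have n2 := within_nbhs (@cfun_continuous _ _ _ e) Fx n1.
have n3 := within_nbhs cF Ax n2.
have /nbhs_normE[de de0 hde] := nbhs_chart dx n3.
exists de => // y [dy [Ay Fy]] yx; have := hde y yx dy Ay Fy => /=.
by apply: le_lt_trans; have := coord_le (rep F d e y - rep F d e x) a; rewrite !mxE.
Qed.

End Charts.

Section Jets_of_maps.
Variables (R : realType) (n : nat).
Notation E := 'rV[R]_n.
Notation fn := (E -> R).
Notation CK := (Ck_with (@cont_class R n)).

Lemma C3_jets (U : set E) (Q : E -> E) : (forall a, CK 3 U (fun x => Q x 0 a)) ->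
  exists A A1 A2, [/\ forall a, C1on U (fun x => Q x 0 a) (A ^~ a),
    forall i a, C1on U (A i a) (fun l => A1 l i a) &
    forall l i a, C1on U (A1 l i a) (fun m => A2 m l i a)].
Proof.
have aP := @adm_cont_class R n.
move=> CQ; have /boolp.choice[q Hq] : forall a, exists q, C1on U (fun x => Q x 0 a) q /\ forall i, CK 2 U (q i).
  by move=> a; have /(CkS aP)[q ? ?] := CQ a; exists q.
have [A1 [A2 [H1 H2 _ _]]] := Ck_tower aP (fun i a => (Hq a).2 i).
by exists (fun i a => q a i), A1, A2; split=> // a; case: (Hq a).
Qed.

Lemma Ck_derivative P k (U : set E) (f : fn) q : adm P -> rdom U -> C1on U f q -> Ck_with P k.+1 U f ->
  forall i, Ck_with P k U (q i).
Proof.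
move=> aP rU [_ cq dq] /(CkS aP)[r [_ cr dr] Cr] i.
by apply: (Ck_eq aP _ (Cr i)); exact: der_uniq rU (cr i) (cq i) (dr i) (dq i).
Qed.

Lemma analytic_onS (U V : set E) f : V `<=` U -> analytic_on U f -> analytic_on V f.
Proof.
move=> VU af x Vx; have [a [rho [? ? h]]] := af x (VU _ Vx); exists a, rho; split=> // y /VU; exact: h.
Qed.

Lemma posdef_unit (G : 'M[R]_n) : (forall v : E, v != 0 -> 0 < (v *m G *m v^T) 0 0) -> G \in unitmx.
Proof.
move=> pG; rewrite unitmxE unitfE; apply/negP => /det0P[v v0 vG].
by have := pG v v0; rewrite vG mul0mx mxE ltxx.
Qed.

End Jets_of_maps.

Section Maps.
Variables (R : realType) (n : nat) (s t : regularity R) (M : manifold n s) (N : manifold n t).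
Implicit Types (F : M -> N) (d : chart R n M) (e : chart R n N).

Lemma local_inverse_jacobian F d e U G A B x : atlas d -> atlas e ->
  {within setT, continuous F} -> local_inverse U F G -> {within F @` U, continuous G} ->
  (forall a, C1on (rep_dom setT F d e) (fun x => rep F d e x 0 a) (A ^~ a)) ->
  (forall a, C1on (rep_dom (F @` U) G e d) (fun x => rep G e d x 0 a) (B ^~ a)) ->
  rep_dom U F d e x -> jac_mx A x *m jac_mx B (rep F d e x) = 1%:M.
Proof.
move=> da ea cF [oU oFU GF] cG C1A C1B Ux.
have cFU : {within U, continuous F} by exact: continuous_subspaceW cF.
have UT : rep_dom U F d e `<=` rep_dom setT F d e by move=> y [dy [_ Fy]].
have rU := rep_dom_rdom d e oU cFU.
have rT := rep_dom_rdom d e openT cF.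
have rV := rep_dom_rdom e d oFU cG.
have UV y : rep_dom U F d e y -> rep_dom (F @` U) G e d (rep F d e y).
  move=> [dy [Uy Fy]]; have [dK dc] := cimageK dy.
  split; first by exists (F (cinv d y)).
  by rewrite /rep /= cfunK //; split; [exists (cinv d y)|rewrite /preimage /= GF].
have SQ y : rep_dom U F d e y -> rep G e d (rep F d e y) = y.
  move=> [dy [Uy Fy]]; have [dK dc] := cimageK dy.
  by rewrite /rep /= cfunK // GF.
apply: (jacobian_inverse rU Ux UV SQ).
  by apply: C1on_jacobian => // a; apply: C1onS (C1A a).
by apply: C1on_jacobian => //; exact: UV.
Qed.

End Maps.

Section Classes_of_maps.
Variables (R : realType) (n : nat).
Notation E := 'rV[R]_n.
Notation fn := (E -> R).
Implicit Types (U V : set E) (r : regularity R).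

Lemma conformal_class r U U0 V Q A A1 A2 g h c : (3 <= n)%N -> metric_regularity r ->
  conformal_chart U V Q A A1 A2 g h c -> U `<=` U0 ->
  (forall i j, of_class r U0 (g i j)) -> (forall i j, of_class r V (h i j)) ->
  forall a, of_class (rsucc r) U (fun x => Q x 0 a).
Proof.
move=> n3; have aP := @adm_cont_class R n; case: r => [//|k al|//|//].
- move=> [k2 al01] cc UU gr hr a; have aH := adm_holder n al01.
  case: k k2 gr hr => [//|[//|k]] _ gr hr.
  by apply: (conformal_Ck n3 aH cc) => i j; [exact: Ck_sub aH _ _ _ _ UU (gr i j)|exact: hr].
- move=> _ cc UU gr hr a k; have [rU _ _ _ _] := cc_map cc.
  apply: (Ck_le aP rU (_ : (k <= k.+3)%N)); first by do 3!apply: leqW.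
  by apply: (conformal_Ck n3 aP cc) => i j; [exact: Ck_sub aP _ _ _ _ UU (gr i j _)|exact: hr].
- move=> _ cc UU gr hr a; apply: (conformal_analytic n3 cc) => i j; last exact: hr.
  exact: analytic_onS UU (gr i j).
Qed.

Lemma inverse_class r U V Q (A B : 'I_n -> 'I_n -> fn) (Phi : 'I_n -> fn) : metric_regularity r ->
  admissible_map Q V U B -> (forall a, C1on U (Phi a) (A ^~ a)) ->
  (forall y, V y -> jac_mx B y *m jac_mx A (Q y) = 1%:M) ->
  (forall a, of_class (rsucc r) U (Phi a)) -> forall a, of_class (rsucc r) V (fun y => Q y 0 a).
Proof.
have aP := @adm_cont_class R n; move=> + am C1A BA; have rU := am_rdom' am; have rV := am_rdom am.
case: r => [//|k al|//|//].
- move=> [k2 al01] regF a; have aH := adm_holder n al01.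
  case: k k2 regF => [//|k] _ regF.
  apply: (inverse_Ck aH am _ BA) => i b.
  have CP : Ck_with (locally_holder al) k.+2 U (Phi b) := regF b.
  exact: Ck_derivative aH rU (C1A b) CP i.
- move=> _ regF a k; apply: (Ck_le aP rV (_ : (k <= k.+2)%N)); first by do 2!apply: leqW.
  by apply: (inverse_Ck aP am _ BA) => i b; exact: (Ck_derivative aP rU (C1A b) (regF b _)).
- by move=> _ regF a; exact: (inverse_analytic am C1A regF BA).
Qed.

End Classes_of_maps.

(** * Conformal maps between manifolds and their local inverses *)

Section Regularity_of_conformal_maps.
Variables (R : realType) (n : nat) (r : regularity R).
Variables (M N : manifold n (rsucc r)) (g : metric r M) (h : metric r N) (F : M -> N).
Notation e_ := (@basis_vec R n).
Notation CK := (Ck_with (@cont_class R n)).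
Hypotheses (n3 : (3 <= n)%N) (hr : metric_regularity r)
  (hF : local_diffeo (Ck 3) F) (hconf : conformal g h F).

Let cF : {within setT, continuous F}. Proof. by case: hF => -[]. Qed.

Lemma rep_C3 d e : atlas d -> atlas e -> forall a, CK 3 (rep_dom setT F d e) (fun x => rep F d e x 0 a).
Proof. by move=> da ea a; case: hF => -[_ h3] _; exact: h3. Qed.

Lemma rep_invertible (d : chart R n M) (e : chart R n N) A x : atlas d -> atlas e ->
  (forall a, C1on (rep_dom setT F d e) (fun x => rep F d e x 0 a) (A ^~ a)) ->
  rep_dom setT F d e x -> exists B, jac_mx A x *m B = 1%:M.
Proof.
move=> da ea C1A [dx [_ Fx]]; have [_ hG] := hF.
have [U [G [Ux [oU oFU GF] [cG G3]]]] := hG (cinv d x).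
have [B [_ [_ [C1B _ _]]]] := C3_jets (G3 e d ea da).
exists (jac_mx B (rep F d e x)).
by apply: (local_inverse_jacobian (U := U) (G := G) da ea cF _ cG C1A C1B).
Qed.

Lemma conformal_chart_of_map (d : chart R n M) (e : chart R n N) : atlas d -> atlas e ->
  exists A A1 A2 c, conformal_chart (rep_dom setT F d e) (cimage e) (rep F d e) A A1 A2
    (fun i j x => g d x i j) (fun i j x => h e x i j) c.
Proof.
move=> da ea; have [A [A1 [A2 [C1A HA1 HA2]]]] := C3_jets (rep_C3 da ea).
have rU := rep_dom_rdom d e openT cF; have rV := chart_rdom e.
set U := rep_dom setT F d e in C1A HA1 HA2 rU *.
have UV y : U y -> cimage e (rep F d e y) by exact: rep_image.
have [cM hcM] := hconf.
have hU x : U x -> jac_mx A x *m h e (rep F d e x) *m (jac_mx A x)^T = cM (cinv d x) *: g d x.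
  move=> Ux; have [dx [_ Fx]] := Ux; have [dK dc] := cimageK dx.
  have := hcM _ d e da ea dc Fx; rewrite dK /pullback.
  by rewrite (C1on_jacobian_within rU C1A Ux).
exists A, A1, A2, (fun x => cM (cinv d x)); split=> //.
- split=> // x Ux; have [B AB] := rep_invertible da ea C1A (interior_subset Ux).
  exact: (interior_map rU rV UV C1A Ux AB).
- by move=> x [dx _] i j; have := metric_sym g da dx => /matrixP/(_ i j); rewrite mxE.
- by move=> x ex i j; have := metric_sym h ea ex => /matrixP/(_ i j); rewrite mxE.
- move=> x [dx _]; have -> : \matrix_(i, j) g d x i j = g d x by apply/matrixP => i j; rewrite mxE.
  by apply: posdef_unit; exact: (metric_pos g da dx).
(* If [c] vanished, inverting [A] in [A h A^T = 0] would give [h = 0], against positivity on a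
   nonzero vector. *)
- move=> x Ux; apply/eqP => c0; have := hU x Ux; rewrite c0 scale0r => J0.
  have [B AB] := rep_invertible da ea C1A Ux; have BA := mulmx1C AB.
  have h0 : h e (rep F d e x) = 0.
    have BAT : (jac_mx A x)^T *m B^T = 1%:M by rewrite -trmx_mul BA trmx1.
    rewrite -[LHS]mul1mx -BA -[LHS]mulmx1 -BAT -[_ *m (_ *m _)]mulmxA.
    by rewrite !mulmxA -[B *m _ *m _]mulmxA -[B *m _ *m _]mulmxA J0 mulmx0 mul0mx.
  have n0 : (0 < n)%N by exact: leq_trans n3.
  have v0 : e_ (Ordinal n0) != 0.
    apply/eqP => /rowP/(_ (Ordinal n0)); rewrite /basis_vec !mxE !eqxx => /eqP; by rewrite oner_eq0.
  by have := metric_pos h ea (UV _ Ux) v0; rewrite h0 mulmx0 mul0mx mxE ltxx.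
- move=> x Ux i j; have := hU x Ux => /matrixP/(_ i j); rewrite !mxE => <-.
  rewrite exchange_big /=; apply: eq_bigr => b _; rewrite !mxE big_distrl /=.
  by apply: eq_bigr => a _; rewrite !mxE.
Qed.

Theorem conformal_map_regularity (d : chart R n M) (e : chart R n N) a : atlas d -> atlas e ->
  of_class (rsucc r) (rep_dom setT F d e) (fun x => rep F d e x 0 a).
Proof.
move=> da ea; have [A [A1 [A2 [c cc]]]] := conformal_chart_of_map da ea.
apply: (conformal_class n3 hr cc (@rep_dom_cimage R n M N setT F d e)) => i j.
  exact: (@metric_class _ _ _ _ _ g d da i j).
exact: (@metric_class _ _ _ _ _ h e ea i j).
Qed.

Section Local_inverse.
Variables (U : set M) (G : N -> M).
Hypothesis (hG : local_inverse U F G).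

(** [G] carries no regularity assumption. The $C^3$ inverse [G'] is continuous, so near [q] its
    values lie in [U], where [G] undoes [F] as well; hence both agree there. *)
Lemma local_inverse_C3 q : (F @` U) q -> exists U' G', [/\ U' (G q), local_inverse U' F G',
  map_of_class (Ck 3) (F @` U') G' & nbhs q [set q' | (F @` U') q' /\ G q' = G' q']].
Proof.
move=> [p Up <-]; have [oU oFU GF] := hG; have [_ hloc] := hF.
have [U' [G' [U'p [oU' oFU' GF'] G3]]] := hloc p.
exists U', G'; split=> //; first by rewrite GF.
have cG' := G3.1.
have Fp : (F @` U') (F p) by exists p.
have nU : nbhs (G' (F p)) U by rewrite GF' //; apply: open_nbhs_nbhs.
have n1 := within_nbhs cG' Fp nU.
have n2 : nbhs (F p) (F @` U') by apply: open_nbhs_nbhs.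
apply: filterS2 n1 n2 => q' h1 h2; split=> //; have Uq := h1 h2.
by case: h2 Uq => p' U'p' <-; rewrite GF' // => Up'; rewrite GF.
Qed.

Lemma local_inverse_continuous : {within F @` U, continuous G}.
Proof.
apply/subspace_continuousP => q Fq B nB.
have [U' [G' [U'q _ [cG' _] nq]]] := local_inverse_C3 Fq.
have [F'q Gq] := nbhs_singleton nq.
have nB' : nbhs (G' q) B by rewrite -Gq.
have n1 := within_nbhs cG' F'q nB'.
rewrite /within /=; apply: filterS2 n1 nq => q' h1 [F'q' Gq'] _.
by have := h1 F'q'; rewrite -Gq'.
Qed.

Variables (e : chart R n N) (d : chart R n M).
Hypotheses (ea : atlas e) (da : atlas d).
Notation V2 := (rep_dom (F @` U) G e d).
Notation U1 := (rep_dom setT F d e).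

Lemma local_inverse_rep y : V2 y -> U1 (rep G e d y) /\ rep F d e (rep G e d y) = y.
Proof.
move=> [ey [Fq Gd]]; have [eK ec] := cimageK ey; have [_ _ GF] := hG.
have [p Up pE] := Fq; have Gp : G (cinv e y) = p by rewrite -pE GF.
have dp : cdom d p by move: Gd; rewrite /preimage /= Gp.
have cp : cinv d (rep G e d y) = p by rewrite /rep /= Gp cfunK.
split; last by rewrite {1}/rep /= cp pE.
split; first by exists (G (cinv e y)).
by rewrite /preimage /= cp; split=> //; rewrite pE.
Qed.

(** [B] is defined as an inverse matrix, which makes it continuous up to the boundary; that it is
    the derivative of the inverse has to be checked at interior points only, against the local $C^3$
    inverses. *)
Lemma local_inverse_admissible A : (forall a, C1on U1 (fun x => rep F d e x 0 a) (A ^~ a)) ->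
  let B i a y := invmx (jac_mx A (rep G e d y)) i a in
  admissible_map (rep G e d) V2 U1 B /\
  (forall y, V2 y -> jac_mx B y *m jac_mx A (rep G e d y) = 1%:M).
Proof.
move=> C1A B; have [oU oFU GF] := hG; have aP := @adm_cont_class R n.
have cG := local_inverse_continuous.
have rU := rep_dom_rdom d e openT cF.
have rV : rdom V2 := rep_dom_rdom e d oFU cG.
have uA y : V2 y -> jac_mx A (rep G e d y) \in unitmx.
  move=> /local_inverse_rep[Uy _]; have [B' AB] := rep_invertible da ea C1A Uy.
  by have [] := mulmx1_unit AB.
have jB y : jac_mx B y = invmx (jac_mx A (rep G e d y)) by apply/matrixP => i a; rewrite mxE.
have BA y : V2 y -> jac_mx B y *m jac_mx A (rep G e d y) = 1%:M.
  by move=> Vy; rewrite jB mulVmx // uA.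
have cS a : econt V2 (fun y => rep G e d y 0 a) by exact: rep_cont.
have VU y : V2 y -> U1 (rep G e d y) by move=> /local_inverse_rep[].
have cAS i a : econt V2 (fun y => jac_mx A (rep G e d y) i a).
  have : econt V2 (A i a \o rep G e d) by apply: (econt_comp _ VU cS); case: (C1A a).
  by apply: eq_econt => y _; rewrite mxE.
have cB i a : econt V2 (B i a).
  have := @Ck_invmx R n 0 V2 n (fun y => jac_mx A (rep G e d y)) rV uA.
  by move=> /(_ (fun i a => (within_econt _ _).2 (cAS i a)) i a)/(within_econt _ _).1.
have C1B a : C1on V2 (fun y => rep G e d y 0 a) (B ^~ a).
  split=> // i y Vy; have Vy' := interior_subset Vy.
  have [ey [Fq Gd]] := Vy'; have [U' [G' [U'q lG' [cG' G3] nq]]] := local_inverse_C3 Fq.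
  have [B' [_ [_ [C1B' _ _]]]] := C3_jets (G3 e d ea da).
  have nV : nbhs y V2 by [].
  have same : nbhs y [set z | rep_dom (F @` U') G' e d z /\ rep G' e d z = rep G e d z].
    apply: filterS2 nV (nbhs_chart ey nq) => z [ez [Fz Gz]] /(_ ez)[F'z GG'].
    split; last by rewrite /rep /= GG'.
    by split=> //; split=> //; rewrite /preimage /= -GG'.
  have [Vy2 Sy] := nbhs_singleton same.
  have Vi : (rep_dom (F @` U') G' e d)° y by apply: filterS same => z [].
  (* The Jacobian of the $C^3$ inverse is a right inverse of [A] at this point, and [B] is a left
     inverse. *)
  have BB' : B i a y = B' i a y.
    have [Uy Fy] := local_inverse_rep Vy'.
    have U'y : rep_dom U' F d e (rep G e d y).
      have [dy [_ Fy']] := Uy; split=> //; split=> //.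
      by rewrite /rep /= cfunK.
    have := local_inverse_jacobian da ea cF lG' cG' C1A C1B' U'y; rewrite Fy => AB.
    have -> : B i a y = jac_mx B y i a by rewrite mxE.
    rewrite -[jac_mx B y]mulmx1 -AB mulmxA (BA y Vy') mul1mx mxE //.
  have [_ _ /(_ i y Vi)] := C1B' a; rewrite -BB'; apply: near_eq_is_derive.
  by apply: filterS same => z [_ ->].
split=> //; split=> // y Vy.
exact: (interior_map rV rU VU C1B Vy (BA y (interior_subset Vy))).
Qed.

Theorem local_inverse_regularity a :
  of_class (rsucc r) V2 (fun y => rep G e d y 0 a).
Proof.
have [A [_ [_ [C1A _ _]]]] := C3_jets (rep_C3 da ea).
have [am BA] := local_inverse_admissible C1A.
apply: (inverse_class hr am C1A BA) => b; exact: conformal_map_regularity.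
Qed.

End Local_inverse.
End Regularity_of_conformal_maps.

Theorem theorem1p1 (R : realType) (n : nat) (r : regularity R)
  (M N : manifold n (rsucc r)) (g : metric r M) (h : metric r N) (F : M -> N)
  (hn : (3 <= n)%N)
  (hr : metric_regularity r)
  (hF : local_diffeo (Ck 3) F)
  (hconf : conformal g h F)
  (hbd : boundary M !=set0 ->
         boundary N !=set0 /\ F @` boundary M `<=` boundary N) :
  map_of_class (rsucc r) setT F /\
  forall (U : set M) (G : N -> M), local_inverse U F G ->
    map_of_class (rsucc r) (F @` U) G.
Proof.
split.
  split; first by case: hF => -[].
  by move=> d e da ea a; exact: (conformal_map_regularity hn hr hF hconf a da ea).
move=> U G hG; split; first exact: (local_inverse_continuous hF hG).
move=> e d ea da a.
exact: (local_inverse_regularity hn hr hF hconf hG ea da a).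
Qed.
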